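(* For each integer $s\geq 3$ define a word $W(x,y)=W_s(x,y)$ by $$W(x,y)= x y^4 x y^5 x\cdots x y^{4+s} x=\Bigl(\prod_{i=4}^{4+s} x y^{i}\Bigr)x$$ (the product being taken in increasing order of $i$ from left to right), and let $G_s$ be the group with presentation $$G_s=\left\langle a,b,t \;\middle|\; t^{-1}at=b,\ t^{-1}bt = W(b,a)\,b\,(W(a,b))^{-1}\right\rangle .$$ Then for every $s\ge 3$ the group $G_s$ is free-by-cyclic and contains a subgroup that is locally free but not free. Moreover, for all sufficiently large $s$, the group $G_s$ is word-hyperbolic.
   Context: A group is locally free if every finitely generated subgroup of it is free. A group is free-by-cyclic if it has a free normal subgroup with cyclic quotient. Word-hyperbolic means hyperbolic in the sense of Gromov. $W(b,a)$ (respectively $W(a,b)$) denotes the word obtained from $W(x,y)$ by substituting $x=b,\ y=a$ (respectively $x=a,\ y=b$). *)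

(* Defs.v *)
(* A subgroup of G : groupType is a classical set [set G] satisfying
   [subgroup]; freeness and local freeness are predicates on such sets. *)
From HB Require Import structures.
From mathcomp Require Import all_boot all_order all_algebra.
From mathcomp Require Import boolp classical_sets functions cardinality.

Set Implicit Arguments.
Unset Strict Implicit.
Unset Printing Implicit Defensive.

Import Order.TTheory GRing.Theory Num.Theory.
Local Open Scope quotient_scope.
Local Open Scope classical_set_scope.
Local Open Scope group_scope.

Definition subgroup (G : groupType) (H : set G) : Prop :=
  H 1 /\ forall x y, H x -> H y -> H (x / y).

Definition normal_subgroup (G : groupType) (N : set G) : Prop :=
  subgroup N /\ forall x g, N x -> N (x ^ g).

Definition generated (G : groupType) (S : set G) : set G :=
  \bigcap_(H in [set H | subgroup H /\ S `<=` H]) H.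

Definition normal_closure (G : groupType) (S : set G) : set G :=
  \bigcap_(N in [set N | normal_subgroup N /\ S `<=` N]) N.

Definition cyclic_group (G : groupType) : Prop :=
  exists g : G, generated [set g] = setT.

Section FreeGroup.
Variable X : choiceType.

(* The letter (x, false) stands for x, and (x, true) for its inverse. *)
Definition word := seq (X * bool).

Inductive free_eq : word -> word -> Prop :=
| free_eq_refl u : free_eq u u
| free_eq_sym u v : free_eq u v -> free_eq v u
| free_eq_trans v u w : free_eq u v -> free_eq v w -> free_eq u w
| free_eq_cancel u x e v : free_eq (u ++ [:: (x, e), (x, ~~ e) & v]) (u ++ v).

Lemma free_eqb_equiv : equiv_class_of (fun u v : word => `[< free_eq u v >]).
Proof.
split=> [u|u v|v u w].
- exact/asboolP/free_eq_refl.
- by apply/asboolP/asboolP; apply: free_eq_sym.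
- by move=> /asboolP uv /asboolP vw; apply/asboolP/(free_eq_trans uv).
Qed.
Canonical free_equiv := EquivRelPack free_eqb_equiv.

Definition free_group := {eq_quot free_equiv}.
HB.instance Definition _ := Choice.on free_group.
HB.instance Definition _ := EqQuotient.on free_group.

Let inv_word (u : word) : word := rev [seq (p.1, ~~ p.2) | p <- u].

Definition free_one : free_group := \pi_free_group [::].
Definition free_mul (x y : free_group) : free_group :=
  \pi_free_group (repr x ++ repr y).
Definition free_inv (x : free_group) : free_group :=
  \pi_free_group (inv_word (repr x)).
Definition free_gen (x : X) : free_group := \pi_free_group [:: (x, false)].

Let free_eq_pi u v : free_eq u v -> \pi_free_group u = \pi_free_group v.
Proof. by move=> uv; apply/eqmodP/asboolP. Qed.

Let free_eq_repr u : free_eq (repr (\pi_free_group u)) u.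
Proof. by apply/asboolP; apply/(eqmodP free_equiv); rewrite reprK. Qed.

Let free_eq_catl w u v : free_eq u v -> free_eq (w ++ u) (w ++ v).
Proof.
elim=> [{}u|{}u {}v _|{}v {}u z _ uv _|{}u x e {}v].
- exact: free_eq_refl.
- exact: free_eq_sym.
- exact: free_eq_trans.
- by rewrite !catA; apply: free_eq_cancel.
Qed.

Let free_eq_catr w u v : free_eq u v -> free_eq (u ++ w) (v ++ w).
Proof.
elim=> [{}u|{}u {}v _|{}v {}u z _ uv _|{}u x e {}v].
- exact: free_eq_refl.
- exact: free_eq_sym.
- exact: free_eq_trans.
- by rewrite -!catA; apply: free_eq_cancel.
Qed.

Let free_eq_invl u : free_eq (inv_word u ++ u) [::].
Proof.
elim: u => [|[x e] u IHu]; first exact: free_eq_refl.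
rewrite /inv_word /= rev_cons cat_rcons; apply: free_eq_trans IHu.
by have:= free_eq_cancel (inv_word u) x (~~ e) u; rewrite negbK.
Qed.

Let free_eq_invr u : free_eq (u ++ inv_word u) [::].
Proof.
elim: u => [|[x e] u IHu]; first exact: free_eq_refl.
rewrite /inv_word /= rev_cons -cats1 -cat1s -/(inv_word u).
apply: (free_eq_trans (v := [:: (x, e)] ++ [:: (x, ~~ e)])).
  by apply: free_eq_catl; rewrite catA; apply: (free_eq_catr _ IHu).
exact: (free_eq_cancel [::] x e [::]).
Qed.

Let free_mulA : associative free_mul.
Proof.
move=> x y z; apply: free_eq_pi.
apply: free_eq_trans (free_eq_catl _ (free_eq_repr _)) _; rewrite catA.
exact/free_eq_catr/free_eq_sym/free_eq_repr.
Qed.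

Let free_mul1 : left_id free_one free_mul.
Proof.
move=> x; rewrite -[RHS]reprK; apply: free_eq_pi.
exact/(free_eq_catr _ (free_eq_repr [::])).
Qed.

Let free_mul1r : right_id free_one free_mul.
Proof.
move=> x; rewrite -[RHS]reprK; apply: free_eq_pi.
by have:= free_eq_catl (repr x) (free_eq_repr [::]); rewrite cats0.
Qed.

Let free_mulV : left_inverse free_one free_inv free_mul.
Proof.
move=> x; apply: free_eq_pi.
exact: free_eq_trans (free_eq_catr _ (free_eq_repr _)) (free_eq_invl _).
Qed.

Let free_mulVr : right_inverse free_one free_inv free_mul.
Proof.
move=> x; apply: free_eq_pi.
exact: free_eq_trans (free_eq_catl _ (free_eq_repr _)) (free_eq_invr _).
Qed.

HB.instance Definition _ := isGroup.Build free_group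
  free_mulA free_mul1 free_mul1r free_mulV free_mulVr.

End FreeGroup.

Lemma normal_closure_normal (G : groupType) (S : set G) :
  normal_subgroup (normal_closure S).
Proof.
split; first split=> [N [[[]]]//|x y Sx Sy N NP].
  by have [[[_ NB] _] _] := NP; apply: NB; [apply: Sx|apply: Sy].
by move=> x g Sx N NP; have [[_ NJ] _] := NP; apply: NJ; apply: Sx.
Qed.

Section Quotient.
Variables (G : groupType) (S : set G).
Local Notation N := (normal_closure S).

Let N1 : N 1. Proof. by have [[]] := normal_closure_normal S. Qed.
Let ND x y : N x -> N y -> N (x / y).
Proof. by have [[_ +] _] := normal_closure_normal S; apply. Qed.
Let NJ x g : N x -> N (x ^ g).
Proof. by have [_ +] := normal_closure_normal S; apply. Qed.
Let NV x : N x -> N x^-1.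
Proof. by move=> Nx; have := ND N1 Nx; rewrite mul1g. Qed.
Let NM x y : N x -> N y -> N (x * y).
Proof. by move=> Nx /NV Ny; have := ND Nx Ny; rewrite invgK. Qed.

Lemma coset_equiv : equiv_class_of (fun x y : G => `[< N (x^-1 * y) >]).
Proof.
split=> [x|x y|y x z].
- by apply/asboolP; rewrite mulVg.
- by apply/asboolP/asboolP => /NV; rewrite invgM invgK.
- move=> /asboolP Nxy /asboolP Nyz; apply/asboolP.
  by have := NM Nxy Nyz; rewrite mulgA mulgK.
Qed.
Canonical coset_equiv_rel := EquivRelPack coset_equiv.

(* The quotient of G by the normal closure of S; this is G / S in the usual
   sense when S is a normal subgroup. *)
Definition quotient_group := {eq_quot coset_equiv_rel}.
HB.instance Definition _ := Choice.on quotient_group.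
HB.instance Definition _ := EqQuotient.on quotient_group.

Definition quotient_one : quotient_group := \pi_quotient_group 1.
Definition quotient_mul (x y : quotient_group) : quotient_group :=
  \pi_quotient_group (repr x * repr y).
Definition quotient_inv (x : quotient_group) : quotient_group :=
  \pi_quotient_group (repr x)^-1.

Let coset_pi x y :
  N (x^-1 * y) -> \pi_quotient_group x = \pi_quotient_group y.
Proof. by move=> xy; apply/eqmodP/asboolP. Qed.

Let coset_repr x : N ((repr (\pi_quotient_group x))^-1 * x).
Proof. by apply/asboolP; apply/(eqmodP coset_equiv_rel); rewrite reprK. Qed.

Let pi_mul x y : quotient_mul (\pi_quotient_group x) (\pi_quotient_group y) =
  \pi_quotient_group (x * y).
Proof.
apply: coset_pi; set x' := repr _; set y' := repr _.
have -> : (x' * y')^-1 * (x * y) = (x'^-1 * x) ^ y' * (y'^-1 * y).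
  by rewrite /conjg invgM !mulgA mulgK.
exact: NM (NJ _ (coset_repr _)) (coset_repr _).
Qed.

Let pi_inv x : quotient_inv (\pi_quotient_group x) = \pi_quotient_group x^-1.
Proof.
apply: coset_pi; set x' := repr _.
have -> : x'^-1^-1 * x^-1 = (x'^-1 * x)^-1 ^ (x'^-1).
  by rewrite /conjg invgM !invgK !mulgA mulgK.
exact: NJ _ (NV (coset_repr _)).
Qed.

Let quotient_mulA : associative quotient_mul.
Proof.
move=> x y z; rewrite -(reprK x) -(reprK y) -(reprK z).
rewrite (pi_mul (repr y) (repr z)) (pi_mul (repr x) (_ * _)).
by rewrite (pi_mul (repr x) (repr y)) (pi_mul (_ * _) (repr z)) mulgA.
Qed.
Let quotient_mul1 : left_id quotient_one quotient_mul.
Proof. by move=> x; rewrite -(reprK x) pi_mul mul1g. Qed.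
Let quotient_mul1r : right_id quotient_one quotient_mul.
Proof. by move=> x; rewrite -(reprK x) pi_mul mulg1. Qed.
Let quotient_mulV : left_inverse quotient_one quotient_inv quotient_mul.
Proof. by move=> x; rewrite -(reprK x) pi_inv pi_mul mulVg. Qed.
Let quotient_mulVr : right_inverse quotient_one quotient_inv quotient_mul.
Proof. by move=> x; rewrite -(reprK x) pi_inv pi_mul mulgV. Qed.

HB.instance Definition _ := isGroup.Build quotient_group
  quotient_mulA quotient_mul1 quotient_mul1r quotient_mulV quotient_mulVr.

End Quotient.

(* The group < X | R >; a pair (l, r) in R stands for the relation l = r. *)
Definition presented_group (X : choiceType)
    (R : set (free_group X * free_group X)) : groupType :=
  quotient_group [set p.1 / p.2 | p in R].

Definition free_subgroup (G : groupType) (H : set G) : Prop :=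
  exists (X : choiceType) (f : {multiplicative free_group X -> G}),
    injective f /\ range f = H.

Definition locally_free_subgroup (G : groupType) (H : set G) : Prop :=
  forall S : set G, finite_set S -> generated S `<=` H ->
    free_subgroup (generated S).

Definition free_by_cyclic (G : groupType) : Prop :=
  exists N : set G, [/\ normal_subgroup N, free_subgroup N &
    cyclic_group (quotient_group N)].

(* w spells g in the letters of S and their inverses. *)
Definition is_word_of (G : groupType) (S : set G) (g : G) (w : seq G) : Prop :=
  (forall x, x \in w -> S x \/ S x^-1) /\ \prod_(x <- w) x = g.

(* The value is 0 when g is not in the subgroup generated by S. *)
Definition word_length (G : groupType) (S : set G) (g : G) : nat :=
  xget 0%N [set n | (exists2 w, is_word_of S g w & size w = n) /\
                    forall w, is_word_of S g w -> (n <= size w)%N].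

Definition word_metric (G : groupType) (S : set G) (x y : G) : nat :=
  word_length S (x^-1 * y).

Definition gromov_product (T : Type) (d : T -> T -> nat) (w x y : T) : rat :=
  (((d x w)%:R + (d y w)%:R - (d x y)%:R) / 2%:R)%R.

(* The four-point condition on Gromov products, (x|z)_w >= min((x|y)_w,
   (y|z)_w) - delta; it is applied below to the group itself with its word
   metric, i.e. to the vertex set of the Cayley graph. *)
Definition gromov_hyperbolic (T : Type) (d : T -> T -> nat) : Prop :=
  exists delta : rat, forall w x y z : T,
    (Num.min (gromov_product d w x y) (gromov_product d w y z) - delta
       <= gromov_product d w x z)%R.

Definition word_hyperbolic (G : groupType) : Prop :=
  exists S : set G, [/\ finite_set S, generated S = setT &
    gromov_hyperbolic (word_metric S)].

Definition W (G : groupType) (s : nat) (x y : G) : G :=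
  (\prod_(4 <= i < (4 + s).+1) (x * y ^+ i)) * x.

Definition Gs_relations (s : nat) :
    set (free_group 'I_3 * free_group 'I_3) :=
  let a := free_gen (@Ordinal 3 0 isT) in
  let b := free_gen (@Ordinal 3 1 isT) in
  let t := free_gen (@Ordinal 3 2 isT) in
  [set (t^-1 * a * t, b); (t^-1 * b * t, W s b a * b * (W s a b)^-1)].

Definition Gs (s : nat) : groupType := presented_group (Gs_relations s).

(* Main.v *)
(* G_s is the mapping torus of the endomorphism phi : a -> b, b -> W(b,a) b W(a,b)^-1
   of the free group F on a and b.

   The images of a and a^-1 b under phi have little mutual cancellation, so phi is
   injective, F embeds in G_s, and the union of the groups t^n F t^-n is locally free by
   Nielsen-Schreier. In a free basis of this union the exponent sums of a b^-1 would be
   divisible by arbitrarily high powers of m = 4 + ... + (4+s) - (s+2), hence vanish; but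
   G_s acts on Q by affine maps in which a b^-1 is a nontrivial translation.

   With u_i = a^i t a^-i, the second relation involves, after the first one has been used to
   eliminate b, only u_0, ..., u_(L+1), and it can be solved for u_0 as well as for
   u_(L+1). Hence conjugation by a is an automorphism of the free group on u_0, ..., u_L,
   and G_s is its mapping torus.

   For hyperbolicity, the signs of the coefficients of a 2-chain c are integrated to a
   1-cochain which is bounded and whose coboundary pairs with c to at least |c|. This is
   a linear isoperimetric inequality for all 2-chains of the universal cover. It makes
   the area of a filling grow exponentially around a point of a geodesic that is far
   from a competing path; so geodesics diverge exponentially and triangles are thin. *)
From HB Require Import structures.
From mathcomp Require Import all_boot all_order all_algebra.
From mathcomp Require Import boolp classical_sets functions cardinality.
From mathcomp Require Import zify ring lra.
Require Import Defs.

Set Implicit Arguments.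
Unset Strict Implicit.
Unset Printing Implicit Defensive.

Import Order.TTheory GRing.Theory Num.Theory.

(** * Chains and fillings *)

(** Let u and v be the coefficients of a chain on the two cells at a vertex. If a cochain has
    coboundary sgn(u+v) on the first cell and, up to an error of 1, sgn(u+v) + 3 sgn(v) on the
    second, then these cells contribute at least |u+v| + 2|v| >= |u| + |v|; this is the origin of
    the factor 3. Such values prescribe a function H on each coset of F. Seen from the other end of
    the t-edges, H has increments of size at most 1 along b = phi(a) and 3 times a sign along c' =
    phi(a^-1 b). The obstacle is to find on F a function with increments at most 1 along single
    letters that follows H up to a constant on every coset of phi(F). It is a sum of marks over the
    letters of the reduced word, each mark depending only on the word up to its letter. The long
    powers in c' make this possible: an occurrence of c' is recognised by a few of its letters, and
    next to nothing cancels between neighbouring blocks. The same cancellation analysis gives the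
    injectivity of phi. *)

Section Chains.
Local Open Scope ring_scope.
Variable X : eqType.
Implicit Types (c : seq (int * X)) (f : X -> int) (P : pred X).

(* A finite chain is a list of weighted cells; it is only ever used through its
   pairing with cochains. *)
Definition pair f c : int := \sum_(p <- c) p.1 * f p.2.
Definition coef c x : int := pair (fun y => (y == x)%:R) c.
Definition norm c : int := \sum_(x <- undup [seq p.2 | p <- c]) `|coef c x|.
Definition cfilter P c := [seq p <- c | P p.2].
Definition cscale (n : int) c := [seq (n * p.1, p.2) | p <- c].
Definition bounded f := forall x, `|f x| <= 1.

Lemma pair_nil f : pair f [::] = 0. Proof. exact: big_nil. Qed.
Lemma pair_cons f p c : pair f (p :: c) = p.1 * f p.2 + pair f c.
Proof. exact: big_cons. Qed.
Lemma pair_cat f c1 c2 : pair f (c1 ++ c2) = pair f c1 + pair f c2.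
Proof. exact: big_cat. Qed.
Lemma pair_scale f n c : pair f (cscale n c) = n * pair f c.
Proof. by rewrite /pair big_map big_distrr /=; apply: eq_bigr => p _; rewrite mulrA. Qed.
Lemma eq_pair f g c : f =1 g -> pair f c = pair g c.
Proof. by move=> fg; apply: eq_bigr => p _; rewrite fg. Qed.
Lemma pairD f g c : pair (fun x => f x + g x) c = pair f c + pair g c.
Proof. by rewrite /pair -big_split; apply: eq_bigr => p _; rewrite mulrDr. Qed.
Lemma pair0 c : pair (fun=> 0) c = 0.
Proof. by apply: big1 => p _; rewrite mulr0. Qed.

Lemma pair_filter f P c :
  pair f (cfilter P c) = pair (fun x => if P x then f x else 0) c.
Proof.
rewrite /pair big_filter big_mkcond; apply: eq_bigr => p _.
by case: ifP => _; rewrite ?mulr0.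
Qed.

Lemma pair_coef_on (U : seq X) f c : uniq U -> {subset [seq p.2 | p <- c] <= U} ->
  pair f c = \sum_(x <- U) coef c x * f x.
Proof.
move=> Uu cU; under eq_bigr do rewrite /coef /pair big_distrl /=.
rewrite exchange_big; apply: eq_big_seq => p pc.
rewrite (bigD1_seq p.2) ?cU ?map_f //= eqxx mulr1 big1 ?addr0 // => x /negPf xp.
by rewrite eq_sym xp mulr0 mul0r.
Qed.

Lemma pair_coef f c :
  pair f c = \sum_(x <- undup [seq p.2 | p <- c]) coef c x * f x.
Proof.
by apply: pair_coef_on; [exact: undup_uniq | move=> x; rewrite mem_undup].
Qed.

Lemma norm_ge0 c : 0 <= norm c.
Proof. exact: sumr_ge0. Qed.

Lemma pair_le_scaled (B : int) f c : (forall x, `|f x| <= B) -> `|pair f c| <= B * norm c.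
Proof.
move=> fB; rewrite pair_coef /norm big_distrr; apply: le_trans (ler_norm_sum _ _ _) _.
by apply: ler_sum => x _; rewrite normrM mulrC ler_wpM2r.
Qed.

Lemma pair_le_norm f c : bounded f -> `|pair f c| <= norm c.
Proof. by move=> f1; rewrite -[norm c]mul1r; apply: pair_le_scaled. Qed.

Lemma sgz_bounded g : bounded (fun x : X => sgz (g x : int)).
Proof. by move=> x; case: sgzP. Qed.

Lemma norm_sgz c : pair (fun x => sgz (coef c x)) c = norm c.
Proof.
rewrite pair_coef; apply: eq_bigr => x _.
by rewrite mulrC; case: sgzP; lia.
Qed.

(** The sign cochain of [c] attains the norm, so every upper bound for [norm] can be tested on
    cochains with values in [-1,1]. This duality replaces any normalisation of chains. *)
Lemma norm_le c b : (forall f, bounded f -> pair f c <= b) -> norm c <= b.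
Proof. by rewrite -norm_sgz; apply; apply: sgz_bounded. Qed.

Lemma norm_ext c1 c2 : (forall f, pair f c1 = pair f c2) -> norm c1 = norm c2.
Proof.
move=> e; apply/le_anti/andP; split; apply: norm_le => f f1.
  by rewrite e; apply: le_trans (ler_norm _) (pair_le_norm _ f1).
by rewrite -e; apply: le_trans (ler_norm _) (pair_le_norm _ f1).
Qed.

Lemma norm_size c : all (fun p => `|p.1| <= 1) c -> norm c <= (size c)%:Z.
Proof.
move=> c1; apply: norm_le => f f1; elim: c c1 => [|p c IHc] /=.
  by rewrite pair_nil.
move=> /andP[p1 /IHc]; rewrite pair_cons.
have : `|p.1 * f p.2| <= 1 by rewrite normrM -[1]mulr1 ler_pM.
by move: (_ * _) => x; lia.
Qed.

Lemma norm_cat c1 c2 : norm (c1 ++ c2) <= norm c1 + norm c2.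
Proof.
apply: norm_le => f f1; rewrite pair_cat.
have := pair_le_norm c1 f1; have := pair_le_norm c2 f1; lia.
Qed.

(** The two parts have disjoint supports; for the lower bound their sign cochains are glued into one
    bounded cochain. *)
Lemma norm_filter P c :
  norm c = norm (cfilter P c) + norm (cfilter (predC P) c).
Proof.
apply/le_anti/andP; split.
  rewrite -[in X in X <= _](norm_ext (c1 := cfilter P c ++ cfilter (predC P) c)).
    exact: norm_cat.
  move=> f; rewrite pair_cat !pair_filter -pairD; apply: eq_pair => x /=.
  by case: (P x); rewrite ?addr0 ?add0r.
rewrite -[in X in X + _]norm_sgz -[in X in _ + X]norm_sgz !pair_filter -pairD.
apply: le_trans (ler_norm _) (pair_le_norm _ _) => x /=.
by case: (P x); rewrite ?addr0 ?add0r; apply: sgz_bounded.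
Qed.

Lemma eq_cfilter P Q c : P =1 Q -> cfilter P c = cfilter Q c.
Proof. by move=> PQ; apply: eq_filter => p; rewrite PQ. Qed.

Lemma cfilter_cfilter P Q c : cfilter P (cfilter Q c) = cfilter (predI P Q) c.
Proof. by rewrite /cfilter -filter_predI. Qed.

End Chains.

Section Bind.
Local Open Scope ring_scope.
Variables (X Y : eqType) (F : X -> seq (int * Y)).
Implicit Type c : seq (int * X).

(** When [F] gives the boundary of a single cell, this is the cellular boundary map on chains. *)
Definition bind c : seq (int * Y) := flatten [seq cscale p.1 (F p.2) | p <- c].

Lemma pair_bind f c : pair f (bind c) = pair (fun x => pair f (F x)) c.
Proof.
elim: c => [|p c IHc]; first by rewrite !pair_nil.
by rewrite /bind /= pair_cat pair_scale pair_cons IHc.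
Qed.

Lemma norm_bind M c : (forall x, norm (F x) <= M) -> norm (bind c) <= M * norm c.
Proof.
move=> FM; apply: norm_le => f f1; rewrite pair_bind.
(* For M <= 0 the hypothesis makes every [F x] null, so both sides vanish; M is an arbitrary integer
   here. *)
have [M0|M0] := ltrP 0 M; last first.
  have F0 x : pair f (F x) = 0.
    have := pair_le_norm (F x) f1; have := FM x; have := norm_ge0 (F x); lia.
  rewrite (eq_pair (g := fun=> 0)) // pair0.
  case: c => [|p c]; first by rewrite /norm /= big_nil mulr0.
  have -> : M = 0 by have := FM p.2; have := norm_ge0 (F p.2); lia.
  by rewrite mul0r.
rewrite pair_coef /norm big_distrr /=; apply: ler_sum => x _.
have : `|pair f (F x)| <= M by apply: le_trans (pair_le_norm _ f1) (FM x).
move: (coef c x) (pair f (F x)) => a b ab.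
apply: le_trans (ler_norm _) _; rewrite normrM mulrC.
by apply: ler_wpM2r.
Qed.

End Bind.

(** * Exponential growth of area around a point of a geodesic *)

Section LogProperty.
Local Open Scope ring_scope.
Variables (V E C : eqType) (d : V -> V -> nat) (src tgt : E -> V).
Variables (base : C -> V) (bd : C -> seq (int * E)) (K M D : nat).

Hypothesis d0 : forall x y, d x y = 0%N <-> x = y.
Hypothesis d_sym : forall x y, d x y = d y x.
Hypothesis d_tri : forall x y z, (d x z <= d x y + d y z)%N.
Hypothesis d_edge : forall e, (d (src e) (tgt e) <= 1)%N.
Hypothesis bd_norm : forall x, norm (bd x) <= M%:Z.
Hypothesis bd_near : forall x p, p \in bd x -> (d (base x) (src p.2) <= D)%N.
Hypothesis bd_cycle : forall x (u : V -> int),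
  pair (fun e => u (tgt e) - u (src e)) (bd x) = 0.
Hypothesis isoperimetry : forall c, norm c <= K%:Z * norm (bind bd c).

Definition step x y (p : int * E) :=
  (p.1 = 1 /\ src p.2 = x /\ tgt p.2 = y) \/
  (p.1 = -1 /\ src p.2 = y /\ tgt p.2 = x).

Definition path_chain (e : nat -> int * E) n := [seq e i | i <- iota 0 n].

Lemma pair_path_chain f e n :
  pair f (path_chain e n) = \sum_(i < n) (e i).1 * f (e i).2.
Proof. by rewrite /pair big_map -{1}(subn0 n) -/(index_iota 0 n) big_mkord. Qed.

Lemma path_chain_norm e n : (forall i, (i < n)%N -> exists x y, step x y (e i)) ->
  norm (path_chain e n) <= n%:Z.
Proof.
move=> es; have := norm_size (c := path_chain e n); rewrite size_map size_iota.
apply; apply/allP => _ /mapP[i + ->]; rewrite mem_iota add0n => /es[x [y]].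
by case=> [[-> _]|[-> _]].
Qed.

Variables (g b : nat -> V) (ge be : nat -> int * E) (n m k R : nat).
Hypothesis g_step : forall i, (i < n)%N -> step (g i) (g i.+1) (ge i).
Hypothesis b_step : forall i, (i < m)%N -> step (b i) (b i.+1) (be i).
Hypothesis g_geodesic : forall i, (i <= n)%N -> d (g 0%N) (g i) = i.
Hypothesis kn : (k <= n)%N.
Hypothesis g0b : g 0%N = b 0%N.
Hypothesis gnb : g n = b m.
Hypothesis far : forall i, (i <= m)%N -> (R < d (g k) (b i))%N.
Variable c : seq (int * C).
Hypothesis filling : forall f,
  pair f (path_chain ge n) - pair f (path_chain be m) = pair f (bind bd c).

Let p := g k.
Let ball r : pred C := fun x => (d p (base x) <= r)%N.
Let area r := norm (cfilter (ball r) c).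

Lemma area_ge0 r : 0 <= area r. Proof. exact: norm_ge0. Qed.

Lemma area_mono r r' : (r <= r')%N -> area r' = area r +
  norm (cfilter (predC (ball r)) (cfilter (ball r') c)).
Proof.
move=> rr'; rewrite /area (norm_filter (ball r)) cfilter_cfilter.
rewrite (@eq_cfilter _ _ (ball r)) // => x /=; rewrite /ball.
by apply/andb_idr => /leq_trans; apply.
Qed.

Lemma area_le : area R <= K%:Z * (n + m)%:Z.
Proof.
have -> : K%:Z * (n + m)%:Z = K%:Z * (n%:Z + m%:Z) by rewrite PoszD.
apply: (@le_trans _ _ (norm c)).
  by rewrite (norm_filter (ball R) c) lerDl norm_ge0.
apply: le_trans (isoperimetry c) _; apply: ler_wpM2l => //.
have : norm (bind bd c) <= norm (path_chain ge n ++ cscale (-1) (path_chain be m)).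
  apply: norm_le => f f1; rewrite -filling.
  apply: le_trans (ler_norm _) _.
  apply: le_trans (pair_le_norm _ f1); rewrite pair_cat pair_scale mulN1r //.
move/le_trans; apply; apply: le_trans (norm_cat _ _) _; apply: lerD.
  by apply: path_chain_norm => i im; exists (g i), (g i.+1); apply: g_step.
apply: (@le_trans _ _ (norm (path_chain be m))).
  apply: norm_le => f f1; rewrite pair_scale mulN1r.
  by have := pair_le_norm (path_chain be m) f1; lia.
by apply: path_chain_norm => i im; exists (b i), (b i.+1); apply: b_step.
Qed.

(** The margin D comes from [bd_near]: every cell whose boundary contains an inner edge has its base
    in the r-ball, so truncating the filling to the ball does not change its boundary there. *)
Let inner r : pred E := fun e => (d p (src e) + D <= r)%N.

(** Distance from the start calibrates the geodesic: its coboundary is bounded by 1 on all edges and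
    equals 1 on each geodesic edge, orientation included. *)
Let u x : int := (d (g 0%N) x)%:Z.
Let du e : int := u (tgt e) - u (src e).

Let du_bounded : bounded du.
Proof.
move=> e; rewrite /du /u; have := d_edge e; have := d_sym (src e) (tgt e).
have := d_tri (g 0%N) (src e) (tgt e); have := d_tri (g 0%N) (tgt e) (src e).
lia.
Qed.

Let geo_count r : int := \sum_(i < n | inner r (ge i).2) 1.

Let geo_step (i : 'I_n) : (ge i).1 * du (ge i).2 = 1.
Proof.
have [[-> [es et]]|[-> [es et]]] := g_step (ltn_ord i).
all: by rewrite /du /u es et !g_geodesic ?mul1r ?mulN1r; have := ltn_ord i; lia.
Qed.

Section Ball.
Variable r : nat.
Hypothesis rR : (r <= R)%N.

Let c_in := bind bd (cfilter (ball r) c).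

(** The discarded cells contain no inner edge, and the competing path has none since it stays
    outside the R-ball; so the boundary seen on inner edges is the geodesic alone. *)
Lemma pair_inner f : pair f (cfilter (inner r) c_in) =
  \sum_(i < n | inner r (ge i).2) (ge i).1 * f (ge i).2.
Proof.
rewrite pair_filter pair_bind pair_filter.
set f' := fun x => if inner r x then f x else 0.
transitivity (pair f' (bind bd c)).
  rewrite pair_bind; apply: eq_pair => x; case: ifPn => // out.
  rewrite /pair big_seq big1 // => e /bd_near near; rewrite /f' /inner ifN ?mulr0 //.
  apply: contra out => inn; rewrite /ball; apply: leq_trans inn.
  by apply: leq_trans (d_tri _ (src e.2) _) _; rewrite leq_add2l d_sym.
rewrite -filling [X in _ - X]pair_path_chain [X in _ - X]big1 ?subr0; last first.
  move=> i _; rewrite /f' /inner ifN ?mulr0 //.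
  have [j jm ->] : exists2 j, (j <= m)%N & src (be i).2 = b j.
    have [[_ [e1 _]]|[_ [e1 _]]] := b_step (ltn_ord i); last by exists i.+1.
    by exists i; rewrite // ltnW.
  by have := far jm; rewrite -/p -ltnNge; lia.
rewrite pair_path_chain [RHS]big_mkcond; apply: eq_bigr => i _.
by rewrite /f'; case: ifP => _; rewrite ?mulr0.
Qed.

Lemma norm_inner : norm (cfilter (inner r) c_in) <= geo_count r.
Proof.
apply: norm_le => f f1; rewrite pair_inner; apply: ler_sum => i _.
have : `|(ge i).1| = 1 by have [[-> _]|[-> _]] := g_step (ltn_ord i).
move=> i1; apply: le_trans (ler_norm _) _; rewrite normrM i1 mul1r.
exact: f1.
Qed.

Lemma geo_count_outer : geo_count r <= norm (cfilter (predC (inner r)) c_in).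
Proof.
have du0 : pair du c_in = 0.
  by rewrite pair_bind (eq_pair (g := fun=> 0)) ?pair0 // => x; apply: bd_cycle.
have : pair du c_in = pair du (cfilter (inner r) c_in) +
    pair du (cfilter (predC (inner r)) c_in).
  rewrite !pair_filter -pairD; apply: eq_pair => x /=.
  by case: (inner r x); rewrite ?addr0 ?add0r.
rewrite du0 pair_inner (eq_bigr (fun=> 1)) //.
have := pair_le_norm (cfilter (predC (inner r)) c_in) du_bounded.
rewrite -/(geo_count r); lia.
Qed.

(** A cell with base within r - 2D of [p] has all its edge sources within r - D, so its edges are
    inner. Only the cells of the annulus between r - 2D and r contribute. *)
Lemma outer_annulus : (2 * D <= r)%N ->
  norm (cfilter (predC (inner r)) c_in) <= M%:Z * (area r - area (r - 2 * D)).
Proof.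
move=> Dr; apply: norm_le => f f1.
have -> : area r - area (r - 2 * D) =
    norm (cfilter (predC (ball (r - 2 * D))) (cfilter (ball r) c)).
  by rewrite (@area_mono (r - 2 * D) r) ?leq_subr // addrAC subrr add0r.
apply: (@le_trans _ _ (pair f (cfilter (predC (inner r))
    (bind bd (cfilter (predC (ball (r - 2 * D))) (cfilter (ball r) c)))))).
  rewrite le_eqVlt; apply/orP; left; apply/eqP.
  rewrite !pair_filter !pair_bind [RHS]pair_filter; apply: eq_pair => x /=.
  case: ifPn => //; rewrite negbK => xin; rewrite /pair big_seq big1 // => e /bd_near near.
  rewrite ifF ?mulr0 //; apply/negbF; rewrite /inner.
  have := d_tri p (base x) (src e.2); move: xin near; rewrite /ball.
  by move: (d _ _) (d _ _) (d _ _) Dr => x1 x2 x3; clear; lia.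
apply: le_trans (ler_norm _) _; rewrite pair_filter.
apply: le_trans (norm_bind _ bd_norm).
by apply: pair_le_norm => e; case: ifP.
Qed.

(* The part of the filling in the r-ball has boundary on the geodesic, balanced by its
   boundary in the outer annulus because d(g 0, -) has zero derivative on cycles; the
   isoperimetric inequality then bounds the area by its own increment. *)
Lemma area_growth : (2 * D <= r)%N ->
  area r <= 2 * K%:Z * M%:Z * (area r - area (r - 2 * D)).
Proof.
move=> Dr; apply: le_trans (isoperimetry _) _.
have := outer_annulus Dr; have := geo_count_outer; have := norm_inner.
rewrite (norm_filter (inner r) (bind _ _)) -/c_in.
move: (norm _) (norm _) (area _ - _) => x y z xg gy yz.
rewrite [2 * _]mulrC -!mulrA; apply: ler_wpM2l => //; lia.
Qed.

End Ball.

Hypotheses (K0 : (0 < K)%N) (M0 : (0 < M)%N) (D0 : (0 < D)%N).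

Let n0 : (0 < n)%N.
Proof.
case: n kn g0b gnb (far (leq0n m)) => // k0 gb0 _ + ; rewrite -gb0.
by move: k0; rewrite leqn0 => /eqP ->; rewrite (proj2 (d0 _ _)).
Qed.

Lemma geo_count_start : 1 <= geo_count D.+1.
Proof.
have [i iP] : exists i : 'I_n, inner D.+1 (ge i).2.
  have dpp : d p p = 0%N by apply/d0.
  have dp x y q : step x y q -> x = p \/ y = p -> (d p (src q.2) <= 1)%N.
    have := d_edge q.2; move=> d1 [] [_ [e1 e2]] [] Ep; move: d1;
      by rewrite e1 e2 Ep ?dpp // d_sym.
  have [kn'|nk] := ltnP k n.
    exists (Ordinal kn') => /=; rewrite /inner -add1n leq_add2r.
    by apply: dp (g_step kn') _; left.
  have kE : k = n by apply/eqP; rewrite eqn_leq kn nk.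
  have kn' : (n.-1 < n)%N by rewrite prednK.
  exists (Ordinal kn') => /=; rewrite /inner -add1n leq_add2r.
  by apply: dp (g_step kn') _; right; rewrite prednK // -kE.
rewrite /geo_count (bigD1 i) //= lerDl; exact: sumr_ge0.
Qed.

(** A geodesic edge at [p] has its source within 1 of [p], hence is inner for the radius D + 1. The
    truncated boundary is then nonzero, which a chain of area 0 does not allow. *)
Lemma area_start : (D < R)%N -> 1 <= area D.+1.
Proof.
move=> DR; have /(_ du) := pair_inner DR.
rewrite (eq_bigr (fun=> 1)) // -/(geo_count D.+1) => pg.
have := pair_le_norm (cfilter (inner D.+1) (bind bd (cfilter (ball D.+1) c))) du_bounded.
rewrite pg; have := norm_bind (cfilter (ball D.+1) c) bd_norm.
rewrite (norm_filter (inner D.+1) (bind _ _)) -/(area D.+1).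
have := norm_ge0 (cfilter (predC (inner D.+1)) (bind bd (cfilter (ball D.+1) c))).
have := area_ge0 D.+1; have := geo_count_start.
move: (area _) (geo_count _) (norm _) (norm _) => a1 a2 a3 a4 h1 h2 h3 h4 h5.
case: (ltrP 0 a1) => // a10; have a1E : a1 = 0 by lia.
by move: h4; rewrite a1E mulr0; lia.
Qed.

Let T := (2 * D)%N.
Let Q := (2 * K * M)%N.

(** By [area_growth], widening the radius by T adds at least a Q-th of the larger area, hence of
    [area r]. Counting these additions gives linear growth, and j = Q of them double the area
    without any division. *)
Lemma area_linear r j : (r + T * j <= R)%N ->
  (Q + j)%:Z * area r <= Q%:Z * area (r + T * j).
Proof.
elim: j => [|j IHj] rj; first by rewrite muln0 !addn0.
have rj' : (r + T * j <= R)%N by apply: leq_trans rj; rewrite leq_add2l leq_mul2l leqnSn orbT.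
have := IHj rj'.
have TT : (T <= r + T * j.+1)%N by rewrite mulnS; lia.
have := area_growth rj TT; have -> : (r + T * j.+1 - 2 * D = r + T * j)%N.
  by rewrite mulnS -/T; lia.
have := @area_mono r (r + T * j.+1) (leq_addr _ _).
have := norm_ge0 (cfilter (predC (ball r)) (cfilter (ball (r + T * j.+1)) c)).
have -> : 2 * K%:Z * M%:Z = Q%:Z by rewrite /Q !PoszM.
have -> : (Q + j.+1)%:Z = (Q + j)%:Z + 1 by rewrite addnS -addn1 PoszD.
rewrite mulrDl mul1r mulrBr.
move: (norm _) (Q%:Z * area (r + T * j.+1)) ((Q + j)%:Z * _) (Q%:Z * area (r + T * j)).
by move=> x1 x2 x3 x4; lia.
Qed.

Lemma area_double r : (r + T * Q <= R)%N -> 2 * area r <= area (r + T * Q).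
Proof.
move=> /area_linear; have -> : (Q + Q)%:Z = 2 * Q%:Z by lia.
have Q0 : 0 < Q%:Z by rewrite ltz_nat /Q !muln_gt0 K0 M0.
by rewrite -mulrA mulrCA (ler_pM2l Q0).
Qed.

Lemma area_exp i : (D.+1 + T * Q * i <= R)%N -> (2 ^ i)%:Z <= area (D.+1 + T * Q * i).
Proof.
elim: i => [|i IHi] iR.
  by rewrite muln0 addn0; apply: area_start; rewrite muln0 addn0 in iR.
have iR' : (D.+1 + T * Q * i + T * Q <= R)%N by rewrite -addnA -mulnSr.
rewrite mulnSr addnA; apply: le_trans (area_double iR').
rewrite expnS PoszM ler_pM2l // IHi //.
by apply: leq_trans iR'; apply: leq_addr.
Qed.

Theorem log_property : (2 ^ (R %/ (T * Q + D.+1)) <= K * (n + m))%N.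
Proof.
(* A positive quotient is needed to absorb the starting radius D + 1 into R. *)
have [i0|i0] := posnP (R %/ (T * Q + D.+1))%N.
  by rewrite i0 expn0 muln_gt0 K0 addn_gt0 n0.
set i := (R %/ _)%N in i0 *.
have iR : (D.+1 + T * Q * i <= R)%N.
  apply: leq_trans (leq_trunc_div R (T * Q + D.+1)); rewrite -/i.
  by rewrite mulnDr addnC mulnC leq_add2l leq_pmull.
have := area_exp iR; have := area_le; have := area_mono iR.
have := norm_ge0 (cfilter (predC (ball (D.+1 + T * Q * i))) (cfilter (ball R) c)).
rewrite -lez_nat [in X in _ -> _ -> _ -> _ -> X]PoszM.
move: (norm _) (area R) (area _) => x1 x2 x3; lia.
Qed.

End LogProperty.

(** * Exponential divergence and thin triangles *)

Section ThinTriangles.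
Variables (V : eqType) (d : V -> V -> nat) (K P : nat).
Hypothesis d0 : forall x y, d x y = 0 <-> x = y.
Hypothesis d_sym : forall x y, d x y = d y x.
Hypothesis d_tri : forall x y z, d x z <= d x y + d y z.

Definition adj x y := d x y == 1.

Hypothesis geodesic : forall x y,
  exists p, [/\ path adj x p, last x p = y & size p = d x y].

Hypothesis divergence : forall x p q w R,
  path adj x p -> path adj x q -> last x p = last x q ->
  size p = d x (last x p) -> w \in x :: p ->
  (forall w', w' \in x :: q -> R < d w w') ->
  2 ^ (R %/ P) <= K * (size p + size q).

(** The metric interval, that is the union of all geodesics from x to y; with it subsegments,
    reversals and concatenations need no choice of geodesics. *)
Definition between x y w := d x w + d w y = d x y.

Lemma dxx x : d x x = 0. Proof. exact/d0. Qed.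

Lemma between_sym x y w : between x y w -> between y x w.
Proof. by rewrite /between addnC ![d _ w]d_sym ![d y x]d_sym ![d w _]d_sym. Qed.

Lemma between_l x y : between x y x. Proof. by rewrite /between dxx. Qed.
Lemma between_r x y : between x y y. Proof. by rewrite /between dxx addn0. Qed.

Lemma between_sub x y u w : between x y u -> between u y w -> between x y w.
Proof.
rewrite /between => xu uw; apply/eqP; rewrite eqn_leq d_tri andbT.
have := d_tri x u w; lia.
Qed.

Lemma between_trans' x y u w : between x y u -> between x u w -> between x y w.
Proof.
move=> b1 b2; apply: between_sym; apply: (between_sub (u := u)); exact: between_sym.
Qed.

Lemma size_path x p : path adj x p -> d x (last x p) <= size p.
Proof.
elim: p x => [|y p IHp] x /=; first by rewrite dxx.
move=> /andP[/eqP xy /IHp]; have := d_tri x y (last y p); lia.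
Qed.

Lemma geodesic_between x p w : path adj x p -> size p = d x (last x p) ->
  w \in x :: p -> between x (last x p) w.
Proof.
move=> xp sp; rewrite in_cons => /predU1P[->|wp]; first exact: between_l.
move: xp sp; case/splitPr: wp => p1 p2; rewrite cat_path last_cat size_cat /= => /and3P[x1 a1 x2] sp.
have := size_path x1; have := size_path x2; move/eqP: a1.
have := d_tri x (last x p1) w; have := d_tri x w (last w p2).
by rewrite /between; lia.
Qed.

Lemma interval_point x y i : i <= d x y ->
  exists2 w, between x y w & d x w = i.
Proof.
move=> ixy; have [p [xp py sp]] := geodesic x y.
exists (last x (take i p)).
  rewrite -py; apply: geodesic_between; rewrite ?py //.
  by have := mem_last x (take i p); rewrite !in_cons => /orP[->//|/mem_take ->]; rewrite orbT.
have := xp; have := sp; rewrite -{1 2}(cat_take_drop i p) cat_path size_cat.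
move=> s12 /andP[x1 x2]; have := size_path x1; have := size_path x2.
rewrite -last_cat cat_take_drop py; have := d_tri x (last x (take i p)) y.
rewrite size_takel ?sp // in s12 *; lia.
Qed.

Fixpoint broken (S : V -> Prop) x (s : seq V) :=
  if s is y :: s' then (forall w, between x y w -> S w) /\ broken S y s' else True.

Fixpoint broken_length x (s : seq V) :=
  if s is y :: s' then d x y + broken_length y s' else 0.

Lemma broken_path S x s : S x -> broken S x s -> exists q,
  [/\ path adj x q, last x q = last x s, size q = broken_length x s &
      forall w, w \in x :: q -> S w].
Proof.
elim: s x => [|y s IHs] x Sx /=.
  by exists [::]; split=> // w; rewrite inE => /eqP ->.
case=> Sxy ys; have [|q [yq lq sq Sq]] := IHs y _ ys.
  exact/Sxy/between_r.
have [p [xp py sp]] := geodesic x y.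
exists (p ++ q); rewrite cat_path last_cat size_cat py sp sq xp yq; split=> // w.
rewrite -cat_cons mem_cat => /orP[wp|wq]; last by apply: Sq; rewrite in_cons wq orbT.
by apply: Sxy; rewrite -py; apply: geodesic_between; rewrite ?py.
Qed.

Lemma broken_divergence x s w R : between x (last x s) w ->
  R < d w x -> broken (fun w' => R < d w w') x s ->
  2 ^ (R %/ P) <= K * (2 * broken_length x s).
Proof.
move=> bw wx bs; have [q [xq lq sq Sq]] := @broken_path (fun w' => R < d w w') x s wx bs.
have [p1 [xp1 l1 s1]] := geodesic x w; have [p2 [xp2 l2 s2]] := geodesic w (last x s).
have lp : last x (p1 ++ p2) = last x s by rewrite last_cat l1.
have := @divergence x (p1 ++ p2) q w R.
rewrite cat_path xp1 l1 xp2 lp lq size_cat s1 s2 -lq => /(_ isT xq erefl).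
have -> : d x w + d w (last x q) = d x (last x q) by rewrite lq.
have wm : w \in x :: p1 ++ p2 by rewrite -cat_cons mem_cat -l1 mem_last.
move=> /(_ erefl wm Sq) /leq_trans; apply; rewrite leq_mul2l mul2n -addnn -sq leq_add2r.
by rewrite size_path ?orbT.
Qed.

(** The bound n on the sides gives a trivial starting value h = n, from which [thin_step] descends
    to a constant that does not depend on n. *)
Definition thin n h := forall x y z w, d x y <= n -> d x z <= n -> d z y <= n ->
  between x y w -> exists2 w', between x z w' \/ between z y w' & d w w' <= h.

Lemma thin_trivial n : thin n n.
Proof.
move=> x y z w xy _ _ bw; exists x; first by left; apply: between_l.
by rewrite d_sym; move: bw; rewrite /between; lia.
Qed.

(** A point w farther than h from the other two sides would admit a detour around its h-ball of
    length at most 200 (h+1), found with the weaker thinness h + 1. Divergence forbids this: detour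
    and geodesic together have length at most 400 (h+1). *)
Lemma thin_step n h : thin n h.+1 -> 2 ^ (h %/ P) > K * (400 * h.+1) -> thin n h.
Proof.
move=> th big x y z w xy xz zy bw; apply: contrapT => /asboolPn nw.
have far w' : between x z w' \/ between z y w' -> h < d w w'.
  move=> bw'; rewrite ltnNge; apply/negP => wh.
  by move/asboolPn: nw; apply; exists w'.
have bad u s : between u (last u s) w -> h < d w u ->
    broken (fun w' => h < d w w') u s -> 200 * h.+1 < broken_length u s.
  move=> b1 b2 b3; have := broken_divergence b1 b2 b3.
  move=> le1; have := leq_trans big le1; rewrite ltn_mul2l => /andP[_]; lia.
(* In a small triangle the two other sides are the detour. Otherwise 22 (h+1) <= n, so thinness
   applies to the auxiliary triangle u' z v', whose side u' v' has at most this length. *)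
have [ns|ns] := ltnP n (22 * h.+1).
  suff: broken_length x [:: z; y] <= 200 * h.+1.
    rewrite leqNgt => /negP; apply; apply: bad => //=.
      by apply: far; left; apply: between_l.
    by split=> [w' b'|]; [apply: far; left|split=> // w' b'; apply: far; right].
  by rewrite /=; lia.
(* Leave the side at u, 10 (h+1) away from w or at the endpoint e if that is nearer, and cross to a
   point u' of another side. The crossing has length at most h + 1, so it stays at least 9 (h+1)
   away from w. *)
have anchor e e' : between e e' w -> d e e' <= n ->
   (forall a, between e e' a -> between x y a) -> (between x z e \/ between z y e) ->
   exists u u', [/\ between e w u, d u w <= 10 * h.+1, d u u' <= h.+1,
     between x z u' \/ between z y u' & forall w', between u u' w' -> h < d w w'].
  move=> b1 le sub ee; have [ew|ew] := leqP (d e w) (10 * h.+1).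
    exists e, e; split=> //; [exact: between_l|by rewrite dxx|].
    move=> w'; rewrite /between dxx => /eqP; rewrite addn_eq0 => /andP[/eqP/d0 <- _].
    exact: far.
  have [u bu du] : exists2 u, between w e u & d w u = 10 * h.+1.
    by apply: interval_point; rewrite d_sym ltnW.
  have bu' : between e w u by apply: between_sym.
  have [u' bu'' uu'] : exists2 u', between x z u' \/ between z y u' & d u u' <= h.+1.
    apply: (th x y z) => //; apply: sub.
    by apply: between_sym; apply: (between_sub (u := w)); [apply: between_sym|].
  exists u, u'; split=> //; first by rewrite d_sym du.
  move=> w' bw'; have := d_tri w w' u; move: bw'; rewrite /between.
  rewrite du (d_sym w' u); lia.
have [u [u' [bu uw uu' bu' ufar]]] : exists u u', [/\ between x w u,
    d u w <= 10 * h.+1, d u u' <= h.+1,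
    between x z u' \/ between z y u' & forall w', between u u' w' -> h < d w w'].
  by apply: (anchor x y) => //; left; apply: between_l.
have [v [v' [bv vw vv' bv' vfar]]] : exists v v', [/\ between y w v,
    d v w <= 10 * h.+1, d v v' <= h.+1,
    between x z v' \/ between z y v' & forall w', between v v' w' -> h < d w w'].
  apply: (anchor y x) => //; [exact: between_sym|by rewrite d_sym| |].
    by move=> a; apply: between_sym.
  by right; apply: between_r.
have side a a' : between x z a \/ between z y a -> between a z a' -> h < d w a'.
  move=> [ba|ba] ba'; apply: far; [left|right]; first exact: between_sub ba ba'.
  apply: between_sym; apply: (between_sub (u := a)) => //; exact: between_sym.
have toz a : between x z a \/ between z y a -> d a z <= n.
  move=> []; rewrite /between ?(d_sym z a); lia.
have uv' : d u' v' <= 22 * h.+1.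
  have := d_tri u' u v'; have := d_tri u w v'; have := d_tri w v v'.
  rewrite (d_sym u' u) (d_sym w v); lia.
(* Go 60 (h+1) from u' towards z: this exceeds 22 (h+1) + (h+1), so the point found by thinness lies
   on v' z and not on u' v', and it leaves the crossing q q' far from w. If z is nearer, both points
   are z. *)
have [q [q' [bq bq' qq' uq qfar]]] : exists q q', [/\ between u' z q,
    between v' z q', d q q' <= h.+1, d u' q <= 60 * h.+1 &
    forall w', between q q' w' -> h < d w w'].
  have [uz|uz] := leqP (d u' z) (60 * h.+1).
    exists z, z; split; rewrite ?dxx //; [exact: between_r..|].
    move=> w'; rewrite /between dxx => /eqP; rewrite addn_eq0 => /andP[/eqP/d0 <- _].
    by apply: far; left; apply: between_r.
  have [q bq uq] : exists2 q, between u' z q & d u' q = 60 * h.+1.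
    by apply: interval_point; rewrite ltnW.
  have [q' bq' qq'] : exists2 q', between u' v' q' \/ between v' z q' & d q q' <= h.+1.
    by apply: (th u' z v') => //; [apply: toz|rewrite (leq_trans uv') // ltnW|apply: toz].
  exists q, q'; split=> //; last 1 first.
  - move=> w' bw'; have := d_tri u' w' q; have := d_tri u' w w'.
    have := d_tri u' u w; move: bw'; rewrite /between (d_sym u' u) (d_sym w' q); lia.
  - case: bq' => // bq'; have := d_tri u' q' q; move: bq'.
    rewrite /between (d_sym q' q); lia.
  - by rewrite uq.
have bw' : between u v w.
  move: bw bu bv; rewrite /between (d_sym y w) (d_sym y v) (d_sym v w).
  have := d_tri x u y; have := d_tri u v y; have := d_tri u w v; lia.
(* In units of h + 1 the five pieces have length at most 1, 60, 1, 83 = 1 + 60 + 22, and 1. *)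
suff: broken_length u [:: u'; q; q'; v'; v] <= 200 * h.+1.
  rewrite leqNgt => /negP; apply; apply: bad => //=.
    by apply: ufar; apply: between_l.
  split=> [//|]; split=> [w' b'|].
    by apply: (side _ _ bu'); apply: (between_trans' bq b').
  split=> [//|]; split=> [w' b'|].
    by apply: (side _ _ bv'); apply: (between_trans' bq' (between_sym b')).
  split=> // w' b'; apply: vfar; exact: between_sym.
rewrite /= addn0; have := d_tri q' q v'; have := d_tri q u' v'.
rewrite (d_sym v' v) (d_sym q' q) (d_sym q u'); lia.
Qed.

Lemma exp_beats_linear c : 0 < P ->
  exists b, forall h, b <= h -> c * h.+1 < 2 ^ (h %/ P).
Proof.
move=> P0; pose C := (2 * (c * P)).+1; exists (2 * C * P) => h Ch.
set i := h %/ P; have iC : 2 * C <= i by rewrite leq_divRL.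
have hi : h.+1 <= P * i.+1 by rewrite mulnC ltn_ceil.
apply: (@leq_ltn_trans (c * P * i.+1)); first by rewrite -mulnA leq_mul2l hi orbT.
have jC : C <= i./2 by lia.
have j2 : C < 2 ^ i./2 by apply: leq_ltn_trans jC (ltn_expl _ _).
have ij : i.+1 <= 2 * 2 ^ i./2.
  have := ltn_expl i./2 (isT : 1 < 2); lia.
have : 2 ^ i./2 * 2 ^ i./2 <= 2 ^ i.
  by rewrite -expnD leq_exp2l // addnn; lia.
apply: leq_trans; apply: (@leq_ltn_trans (c * P * (2 * 2 ^ i./2))).
  by rewrite leq_mul2l ij orbT.
rewrite mulnA ltn_pmul2r ?expn_gt0 // mulnC; move: j2; rewrite /C; lia.
Qed.

(** Triangles with sides at most n are trivially (n + b)-thin, and above the threshold b of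
    [exp_beats_linear] the thinness can be lowered one unit at a time. *)
Lemma thin_uniform : 0 < P -> exists delta, forall n, thin n delta.
Proof.
move=> P0; have [b bP] := exp_beats_linear (K * 400) P0.
exists b => n; have : thin n (n + b).
  move=> x y z w xy xz zy bw; have [w' b' ww'] := thin_trivial xy xz zy bw.
  by exists w'; rewrite // (leq_trans ww') // leq_addr.
elim: n {-2}n => [//|m IHm] n; rewrite addSn => th; apply: IHm.
by apply: thin_step th _; rewrite mulnA bP // leq_addl.
Qed.

(** Take the last point m of a geodesic from x to z that is close to the side x w. Then m or its
    successor is close to w z, so m is delta-close to one side and (delta+1)-close to the other. The
    inequality says that d(w, m) exceeds the Gromov product of x and z at w by at most 2 delta +
    1. *)
Lemma center n delta x z w : thin n delta -> d x z <= n -> d x w <= n -> d w z <= n ->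
  exists2 m, between x z m &
    2 * d w m + d x z <= d x w + d z w + 4 * delta + 2.
Proof.
move=> th xz xw wz; have [p [xp pz sp]] := geodesic x z.
pose near a b m := `[< exists2 m', between a b m' & d m m' <= delta >].
have [i ip nxi] : exists2 i, i <= size p & near x w (nth x (x :: p) i) /\
    (near w z (nth x (x :: p) i) \/ i < size p /\ near w z (nth x (x :: p) i.+1)).
  have near_x : near x w (nth x (x :: p) 0).
    by apply/asboolP; exists x; [exact: between_l|rewrite dxx].
  have near_z : near w z (nth x (x :: p) (size p)).
    by rewrite nth_last /= pz; apply/asboolP; exists z; [exact: between_r|rewrite dxx].
  pose Pi i := (i <= size p) && near x w (nth x (x :: p) i).
  have Pi_bound i : Pi i -> i <= size p by case/andP.
  have [i /andP[ip ni] imax] := ex_maxnP (ex_intro Pi 0 near_x) Pi_bound.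
  exists i => //; split=> //.
  have [iE|ilt] := eqVneq i (size p); first by left; rewrite iE.
  right; have ip' : i < size p by rewrite ltn_neqAle ilt.
  split=> //; have bi : between x z (nth x (x :: p) i.+1).
    by rewrite -pz; apply: geodesic_between; rewrite ?pz ?mem_nth.
  have [m' [bm|bm] multiplier'] := th _ _ _ _ xz xw wz bi; last by apply/asboolP; exists m'.
  have : Pi i.+1 by rewrite /Pi ip'; apply/asboolP; exists m'.
  by move/imax; rewrite ltnn.
set m := nth x (x :: p) i in nxi; exists m.
  by rewrite -pz; apply: geodesic_between; rewrite ?pz ?mem_nth.
case: nxi => /asboolP[a ba ma] nz.
have [b bb mb] : exists2 b, between w z b & d m b <= delta.+1.
  case: nz => [/asboolP[b bb mb]|[ip' /asboolP[b bb mb]]]; first by exists b; rewrite // ltnW.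
  exists b => //; apply: leq_trans (d_tri _ (nth x (x :: p) i.+1) _) _.
  by rewrite -[delta.+1]add1n leq_add //; move/(pathP x): xp => /(_ _ ip') /eqP; rewrite -/m /= => ->.
have bm : between x z m by rewrite -pz; apply: geodesic_between; rewrite ?pz ?mem_nth.
move: ba bb bm; rewrite /between.
have := d_tri x a m; have := d_tri w a m; have := d_tri z b m; have := d_tri w b m.
rewrite ![d _ m]d_sym (d_sym a w) (d_sym z b) (d_sym z w).
have := d_sym m a; have := d_sym m b; have := d_sym m w; have := d_sym m z; have := d_sym m x.
lia.
Qed.

Lemma gromov_product_le w x y m : between x y m -> d x w + d y w <= 2 * d w m + d x y.
Proof.
rewrite /between; have := d_tri x m w; have := d_tri y m w.
rewrite (d_sym m w) (d_sym y m); lia.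
Qed.

Theorem thin_gromov : 0 < P -> gromov_hyperbolic d.
Proof.
move=> P0; have [delta th] := thin_uniform P0.
(* The center m costs 2 delta + 1, and passing from m to a point m' on x y or z y costs another
   delta; the distance from w to m' bounds the Gromov product of that side. *)
exists (delta * 3 + 1)%:R%R => w x y z.
pose n := d x y + d y z + d x z + d x w + d w z.
have [|||m bm mc] := @center n delta x z w (th n); try by rewrite /n; lia.
have [|||m' bm' multiplier'] := th n x z y m _ _ _ bm; try by rewrite /n ?(d_sym z y); lia.
have wm' := d_tri w m m'.
have : d x w + d y w + d x z <= d x w + d z w + d x y + (delta * 6 + 2) \/
  d y w + d z w + d x z <= d x w + d z w + d y z + (delta * 6 + 2).
  by case: bm' => b; have := gromov_product_le w b; [left|right]; lia.
have cast a b : a <= b -> (a%:R <= b%:R :> rat)%R by rewrite ler_nat.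
rewrite lerBlDr ge_min /gromov_product => -[/cast|/cast] H; apply/orP; [left|right].
all: by move: H; rewrite !natrD !natrM; lra.
Qed.

End ThinTriangles.

(** * Free groups, quotients and presentations *)

Local Open Scope quotient_scope.
Local Open Scope classical_set_scope.
Local Open Scope group_scope.

Section WordEval.
Variables (X : choiceType) (G : groupType).
Implicit Types (f : X -> G) (w : word X) (u v : free_group X).

Definition letter_eval f (p : X * bool) : G := if p.2 then (f p.1)^-1 else f p.1.

Definition word_eval f w : G := \prod_(p <- w) letter_eval f p.

Lemma word_eval_nil f : word_eval f [::] = 1.
Proof. exact: big_nil. Qed.

Lemma word_eval_cons f p w : word_eval f (p :: w) = letter_eval f p * word_eval f w.
Proof. exact: big_cons. Qed.

Lemma word_eval_cat f w1 w2 :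
  word_eval f (w1 ++ w2) = word_eval f w1 * word_eval f w2.
Proof. exact: big_cat. Qed.

Lemma word_eval_seq1 f p : word_eval f [:: p] = letter_eval f p.
Proof. exact: big_seq1. Qed.

Lemma letter_evalN f x e : letter_eval f (x, ~~ e) = (letter_eval f (x, e))^-1.
Proof. by case: e; rewrite /letter_eval //= invgK. Qed.

Lemma word_eval_free_eq f w1 w2 : free_eq w1 w2 -> word_eval f w1 = word_eval f w2.
Proof.
elim=> [//|? ? _ -> //|? ? ? _ -> _ -> //|u x e v].
by rewrite !(word_eval_cat, word_eval_cons) letter_evalN mulVKg.
Qed.

End WordEval.

Section FreeGroupTheory.
Variable X : choiceType.
Implicit Types (w : word X) (u v : free_group X).

Definition fpi w : free_group X := \pi_(free_group X) w.

Lemma fpi_eq w1 w2 : fpi w1 = fpi w2 <-> free_eq w1 w2.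
Proof.
by split=> [/(eqmodP (free_equiv X))/asboolP|H] //; apply/eqmodP/asboolP.
Qed.

Lemma fpi_repr u : fpi (repr u) = u.
Proof. exact: reprK. Qed.

Lemma free_eq_repr w : free_eq (repr (fpi w)) w.
Proof. by apply/fpi_eq; rewrite fpi_repr. Qed.

Lemma free_eq_catl w (u v : word X) : free_eq u v -> free_eq (w ++ u) (w ++ v).
Proof.
elim=> [{}u|{}u {}v _|{}v {}u z _ uv _|{}u x e {}v].
- exact: free_eq_refl.
- exact: free_eq_sym.
- exact: free_eq_trans.
- by rewrite !catA; apply: free_eq_cancel.
Qed.

Lemma free_eq_catr w (u v : word X) : free_eq u v -> free_eq (u ++ w) (v ++ w).
Proof.
elim=> [{}u|{}u {}v _|{}v {}u z _ uv _|{}u x e {}v].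
- exact: free_eq_refl.
- exact: free_eq_sym.
- exact: free_eq_trans.
- by rewrite -!catA; apply: free_eq_cancel.
Qed.

Lemma fpi_cat w1 w2 : fpi (w1 ++ w2) = fpi w1 * fpi w2.
Proof.
apply/fpi_eq/free_eq_sym.
apply: free_eq_trans (free_eq_catl _ (free_eq_repr _)) _.
exact: free_eq_catr (free_eq_repr _).
Qed.

Lemma fpi_nil : fpi [::] = 1. Proof. by []. Qed.

Lemma fpi_letter p : fpi [:: p] = letter_eval (@free_gen X) p.
Proof.
case: p => x [] //; rewrite /letter_eval /=; apply/eqP; rewrite -mulg_eq1.
by rewrite -fpi_cat; apply/eqP/fpi_eq/(free_eq_cancel [::]).
Qed.

Lemma fpi_word_eval w : fpi w = word_eval (@free_gen X) w.
Proof.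
elim: w => [|p w IHw]; first by rewrite word_eval_nil.
by rewrite word_eval_cons -cat1s fpi_cat IHw fpi_letter.
Qed.

Section FreeHom.
Variables (G : groupType) (f : X -> G).

Definition free_hom u : G := word_eval f (repr u).

Lemma free_hom_fpi w : free_hom (fpi w) = word_eval f w.
Proof. exact/word_eval_free_eq/free_eq_repr. Qed.

Lemma free_hom_mul : {morph free_hom : u v / u * v}.
Proof.
move=> u v; rewrite -{1}(fpi_repr u) -{1}(fpi_repr v) -fpi_cat free_hom_fpi.
by rewrite word_eval_cat.
Qed.

HB.instance Definition _ := isMultiplicative.Build _ _ free_hom free_hom_mul.

Lemma free_hom1 : free_hom 1 = 1.
Proof. by rewrite -fpi_nil free_hom_fpi word_eval_nil. Qed.

HB.instance Definition _ :=
  Multiplicative_isUMagmaMorphism.Build _ _ free_hom free_hom1.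

Lemma free_hom_gen x : free_hom (free_gen x) = f x.
Proof. by rewrite free_hom_fpi word_eval_seq1. Qed.

End FreeHom.

End FreeGroupTheory.

Section Morphisms.
Variables (G H : groupType) (f : {multiplicative G -> H}).

Lemma gmorph1 : f 1 = 1.
Proof. by apply: (@mulgI _ (f 1)); rewrite -gmulfM !mulg1. Qed.

Lemma gmorphV x : f x^-1 = (f x)^-1.
Proof. by apply: (@mulgI _ (f x)); rewrite -gmulfM !mulgV gmorph1. Qed.

Lemma gmorphX x n : f (x ^+ n) = f x ^+ n.
Proof. by elim: n => [|n IHn]; rewrite ?gmorph1 // !expgS gmulfM IHn. Qed.

Lemma gmorph_prod (I : Type) (r : seq I) (E : I -> G) :
  f (\prod_(i <- r) E i) = \prod_(i <- r) f (E i).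
Proof. exact: (big_morph f (@gmulfM _ _ f) gmorph1). Qed.

Lemma gmorph_word_eval (X : choiceType) (g : X -> G) w :
  f (word_eval g w) = word_eval (f \o g) w.
Proof.
rewrite gmorph_prod; apply: eq_bigr => -[x []] _ //=.
by rewrite /letter_eval /= gmorphV.
Qed.

Lemma gmorph_inj : (forall x, f x = 1 -> x = 1) -> injective f.
Proof.
move=> f1 x y fxy; apply/divg1_eq/f1.
by rewrite gmulfM gmorphV fxy mulgV.
Qed.

End Morphisms.

Lemma free_hom_ext (X : choiceType) (G : groupType)
    (f g : {multiplicative free_group X -> G}) :
  (forall x, f (free_gen x) = g (free_gen x)) -> f =1 g.
Proof.
move=> fg u; rewrite -(fpi_repr u) fpi_word_eval !gmorph_word_eval.
by apply: eq_bigr => -[x []] _; rewrite /letter_eval /= fg.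
Qed.

Section GeneratedTheory.
Variable G : groupType.
Implicit Types (S H : set G).

Lemma subgroup1 H : subgroup H -> H 1. Proof. by case. Qed.

Lemma subgroupV H x : subgroup H -> H x -> H x^-1.
Proof. by move=> [H1 HD] /(HD _ _ H1); rewrite mul1g. Qed.

Lemma subgroupM H x y : subgroup H -> H x -> H y -> H (x * y).
Proof. by move=> sH Hx /(subgroupV sH) /(sH.2 _ _ Hx); rewrite invgK. Qed.

Lemma subgroup_prod H (I : eqType) (r : seq I) (F : I -> G) :
  subgroup H -> (forall i, i \in r -> H (F i)) -> H (\prod_(i <- r) F i).
Proof.
move=> sH HF; rewrite big_seq; elim/big_ind: _ => //; first exact: subgroup1.
by move=> x y; apply: subgroupM.
Qed.

Lemma generated_subgroup S : subgroup (generated S).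
Proof.
split=> [H [[]]//|x y Sx Sy H HP].
by have [[_ HD] _] := HP; apply: HD; [apply: Sx|apply: Sy].
Qed.

Lemma sub_generated S : S `<=` generated S.
Proof. by move=> x Sx H [_]; apply. Qed.

Lemma generated_min S H : subgroup H -> S `<=` H -> generated S `<=` H.
Proof. by move=> sH SH x; apply. Qed.

Lemma normal_closure_min S N : normal_subgroup N -> S `<=` N ->
  normal_closure S `<=` N.
Proof. by move=> nN SN x; apply. Qed.

Lemma sub_normal_closure S : S `<=` normal_closure S.
Proof. by move=> x Sx H [_]; apply. Qed.

End GeneratedTheory.

Section QuotientTheory.
Variables (G : groupType) (S : set G).

Definition qpi (x : G) : quotient_group S := \pi_(quotient_group S) x.

Lemma qpi_eq x y : qpi x = qpi y <-> normal_closure S (x^-1 * y).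
Proof.
by split=> [/(eqmodP (coset_equiv_rel S))/asboolP|H] //; apply/eqmodP/asboolP.
Qed.

Lemma qpi_repr x : qpi (repr x) = x.
Proof. exact: reprK. Qed.

Lemma qpi_mul : {morph qpi : x y / x * y}.
Proof.
move=> x y; apply/esym/qpi_eq; rewrite -/(qpi x) -/(qpi y).
have [sN nN] := normal_closure_normal S.
have reprN z : normal_closure S ((repr (qpi z))^-1 * z).
  by apply/qpi_eq; rewrite qpi_repr.
set x' := repr _; set y' := repr _.
have -> : (x' * y')^-1 * (x * y) = (x'^-1 * x) ^ y' * (y'^-1 * y).
  by rewrite /conjg invgM !mulgA mulgK.
exact: (subgroupM sN (nN _ _ (reprN _)) (reprN _)).
Qed.

HB.instance Definition _ := isMultiplicative.Build _ _ qpi qpi_mul.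

Lemma qpi_eq1 x : qpi x = 1 <-> normal_closure S x.
Proof.
have <- : qpi 1 = 1 by exact: gmorph1.
split=> [/esym/qpi_eq|H]; first by rewrite invg1 mul1g.
by apply/esym/qpi_eq; rewrite invg1 mul1g.
Qed.

Section QuotientHom.
Variables (H : groupType) (f : {multiplicative G -> H}).
Hypothesis fS : forall x, S x -> f x = 1.

Let ker_normal x : normal_closure S x -> f x = 1.
Proof.
suff nK : normal_subgroup [set y | f y = 1].
  by move=> Nx; exact: (normal_closure_min nK fS Nx).
split; first split=> [|y z /= fy fz]; first exact: gmorph1.
  by rewrite gmulfM gmorphV fy fz invg1 mulg1.
by move=> y g /= fy; rewrite /conjg !gmulfM fy mul1g gmorphV mulVg.
Qed.

Lemma quotient_hom :
  exists h : {multiplicative quotient_group S -> H}, forall x, h (qpi x) = f x.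
Proof.
pose h (x : quotient_group S) := f (repr x).
have hE x : h (qpi x) = f x.
  apply/esym/divg1_eq; rewrite -gmorphV -gmulfM; apply: ker_normal.
  have [sN nN] := normal_closure_normal S.
  have Nx : normal_closure S ((repr (qpi x))^-1 * x).
    by apply/qpi_eq; rewrite qpi_repr.
  have := nN _ (repr (qpi x))^-1 Nx.
  by rewrite /conjg invgK !mulgA mulgV mul1g.
have hM : {morph h : x y / x * y}.
  move=> x y; rewrite -(qpi_repr x) -(qpi_repr y) -qpi_mul !hE.
  exact: gmulfM.
pose mM := isMultiplicative.Build _ _ h hM.
pose hh : {multiplicative _ -> _} := HB.pack h mM.
by exists hh.
Qed.

End QuotientHom.
End QuotientTheory.

Section Presentation.
Variables (X : choiceType) (R : set (free_group X * free_group X)).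

Definition pgen (u : free_group X) : presented_group R :=
  qpi [set p.1 / p.2 | p in R] u.

Lemma pgen_mul : {morph pgen : u v / u * v}.
Proof. exact: qpi_mul. Qed.

HB.instance Definition _ := isMultiplicative.Build _ _ pgen pgen_mul.

Lemma pgen_rel l r : R (l, r) -> pgen l = pgen r.
Proof.
move=> Rlr; apply/divg1_eq; rewrite -gmorphV -gmulfM; apply/qpi_eq1.
by apply: sub_normal_closure; exists (l, r).
Qed.

Lemma pgen_surj x : exists u, pgen u = x.
Proof. by exists (repr x); apply: qpi_repr. Qed.

Lemma presented_hom (H : groupType) (f : X -> H) :
  (forall l r, R (l, r) -> free_hom f l = free_hom f r) ->
  exists h : {multiplicative presented_group R -> H},
    forall x, h (pgen (free_gen x)) = f x.
Proof.
move=> fR; have fR1 x : [set p.1 / p.2 | p in R] x -> free_hom f x = 1.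
  by case=> [[l r] /= /fR lr <-]; rewrite gmulfM gmorphV /= lr mulgV.
have [h hE] := quotient_hom fR1.
by exists h => x; rewrite hE /= free_hom_gen.
Qed.

End Presentation.

Section Bijections.
Variable T : Type.

(** Permutation groups serve as targets of homomorphisms from [Gs s]: faithfulness on a suitable set
    proves injectivity statements about the presented group. *)
Record bij := Bij {
  bij_fun :> T -> T;
  bij_inv : T -> T;
  bij_funK : cancel bij_fun bij_inv;
  bij_invK : cancel bij_inv bij_fun }.

Lemma bij_ext (f g : bij) : f =1 g -> f = g.
Proof.
case: f g => f f' fK f'K [g g' gK g'K] /= /funext fg; subst g.
have f'g' : f' = g' by apply/funext => x; rewrite -[in LHS](g'K x) fK.
by subst g'; congr Bij; apply: Prop_irrelevance.
Qed.

HB.instance Definition _ := gen_eqMixin bij.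
HB.instance Definition _ := gen_choiceMixin bij.

Definition bij_one : bij := @Bij id id (fun=> erefl) (fun=> erefl).
Definition bij_mul (f g : bij) : bij :=
  Bij (can_comp (bij_funK f) (bij_funK g)) (can_comp (bij_invK g) (bij_invK f)).
Definition bij_V (f : bij) : bij := Bij (bij_invK f) (bij_funK f).

Let bij_mulA : associative bij_mul. Proof. by move=> f g h; apply: bij_ext. Qed.
Let bij_mul1 : left_id bij_one bij_mul. Proof. by move=> f; apply: bij_ext. Qed.
Let bij_mul1r : right_id bij_one bij_mul. Proof. by move=> f; apply: bij_ext. Qed.
Let bij_mulV : left_inverse bij_one bij_V bij_mul.
Proof. by move=> f; apply: bij_ext => x /=; rewrite bij_funK. Qed.
Let bij_mulVr : right_inverse bij_one bij_V bij_mul.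
Proof. by move=> f; apply: bij_ext => x /=; rewrite bij_invK. Qed.

HB.instance Definition _ := isGroup.Build bij
  bij_mulA bij_mul1 bij_mul1r bij_mulV bij_mulVr.

Lemma bij_mulE (f g : bij) x : (f * g) x = f (g x). Proof. by []. Qed.
Lemma bij_VE (f : bij) x : f^-1 x = bij_inv f x. Proof. by []. Qed.

End Bijections.

(* The normal form of an element of the free group is its reduced word read
   backwards, so that right multiplication by a letter acts on the head. *)
Section NormalForm.
Variable X : choiceType.
Implicit Types (p q : X * bool) (l w : word X) (u v : free_group X).

Definition linv p : X * bool := (p.1, ~~ p.2).

Lemma linvK : involutive linv.
Proof. by case=> x e; rewrite /linv /= negbK. Qed.

Lemma linv_neq p : p != linv p.
Proof. by case: p => x [] /=; rewrite /linv xpair_eqE eqxx. Qed.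

Lemma eq_linv p q : (p == linv q) = (q == linv p).
Proof. by rewrite -(inj_eq (inv_inj linvK)) linvK eq_sym. Qed.

Definition nocancel p q := q != linv p.

Lemma nocancel_sym : symmetric nocancel.
Proof. by move=> p q; rewrite /nocancel eq_linv. Qed.

Definition reduced l := sorted nocancel l.

Lemma reduced_rev l : reduced (rev l) = reduced l.
Proof.
rewrite /reduced rev_sorted; apply: eq_sorted => p q.
by rewrite nocancel_sym.
Qed.

Lemma reduced_cat l1 l2 : reduced (l1 ++ l2) -> reduced l1 /\ reduced l2.
Proof. by move=> /cat_sorted2[]. Qed.

Definition push p l :=
  if l is q :: l' then if q == linv p then l' else p :: l else [:: p].

Lemma push_reduced p l : reduced l -> reduced (push p l).
Proof.
case: l => [//|q l] /=; case: ifPn => [_|qp /= ->]; first exact: path_sorted.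
by rewrite /nocancel qp.
Qed.

Lemma pushK p l : reduced l -> push (linv p) (push p l) = l.
Proof.
case: l => [|q l] /=; first by rewrite linvK eqxx.
case: ifPn => [/eqP -> {q}|_ _]; last by rewrite /= linvK eqxx.
by case: l => [//|q l] /= /andP[+ _]; rewrite /nocancel => /negPf ->.
Qed.

Lemma push_nocancel p l : reduced (p :: l) -> push p l = p :: l.
Proof. by case: l => [//|q l] /= /andP[/negPf ->]. Qed.

Definition pushw l w := foldl (fun l p => push p l) l w.

Lemma pushw_cons l p w : pushw l (p :: w) = pushw (push p l) w.
Proof. by []. Qed.

Lemma pushw_cat l w1 w2 : pushw l (w1 ++ w2) = pushw (pushw l w1) w2.
Proof. exact: foldl_cat. Qed.

Lemma pushw_reduced l w : reduced l -> reduced (pushw l w).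
Proof. by elim: w l => //= p w IHw l rl; apply/IHw/push_reduced. Qed.

Lemma pushw_free_eq l w1 w2 : reduced l -> free_eq w1 w2 -> pushw l w1 = pushw l w2.
Proof.
move=> + w12; elim: w12 l => [//|u v _ IH l rl|v u z _ IH1 _ IH2 l rl|u x e v l rl].
- by rewrite IH.
- by rewrite IH1 // IH2.
rewrite !pushw_cat /=.
by rewrite -[(x, ~~ e)]/(linv (x, e)) pushK // pushw_reduced.
Qed.

Definition nf u := pushw [::] (repr u).

Lemma nf_fpi w : nf (fpi w) = pushw [::] w.
Proof. by apply: pushw_free_eq => //; apply: free_eq_repr. Qed.

Lemma nf_reduced u : reduced (nf u).
Proof. exact: pushw_reduced. Qed.

Lemma nf_mul_fpi u w : nf (u * fpi w) = pushw (nf u) w.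
Proof.
by rewrite -(fpi_repr u) -fpi_cat nf_fpi pushw_cat fpi_repr.
Qed.

Lemma fpi_push p l : reduced l -> fpi (rev (push p l)) = fpi (rev l) * fpi [:: p].
Proof.
case: l => [|q l] rl; first by rewrite -fpi_cat.
rewrite /=; case: ifPn => [/eqP ->|_]; last by rewrite rev_cons -cats1 fpi_cat.
rewrite rev_cons -cats1 -fpi_cat -catA cat1s.
apply/esym/fpi_eq; have := free_eq_cancel (rev l) p.1 (~~ p.2) [::].
by rewrite negbK cats0 -surjective_pairing.
Qed.

Lemma fpi_pushw l w : reduced l -> fpi (rev (pushw l w)) = fpi (rev l) * fpi w.
Proof.
elim: w l => [|p w IHw] l rl; first by rewrite /= fpi_nil mulg1.
rewrite pushw_cons IHw; last exact: push_reduced.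
by rewrite fpi_push // -(cat1s p w) fpi_cat mulgA.
Qed.

Lemma nfK u : fpi (rev (nf u)) = u.
Proof. by rewrite fpi_pushw // fpi_nil mul1g fpi_repr. Qed.

Lemma nf_inj : injective nf.
Proof. by move=> u v uv; rewrite -(nfK u) uv nfK. Qed.

Lemma pushw_catrev l w : reduced (catrev w l) -> pushw l w = catrev w l.
Proof.
elim: w l => [//|p w IHw] l /= rl; rewrite push_nocancel ?IHw //.
by move: rl; rewrite catrevE => /reduced_cat[].
Qed.

Lemma pushw_rev l l' : reduced (l' ++ l) -> pushw l (rev l') = l' ++ l.
Proof. by move=> r; rewrite pushw_catrev catrevE revK. Qed.

Lemma nf_fpi_rev l : reduced l -> nf (fpi (rev l)) = l.
Proof. by move=> rl; rewrite nf_fpi pushw_rev cats0. Qed.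

Lemma nf1 : nf 1 = [::].
Proof. by rewrite -(fpi_nil X) nf_fpi. Qed.

Lemma nf_eq0 u : nf u = [::] -> u = 1.
Proof. by move=> u0; apply: nf_inj; rewrite nf1. Qed.

(** Here x is the part of w that cancels against the end of the word of l, and y is the part that
    survives. *)
Lemma pushw_split l w : reduced l -> reduced w -> exists x y l',
  [/\ w = x ++ y, l = map linv x ++ l' & pushw l w = rev y ++ l'].
Proof.
elim: w l => [|p w IHw] l rl rw; first by exists [::], [::], l.
have rw' : reduced w by exact: path_sorted rw.
case: l rl => [|q l] rl.
  exists [::], (p :: w), [::]; split => //.
  by rewrite pushw_catrev catrevE ?cats0 // reduced_rev.
have [/eqP qp|qp] := boolP (q == linv p).
  have [x [y [l' [-> -> /= pe]]]] := IHw _ (path_sorted rl) rw'.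
  by exists (p :: x), y, l'; split=> //=; rewrite qp // eqxx.
exists [::], (p :: w), (q :: l); split => //.
rewrite pushw_catrev catrevE // /reduced rev_cons -cats1 -catA cat1s.
case/lastP: w {IHw rw'} rw => [|w p'] rw; first by rewrite /= /nocancel qp.
have : reduced (rev (p :: rcons w p')) by rewrite reduced_rev.
rewrite /reduced rev_cons rev_rcons /= -cats1 !cat_path /= => /andP[-> /andP[-> _]].
by rewrite /= /nocancel qp.
Qed.

End NormalForm.

Notation la := (false, false).
Notation lA := (false, true).
Notation lb := (true, false).
Notation lB := (true, true).

Notation F2 := (free_group bool).
Notation ga := (free_gen false : F2).
Notation gb := (free_gen true : F2).

Definition el (l : word bool) : F2 := fpi (rev l).

Lemma el_cons p l : el (p :: l) = el l * letter_eval (@free_gen bool) p.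
Proof. by rewrite /el rev_cons -cats1 fpi_cat fpi_letter. Qed.

Lemma el_nseq k p l : el (nseq k p ++ l) = el l * letter_eval (@free_gen bool) p ^+ k.
Proof.
elim: k => [|k IHk]; first by rewrite mulg1.
by rewrite /= el_cons IHk expgSr mulgA.
Qed.

Lemma nf_el l : reduced l -> nf (el l) = l.
Proof. exact: nf_fpi_rev. Qed.

Lemma el_nf u : el (nf u) = u.
Proof. exact: nfK. Qed.

Definition hd_neq (T : eqType) (p : T) l := if l is q :: _ then q != p else true.

Lemma reduced_nseq (X : choiceType) k (p : X * bool) l :
  reduced l -> hd_neq (linv p) l -> reduced (nseq k p ++ l).
Proof.
move=> rl pl; elim: k => [//|k IHk] /=.
case: k IHk => [|k] /= IHk; last by rewrite /nocancel linv_neq.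
by case: l rl pl {IHk} => [|q l] //= rl pl; rewrite /nocancel pl.
Qed.

Lemma prefix_nseq_lt (T : eqType) m k (p q : T) r l :
  (m < k)%N -> q != p -> prefix (nseq m p ++ q :: r) (nseq k p ++ l) = false.
Proof.
move=> mk qp; elim: m k mk => [|m IHm] [|k] //= mk; first by rewrite (negPf qp).
by rewrite eqxx IHm.
Qed.

Lemma prefix_nseq_gt (T : eqType) m k (p q : T) r l :
  (k < m)%N -> q != p -> prefix (nseq m p ++ r) (nseq k p ++ q :: l) = false.
Proof.
move=> mk qp; elim: m k mk => [//|m IHm] [|k] //= mk.
  by rewrite eq_sym (negPf qp).
by rewrite eqxx IHm.
Qed.

(** * Counting along cosets of the image of phi *)

Section Marks.
Variable s : nat.

(* W(b,a) b W(a,b)^-1 = b c', so the endomorphism a -> b, b -> W(b,a) b W(a,b)^-1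
   sends a^-1 b to c'. *)
Definition c' : F2 :=
  ga ^+ 4 * gb * (\prod_(5 <= i < 5 + s) (ga ^+ i * gb)) * gb * ga^-1 *
  (\prod_(4 <= i < (4 + s).+1) (ga * gb ^+ i))^-1.

(** The four blocks of which c' and c'^-1 consist, written in front of a reversed word [l] so that
    runs of equal letters can be peeled off; [el_MID], [el_UB], [el_DN] and [el_DA] identify them as
    products. *)
Fixpoint MID n (l : word bool) :=
  if n is n'.+1 then lb :: nseq (5 + n') la ++ MID n' l else l.
Fixpoint DN i n (l : word bool) :=
  if n is n'.+1 then lA :: nseq i lB ++ DN i.+1 n' l else l.
Fixpoint UB n (l : word bool) :=
  if n is n'.+1 then nseq (5 + n') lb ++ la :: UB n' l else nseq 4 lb ++ l.
Fixpoint DA i n (l : word bool) :=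
  if n is n'.+1 then nseq i lA ++ lB :: DA i.+1 n' l else l.

(* Reversed words: [CE k l] spells l a^(k-4) c' and [CEi l] spells l a^-1 c'^-1. *)
Definition CE k (l : word bool) :=
  DN 4 s.+1 (lA :: lb :: MID s (lb :: nseq k la ++ l)).
Definition CEi (l : word bool) := DA 4 s.+1 (lB :: la :: UB s l).

Lemma leA : letter_eval (@free_gen bool) lA = ga^-1. Proof. by []. Qed.
Lemma leB : letter_eval (@free_gen bool) lB = gb^-1. Proof. by []. Qed.
Lemma lea : letter_eval (@free_gen bool) la = ga. Proof. by []. Qed.
Lemma leb : letter_eval (@free_gen bool) lb = gb. Proof. by []. Qed.
Definition leE := (lea, leA, leb, leB).

Lemma el_MID n l : el (MID n l) = el l * \prod_(5 <= i < 5 + n) (ga ^+ i * gb).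
Proof.
elim: n => [|n IHn]; first by rewrite big_geq ?addn0 // mulg1.
rewrite addnS big_nat_recr ?leq_addr //.
rewrite -[MID n.+1 l]/(lb :: nseq (5 + n) la ++ MID n l).
by rewrite el_cons el_nseq IHn !leE !mulgA.
Qed.

Lemma el_UB n l :
  el (UB n l) = el l * gb ^+ 4 * \prod_(5 <= i < 5 + n) (ga * gb ^+ i).
Proof.
elim: n => [|n IHn].
  by rewrite big_geq ?addn0 // mulg1 -[UB 0 l]/(nseq 4 lb ++ l) el_nseq.
rewrite addnS big_nat_recr ?leq_addr //.
rewrite -[UB n.+1 l]/(nseq (5 + n) lb ++ la :: UB n l).
by rewrite el_nseq el_cons IHn !leE !mulgA.
Qed.

Lemma el_DN i n l :
  el (DN i n l) = el l * (\prod_(i <= k < i + n) (ga * gb ^+ k))^-1.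
Proof.
elim: n i => [|n IHn] i; first by rewrite big_geq ?addn0 // invg1 mulg1.
rewrite -addSnnS big_ltn ?leq_addr // !invgM.
rewrite -[DN i n.+1 l]/(lA :: nseq i lB ++ DN i.+1 n l).
by rewrite el_cons el_nseq IHn !leE -expVgn !mulgA.
Qed.

Lemma el_DA i n l :
  el (DA i n l) = el l * (\prod_(i <= k < i + n) (ga ^+ k * gb))^-1.
Proof.
elim: n i => [|n IHn] i; first by rewrite big_geq ?addn0 // invg1 mulg1.
rewrite -addSnnS big_ltn ?leq_addr // !invgM.
rewrite -[DA i n.+1 l]/(nseq i lA ++ lB :: DA i.+1 n l).
by rewrite el_nseq el_cons IHn !leE -expVgn !mulgA.
Qed.

Lemma el_CE k l : el (CE k l) = el l * ga ^+ k * ga ^- 4 * c'.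
Proof.
rewrite /CE el_DN addnS -addSn el_cons el_cons el_MID el_cons el_nseq !leE /c'.
by move: (ga ^+ 4) => x; rewrite !mulgA mulgVK.
Qed.

Lemma el_CEi l : el (CEi l) = el l * ga^-1 * c'^-1.
Proof.
rewrite /CEi el_DA !el_cons el_UB !leE /c' addnS -addSn.
rewrite (big_ltn (m := 4)) // (big_ltn (m := 4)) //.
move: (ga ^+ 4) (gb ^+ 4) => x y.
by rewrite !invgM !invgK !mulgA mulgVK.
Qed.

End Marks.

(** * The potential as a sum of marks over a reduced word *)

Section Potential.
Variable s : nat.
Variables A E : F2 -> int.

Definition run (p : bool * bool) (l : word bool) := find (fun q => q != p) l.

Lemma run_nseq k p l :
  hd_neq p l -> run p (nseq k p ++ l) = k.
Proof.
rewrite /run; elim: k => [|k IHk] pl /=; last by rewrite eqxx /= IHk.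
by case: l pl => [//|q l] /= ->.
Qed.

Lemma run_nseq_le k p l : (k <= run p (nseq k p ++ l))%N.
Proof. by elim: k => [//|k IHk] /=; rewrite eqxx. Qed.

Lemma run_split p l : exists l', l = nseq (run p l) p ++ l' /\
  hd_neq p l'.
Proof.
elim: l => [|q l [l' [IHl pl']]]; first by exists [::].
rewrite /run /=; have [->|qp] := eqVneq q p; last by exists (q :: l).
by exists l'; rewrite /= [in LHS]IHl.
Qed.

(* Lists are reversed words: [isP1] and [isP2] say that the word ends with
   a^-1 b^-4 a^-1 or a^-1 b^-1 a^-4, the ends of c' and of c'^-1. *)
Definition isP1 (l : word bool) := prefix [:: lA; lB; lB; lB; lB; lA] l.
Definition isP2 (l : word bool) := prefix [:: lA; lA; lA; lA; lB; lA] l.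
Definition isEp (l : word bool) := prefix (lA :: nseq 6 lB ++ [:: lA]) l.
Definition isEm (l : word bool) := prefix (la :: nseq 5 lb ++ [:: la]) l.

(** From a vertex j letters into the distinguished run, [gp j] and [gm j] lead to the vertex where
    that occurrence of c' begins, the argument at which E is to be read. For [gp] one undoes the j
    letters, runs through the remainder b^-5 a^-1 b^-4 a^-1 and returns along c'^-1; for [gm] one
    returns to the end of c' and then goes along c'^-1. *)
Definition gp j : F2 := gb ^+ j * gb ^- 5 * ga^-1 * gb ^- 4 * ga^-1 * (c' s)^-1.
Definition gm j : F2 := gb ^- j * (ga * gb ^+ 4 * ga * gb ^+ 5 * ga)^-1 * (c' s)^-1.

(* The letters of a b-run carry A-marks if the run is too long to lie inside c' or c'^-1
   or if it follows one of their ends, so that it comes from the factor b = phi(a).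
   Otherwise the first three letters of one distinguished run in each occurrence of
   c' or c'^-1 carry the marks of E, whence the coefficient 3 in [oscillation]. *)
Definition markb (e : bool) j (l rest : word bool) : int :=
  if [|| s + 5 <= j, isP1 rest | isP2 rest]%N then
    if e then (- A (el l))%R else A (el (behead l))
  else if e then if isEp rest && (j <= 3)%N then E (el l * gp j) else 0%R
  else if isEm rest && (j <= 3)%N then (- E (el l * gm j)%g)%R else 0%R.

Definition mark (l : word bool) : int :=
  if l is p :: _ then
    if p.1 then markb p.2 (run p l) l (drop (run p l) l) else 0%R
  else 0%R.

Fixpoint potential (l : word bool) : int :=
  if l is _ :: l' then (potential l' + mark l)%R else 0%R.

Lemma potential_cons p l : potential (p :: l) = (potential l + mark (p :: l))%R. Proof. by []. Qed.

Lemma mark_run e j l :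
  hd_neq (true, e) l ->
  mark (nseq j.+1 (true, e) ++ l) = markb e j.+1 (nseq j.+1 (true, e) ++ l) l.
Proof.
move=> pl; set l1 := nseq _ _ ++ _.
have -> : mark l1 = markb e (run (true, e) l1) l1 (drop (run (true, e) l1) l1) by [].
by rewrite run_nseq // drop_size_cat // size_nseq.
Qed.

Lemma potential_a k e l : potential (nseq k (false, e) ++ l) = potential l.
Proof. by elim: k => [//|k IHk] /=; rewrite IHk addr0. Qed.

(** After such a word a b-run of length at most s + 4, the longest b-run inside c' and c'^-1,
    carries no mark. *)
Definition plain e (l : word bool) :=
  [&& ~~ isP1 l, ~~ isP2 l & ~~ (if e then isEp l else isEm l)].

Lemma potential_plain e j l : (j <= s + 4)%N ->
  hd_neq (true, e) l -> plain e l ->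
  potential (nseq j (true, e) ++ l) = potential l.
Proof.
move=> + pl /and3P[n1 n2 n3]; elim: j => [//|j IHj] js.
rewrite -[nseq _ _ ++ _]/((true, e) :: (nseq j (true, e) ++ l)) potential_cons.
rewrite IHj 1?ltnW // -[_ :: _]/(nseq j.+1 (true, e) ++ l) mark_run //.
rewrite /markb; have -> : (s + 5 <= j.+1)%N = false by lia.
rewrite (negPf n1) (negPf n2) /=.
by case: e n3 {pl IHj} => /negPf ->; rewrite addr0.
Qed.

(** The distinguished runs, b^-5 preceded by a^-1 b^-6 a^-1 in c' and b^6 preceded by a b^5 a in
    c'^-1, exist because 4 + s >= 6. *)
Hypothesis s2 : (2 <= s)%N.

Lemma potential_MID n k l : (n <= s)%N -> (2 <= k)%N ->
  potential (MID n (lb :: nseq k la ++ l)) = potential l.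
Proof.
move=> + k2; have plain_a m r : (2 <= m)%N -> plain false (nseq m la ++ r).
  by case: m => [|[|m]].
elim: n => [|n IHn] ns.
  rewrite -[MID 0 _]/(nseq 1 lb ++ (nseq k la ++ l)) potential_plain ?potential_a ?plain_a //.
  - by rewrite addnS.
  - by case: k k2.
rewrite -[MID n.+1 _]/(nseq 1 lb ++ (nseq (5 + n) la ++ MID n (lb :: nseq k la ++ l))).
by rewrite potential_plain ?potential_a ?plain_a ?IHn //; rewrite ?addnS // ltnW.
Qed.

(** A run b^-i of c' with i >= 6 follows either b a^-1 or a run of at least 7 letters, whereas the
    patterns [isP1] and [isEp] ask for exactly 4 or 6. *)
Lemma potential_DN i n l : (6 <= i)%N -> (i + n <= s + 5)%N ->
  potential (DN i n (lA :: lb :: l)) = potential (lb :: l).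
Proof.
elim: n i => [|n IHn] i i6 ins; first by rewrite /= addr0.
rewrite -[DN _ _ _]/(nseq 1 lA ++ (nseq i lB ++ DN i.+1 n (lA :: lb :: l))).
rewrite potential_a potential_plain ?IHn //; [lia|lia|lia|..]; first by case: n {IHn ins}.
case: n {IHn ins} => [//|n].
rewrite -[DN _ _ _]/(lA :: (nseq i.+1 lB ++ DN i.+2 n (lA :: lb :: l))).
rewrite /plain /isP1 /isP2 /isEp.
have p k r : (k < i.+1)%N -> prefix (lA :: (nseq k lB ++ lA :: r))
    (lA :: (nseq i.+1 lB ++ DN i.+2 n (lA :: lb :: l))) = false.
  by move=> ki; rewrite prefix_cons eqxx prefix_nseq_lt.
by rewrite (p 4 [::]) ?(p 6 [::]) //; lia.
Qed.

Lemma potential_UB n l : (2 <= n <= s)%N ->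
  potential (UB n l) = potential (UB 2 l).
Proof.
elim: n => [//|n IHn] /andP[n2 ns].
move: n2; rewrite leq_eqVlt => /predU1P[<- //|n2].
rewrite -[UB n.+1 l]/(nseq (5 + n) lb ++ (nseq 1 la ++ UB n l)).
rewrite potential_plain ?potential_a ?IHn //; [lia|lia|].
case: n n2 {IHn ns} => [//|n] n2.
rewrite -[UB n.+1 l]/(nseq (5 + n) lb ++ (nseq 1 la ++ UB n l)).
rewrite /plain /isEm -/([:: la] ++ _).
have -> : prefix (la :: nseq 5 lb ++ [:: la])
   (nseq 1 la ++ nseq (5 + n) lb ++ nseq 1 la ++ UB n l) = false; last by [].
by rewrite -[nseq 1 la ++ _]/(la :: _) prefix_cons eqxx prefix_nseq_lt //; lia.
Qed.

Lemma potential_DA i n l : (4 <= i)%N ->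
  potential (DA i n.+1 (lB :: la :: l)) = potential l.
Proof.
elim: n i => [|n IHn] i i4.
  rewrite -[DA _ _ _]/(nseq i lA ++ (nseq 2 lB ++ (nseq 1 la ++ l))) potential_a.
  by rewrite potential_plain ?potential_a //; lia.
rewrite -[DA _ _ _]/(nseq i lA ++ (nseq 1 lB ++ DA i.+1 n.+1 (lB :: la :: l))).
rewrite potential_a potential_plain ?IHn //; [lia..|].
rewrite -[DA _ _ _]/(nseq i.+1 lA ++ (nseq 1 lB ++ DA i.+2 n (lB :: la :: l))).
rewrite /plain /isP2 -[[:: lA; lA; lA; lA; lB; lA]]/(nseq 4 lA ++ [:: lB; lA]).
rewrite prefix_nseq_lt //.
by case: i i4 {IHn} => [|[|i]].
Qed.

Lemma potential_Ep l : isEp l ->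
  potential (nseq 5 lB ++ l) =
  (potential l + 3 * E (el l * gb ^- 5 * ga^-1 * gb ^- 4 * ga^-1 * (c' s)^-1)%g)%R.
Proof.
move=> lE; have : exists l', l = (lA :: nseq 6 lB ++ [:: lA]) ++ l' by apply/prefixP.
case=> l' el'; set f := (_ * (c' s)^-1)%g.
have nh : hd_neq lB l by rewrite el'.
have mk j : mark (nseq j.+1 lB ++ l) = if (j < 3)%N then E f else
    if (s + 5 <= j.+1)%N then (- A (el (nseq j.+1 lB ++ l)))%R else 0%R.
  rewrite mark_run // /markb lE.
  have -> : isP1 l = false by rewrite el'.
  have -> : isP2 l = false by rewrite el'.
  rewrite orbF el_nseq leE expVgn /gp.
  case: (ltnP j 3) => j3; last by rewrite ?orbF.
  have -> : (s + 5 <= j.+1)%N = false by lia.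
  rewrite /= /f; move: (gb ^+ 5) (gb ^+ 4) (gb ^+ j.+1) => x y z.
  by rewrite -!mulgA mulKg !mulgA.
rewrite -[nseq 5 lB ++ l]/(lB :: lB :: lB :: lB :: lB :: l) !potential_cons.
rewrite (mk 0%N) (mk 1%N) (mk 2%N) (mk 3%N) (mk 4%N) /=.
have -> : (s + 5 <= 4)%N = false by lia.
have -> : (s + 5 <= 5)%N = false by lia.
lia.
Qed.

Lemma potential_Em l : isEm l ->
  potential (nseq 6 lb ++ l) =
  (potential l - 3 * E (el l * (ga * gb ^+ 4 * ga * gb ^+ 5 * ga)^-1 * (c' s)^-1)%g)%R.
Proof.
move=> lE; have : exists l', l = (la :: nseq 5 lb ++ [:: la]) ++ l' by apply/prefixP.
case=> l' el'; set f := (_ * (c' s)^-1)%g.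
have nh : hd_neq lb l by rewrite el'.
have mk j : mark (nseq j.+1 lb ++ l) = if (j < 3)%N then (- E f)%R else
    if (s + 5 <= j.+1)%N then A (el (behead (nseq j.+1 lb ++ l))) else 0%R.
  rewrite mark_run // /markb lE.
  have -> : isP1 l = false by rewrite el'.
  have -> : isP2 l = false by rewrite el'.
  rewrite orbF /gm.
  case: (ltnP j 3) => j3; last by rewrite ?orbF.
  have -> : (s + 5 <= j.+1)%N = false by lia.
  transitivity (- E (el (nseq j.+1 lb ++ l) * gm j.+1)%g)%R => //.
  rewrite /f /gm el_nseq leE; move: (_ * ga) (gb ^+ j.+1) => x y.
  by rewrite -!mulgA mulVKg.
rewrite -[nseq 6 lb ++ l]/(lb :: lb :: lb :: lb :: lb :: lb :: l) !potential_cons.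
rewrite (mk 0%N) (mk 1%N) (mk 2%N) (mk 3%N) (mk 4%N) (mk 5%N) /=.
have -> : (s + 5 <= 4)%N = false by lia.
have -> : (s + 5 <= 5)%N = false by lia.
have -> : (s + 5 <= 6)%N = false by lia.
lia.
Qed.

Lemma potential_CE k l : (2 <= k)%N ->
  potential (CE s k l) = (potential l + 3 * E (el (CE s k l) * (c' s)^-1)%g)%R.
Proof.
move=> k2; rewrite /CE; set M := MID _ _.
have hM : potential (lb :: M) = potential l.
  rewrite -(potential_MID (n := s) l _ k2) // /M.
  case: (s) s2 => // n _; set R := nseq (5 + n) la ++ MID n (lb :: nseq k la ++ l).
  rewrite -[X in potential X = _]/(nseq 2 lb ++ R) -[X in _ = potential X]/(nseq 1 lb ++ R).
  by rewrite !potential_plain //; lia.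
set D6 := DN 6 s.-1 (lA :: lb :: M).
have -> : DN 4 s.+1 (lA :: lb :: M) = nseq 1 lA ++ (nseq 4 lB ++ (nseq 1 lA ++ (nseq 5 lB ++ D6))).
  by rewrite /D6; case: (s) s2.
have ED : isEp D6.
  rewrite /D6; case: (s) s2 => [|[|n]] // _; case: n => [|n].
    by rewrite /isEp [DN _ _ _]/=.
  by rewrite /isEp [DN _ _ _]/=.
rewrite (potential_a 1) potential_plain; [|lia|by []|]; last first.
  by case/prefixP: (ED) => l' ->.
rewrite potential_a (potential_Ep ED) potential_DN ?hM //; last by case: (s) s2 => // n _; lia.
by congr (_ + 3 * E _)%R; rewrite (el_nseq 1) !el_nseq !leE !expVgn expg1.

Qed.

(** The hypotheses protect the initial b^4 of the block: it must neither prolong a run of [l] nor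
    follow a pattern that would mark it. *)
Lemma potential_CEi l : plain false l -> hd_neq lb l ->
  potential (CEi s l) = (potential l - 3 * E (el (CEi s l)))%R.
Proof.
move=> pl nl; rewrite {1}/CEi potential_DA // potential_UB ?s2 ?leqnn //.
rewrite -[UB 2 l]/(nseq 6 lb ++ (nseq 1 la ++ nseq 5 lb ++ (nseq 1 la ++ nseq 4 lb ++ l))).
rewrite potential_Em // potential_a potential_plain //; [|lia|].
  rewrite potential_a potential_plain //; last lia.
  congr (_ - 3 * E _)%R; rewrite el_CEi (el_nseq 1) el_nseq (el_nseq 1) el_nseq.
  rewrite !leE expg1; move: (gb ^+ 5) (gb ^+ 4) => x y.
  by rewrite !invgM !mulgA !mulgK.
rewrite /plain /isEm -[nseq 1 la ++ _]/(la :: (nseq 4 lb ++ l)) prefix_cons eqxx.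
case: l {pl} nl => [//|q l] nl.
by rewrite prefix_nseq_gt.
Qed.

Lemma reduced_MID n l : reduced (lb :: l) -> reduced (MID n (lb :: l)).
Proof.
move=> rl; elim: n => [//|n IHn].
apply: (@reduced_nseq _ 1); last by [].
by apply: reduced_nseq => //; case: n {IHn}.
Qed.

Lemma reduced_DN i n l : (0 < i)%N -> reduced (lA :: l) -> reduced (DN i n (lA :: l)).
Proof.
move=> + rl; elim: n i => [//|n IHn] i i0.
apply: (@reduced_nseq _ 1); last by case: i i0.
by apply: reduced_nseq; [exact: IHn|case: n {IHn}].
Qed.

Lemma reduced_UB n l : hd_neq lB l -> reduced l -> reduced (UB n l).
Proof.
move=> nl rl; elim: n => [|n IHn]; first exact: (@reduced_nseq _ 4).
apply: (@reduced_nseq _ (5 + n)); last by [].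
by apply: (@reduced_nseq _ 1) => //; case: n {IHn}.
Qed.

Lemma reduced_DA i n l : (0 < i)%N -> reduced (lB :: l) -> reduced (DA i n (lB :: l)).
Proof.
move=> + rl; elim: n i => [//|n IHn] i i0.
apply: reduced_nseq; last by [].
apply: (@reduced_nseq _ 1); first exact: IHn.
by case: n {IHn}.
Qed.

Lemma reduced_CE k l : (0 < k)%N -> reduced l -> hd_neq lA l -> reduced (CE s k l).
Proof.
move=> k0 rl nl; apply: reduced_DN => //.
have rM : reduced (MID s (lb :: nseq k la ++ l)).
  apply: reduced_MID; apply: (@reduced_nseq _ 1); first exact: reduced_nseq.
  by case: k k0.
apply: (@reduced_nseq _ 1 lA (nseq 1 lb ++ _)); last by [].
by apply: (@reduced_nseq _ 1) => //; case: (s).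
Qed.

Lemma reduced_CEi l : reduced l -> hd_neq lB l -> reduced (CEi s l).
Proof.
move=> rl nl; apply: reduced_DA => //.
apply: (@reduced_nseq _ 1 lB (nseq 1 la ++ _)); last by [].
by apply: (@reduced_nseq _ 1); [exact: reduced_UB|case: (s)].
Qed.

Lemma size_MID n l : (size l <= size (MID n l))%N.
Proof.
elim: n => [//|n IHn]; apply: (leq_trans IHn).
by rewrite -[MID n.+1 l]/((lb :: nseq (5 + n) la) ++ MID n l) size_cat leq_addl.
Qed.

Lemma size_DN i n l : (size l <= size (DN i n l))%N.
Proof.
elim: n i => [//|n IHn] i; apply: (leq_trans (IHn i.+1)).
by rewrite -[DN i n.+1 l]/((lA :: nseq i lB) ++ DN i.+1 n l) size_cat leq_addl.
Qed.

Lemma size_UB n l : (size l < size (UB n l))%N.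
Proof.
elim: n => [|n IHn]; first by rewrite -[UB 0 l]/(nseq 4 lb ++ l) size_cat size_nseq -add1n leq_add2r.
apply: (leq_trans IHn).
rewrite -[UB n.+1 l]/(nseq (5 + n) lb ++ [:: la] ++ UB n l).
by rewrite catA size_cat leq_addl.
Qed.

Lemma size_DA i n l : (size l <= size (DA i n l))%N.
Proof.
elim: n i => [//|n IHn] i; apply: (leq_trans (IHn i.+1)).
rewrite -[DA i n.+1 l]/(nseq i lA ++ [:: lB] ++ DA i.+1 n l).
by rewrite catA size_cat leq_addl.
Qed.

Lemma size_CE k l : (size l + 2 <= size (CE s k l))%N.
Proof.
apply: leq_trans (size_DN _ _ _); rewrite addn2 /= !ltnS.
apply: leq_trans (size_MID _ _); by rewrite /= size_cat leqW // leq_addl.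
Qed.

Lemma size_CEi l : (size l + 2 <= size (CEi s l))%N.
Proof.
apply: leq_trans (size_DA _ _ _); rewrite addn2 /= !ltnS.
exact: ltnW (size_UB _ _).
Qed.

Definition psiL (z : bool * bool) : F2 :=
  letter_eval (fun x : bool => if x then c' s else gb) z.

(* The suffixes that make the marks of the following block exact. *)
Definition Good (z : bool * bool) (l : word bool) :=
  match z with
  | (false, e) => let j := run (true, e) l in
      (0 < j)%N && [|| s + 5 <= j, isP1 (drop j l) | isP2 (drop j l)]%N
  | (true, false) => isP1 l
  | (true, true) => isP2 l
  end.

Definition incr (z : bool * bool) (l l' : word bool) : int :=
  match z with
  | (false, false) => A (el l)
  | (false, true) => - A (el l')
  | (true, false) => 3 * E (el l)
  | (true, true) => - (3 * E (el l'))
  end%R.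

Lemma nf_CE l : reduced l -> hd_neq lA l -> nf (el l * c' s) = CE s 4 l.
Proof.
move=> rl nl; rewrite -(nf_el (reduced_CE (k := 4) _ rl nl)) // el_CE.
by move: (ga ^+ 4) => x; rewrite mulgK.
Qed.

Lemma nf_CE_A l : reduced (lA :: l) -> hd_neq lA l ->
  nf (el (lA :: l) * c' s) = CE s 3 l.
Proof.
move=> rl nl; rewrite -(nf_el (l := CE s 3 l)); last first.
  by apply: reduced_CE => //; exact: path_sorted rl.
rewrite el_CE el_cons leE (expgS ga 3); move: (ga ^+ 3) => x.
by rewrite mulgKA.
Qed.

Lemma nf_CEi l : reduced l -> hd_neq lA l -> nf (el l * (c' s)^-1) = CEi s (la :: l).
Proof.
move=> rl nl; rewrite -(nf_el (l := CEi s (la :: l))); last first.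
  by apply: reduced_CEi => //; apply: (@reduced_nseq _ 1).
by rewrite el_CEi el_cons leE mulgK.
Qed.

Lemma nf_CEi_A l : reduced (lA :: l) -> hd_neq lB l ->
  nf (el (lA :: l) * (c' s)^-1) = CEi s l.
Proof.
move=> rl nl; rewrite -(nf_el (l := CEi s l)); last first.
  by apply: reduced_CEi => //; exact: path_sorted rl.
by rewrite el_CEi el_cons leE.
Qed.

Lemma isP1_CE k l : isP1 (CE s k l).
Proof. by case: (s) s2. Qed.

Lemma isP2_CEi l : isP2 (CEi s l).
Proof. by case: (s) s2. Qed.

Lemma run_hd_neq p l : hd_neq p l -> run p l = 0%N.
Proof. by case: l => [//|q l] /= pq; rewrite /run /= pq. Qed.

Lemma hd_run p q l : (0 < run p l)%N -> q != p -> hd_neq q l.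
Proof.
by case: l => [//|r l]; rewrite /run /=; case: (eqVneq r p) => [-> _|//]; rewrite eq_sym.
Qed.

Lemma mark_Good_a e l : Good (false, e) l || isP1 l || isP2 l -> hd_neq (true, ~~ e) l ->
  mark ((true, e) :: l) = incr (false, e) l ((true, e) :: l) /\
  Good (false, e) ((true, e) :: l).
Proof.
move=> gl nl; have [l' [El nl']] := run_split (true, e) l.
set j := run _ l in El; have Ej : (true, e) :: l = nseq j.+1 (true, e) ++ l'.
  by rewrite [in LHS]El.
have P : [|| s + 5 <= j.+1, isP1 l' | isP2 l']%N.
  move: gl; rewrite -orbA => /orP[/andP[_]|P].
    rewrite -/j El drop_size_cat ?size_nseq // => /or3P[js|->|->]; rewrite ?orbT //.
    by rewrite leqW.
  suff <- : l = l' by rewrite P orbT.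
  by rewrite El /j run_hd_neq //; case/orP: P => /prefixP[r ->].
split; last by rewrite /Good Ej run_nseq // drop_size_cat ?size_nseq.
have -> : mark ((true, e) :: l) = markb e j.+1 ((true, e) :: l) l'.
  by rewrite Ej mark_run.
by rewrite /markb P; case: (e).
Qed.

(** The danger is that [l] ends with a b^5 and the a that opens c'^-1 then completes [isEm]. But a
    last run of exactly 5 letters in a good word follows an end of c' or c'^-1, so it is preceded by
    a^-1 and not by a. *)
Lemma Good_plain e l : reduced l -> Good (false, e) l -> plain false (la :: l).
Proof.
move=> rl /andP[j0 P].
rewrite -[plain _ _]/(~~ prefix (nseq 5 lb ++ [:: la]) l).
have [l' [El nl']] := run_split (true, e) l.
move: P j0 El nl'; move: (run _ l) => j P j0 El nl'.
case: e El P nl' => El P nl'; first by rewrite El; case: (j) j0.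
rewrite {1}El; case: (ltnP 5 j) => j5; first by rewrite prefix_nseq_lt.
move: P; rewrite El drop_size_cat ?size_nseq // => P.
have {P} : isP1 l' || isP2 l' by case/or3P: P => [|->|->]; rewrite ?orbT //; lia.
case: (ltngtP j 5) j5 => // j5 _ P.
  by case/orP: P => /prefixP[r Er]; rewrite Er prefix_nseq_gt.
by rewrite j5; case/orP: P => /prefixP[r ->].
Qed.

(** The word c' begins with a^4 and ends with a^-1, and c'^-1 begins with a b^4 and ends with a^-4.
    So consecutive blocks lose at most one pair a^-1 a, and only between two equal blocks; all
    marked letters and the recognisable ends survive. *)
Lemma step_Good z z' l : reduced l -> Good z l -> z' != linv z ->
  let l' := nf (el l * psiL z') in
  [/\ Good z' l', potential l' = (potential l + incr z' l l')%R & (size l < size l')%N].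
Proof.
move=> rl; case: z' => [[] e']; last first.
  move=> gl nz /=; rewrite /psiL.
  have -> : letter_eval (fun x : bool => if x then c' s else gb) (false, e') =
    letter_eval (@free_gen bool) (true, e') by case: (e').
  rewrite -el_cons.
  have nl : hd_neq (true, ~~ e') l.
    case: z gl nz => [[] e]; first by case: e => /prefixP[r ->].
    case: (eqVneq e e') => [-> /andP[/hd_run + _] _|ne _]; last first.
      by rewrite /linv xpair_eqE /=; case: e e' ne => [] [].
    by apply; rewrite xpair_eqE /=; case: (e').
  have rl' : reduced ((true, e') :: l) by exact: (@reduced_nseq _ 1).
  rewrite nf_el // potential_cons.
  have [|mE gE] := mark_Good_a (e := e') (l := l) _ nl; last first.
    by split=> //; rewrite mE; case: (e').
  case: z gl nz => [[] e]; first by case: e => /= ->; rewrite ?orbT.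
  by case: (eqVneq e e') => [-> -> //|]; rewrite /linv xpair_eqE /=; case: (e) (e') => [] [].
move=> gl nz /=.
case: e' nz => nz; rewrite /psiL /letter_eval /=.
  have [[l0 El]|nl] : (exists l0, l = lA :: l0) \/ hd_neq lA l.
    by case: (l) => [|q l0]; [right|case: (eqVneq q lA) => [->|?]; [left; exists l0|right]].
  - subst l; rewrite nf_CEi_A //; last first.
      by case: z gl nz => [[] []] // /prefixP[r [->]].
    have z_eq : z = (true, true).
      by case: z gl nz => [[] []].
    rewrite z_eq in gl; rewrite isP2_CEi potential_CEi //.
    + by split=> //=; rewrite ?addr0 //; have := size_CEi l0; rewrite addn2.
    + by case/prefixP: gl => r [->].
    + by case/prefixP: gl => r [->].
  - rewrite nf_CEi // isP2_CEi potential_CEi //; last first.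
      case: z gl nz => [[] []]; try by case/prefixP=> r El; rewrite El in nl.
      - by move=> + _; apply: Good_plain.
      - by move=> + _; apply: Good_plain.
    split=> //; first by rewrite (potential_a 1 false).
    by have := size_CEi (la :: l); rewrite addn2; move/ltnW/ltnW.
have [[l0 El]|nl] : (exists l0, l = lA :: l0) \/ hd_neq lA l.
  by case: (l) => [|q l0]; [right|case: (eqVneq q lA) => [->|?]; [left; exists l0|right]].
- subst l; have z_eq : z = (true, false) by case: z gl nz => [[] []].
  rewrite z_eq in gl; rewrite nf_CE_A //; last by case/prefixP: gl => r [->].
  rewrite isP1_CE potential_CE //; split=> //.
    rewrite el_CE el_cons leE (expgS ga 3) mulgKA /= addr0.
    by move: (c' s) => c; rewrite mulgK.
  by have := size_CE 3 l0; rewrite addn2.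
- rewrite nf_CE // isP1_CE potential_CE //; split=> //.
    by rewrite el_CE; move: (c' s) (ga ^+ 4) => c x; rewrite !mulgK.
  by have := size_CE 4 l; rewrite addn2; move/ltnW.
Qed.

Lemma step_e e l : reduced l -> hd_neq lA l ->
  let l' := nf (el l * psiL (true, e)) in Good (true, e) l' /\ (size l < size l')%N.
Proof.
move=> rl nl /=; case: e; rewrite /psiL /letter_eval /=.
  rewrite nf_CEi // isP2_CEi; split=> //.
  by have := size_CEi (la :: l); rewrite addn2; move/ltnW/ltnW.
rewrite nf_CE // isP1_CE; split=> //.
by have := size_CE 4 l; rewrite addn2; move/ltnW.
Qed.

Definition Psi : {multiplicative F2 -> F2} :=
  free_hom (fun x : bool => if x then c' s else gb).

Lemma Psi_cons z V : Psi (el (z :: V)) = Psi (el V) * psiL z.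
Proof.
rewrite el_cons gmulfM /psiL; congr (_ * _).
by rewrite -fpi_letter /Psi /= free_hom_fpi word_eval_seq1.
Qed.

Lemma Psi_nil : Psi (el [::]) = 1.
Proof. exact: gmorph1. Qed.

(** Until the first c' or c'^-1 the image is a power of b without a good ending; [step_e] supplies
    the first good ending and [step_Good] keeps it. As the normal form is nonempty in both cases,
    this also yields the injectivity of [Psi]. *)
Lemma nf_Psi z V : reduced (z :: V) -> let l := nf (Psi (el (z :: V))) in
  Good z l /\ (size (z :: V) <= size l)%N \/
  exists2 e, z = (false, e) & l = nseq (size V).+1 (true, e).
Proof.
elim: V z => [|y V IHV] z rV /=.
  rewrite Psi_cons Psi_nil -[1]/(el [::]).
  case: z {rV} => [] [] e; first by left; apply: step_e.
  right; exists e => //; rewrite -[psiL _]/(letter_eval _ (true, e)).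
  by rewrite /psiL; case: e; rewrite -el_cons nf_el.
have [rzy ry] : z != linv y /\ reduced (y :: V).
  by move: rV => /= /andP[]; rewrite /nocancel eq_linv.
rewrite Psi_cons -[Psi _]el_nf.
have [[gl sl]|[e yE lE]] := IHV _ ry.
  left; have [g' _ s'] := step_Good (nf_reduced _) gl rzy.
  by split=> //; apply: leq_ltn_trans s'.
rewrite lE; case: z rzy {rV} => [] [] e' rzy.
  left; have [||g' s'] := @step_e e' (nseq (size V).+1 (true, e)) => //.
    by rewrite -lE; apply: nf_reduced.
  by split=> //; apply: leq_trans s'; rewrite size_nseq.
have ee' : e' = e by move: rzy; rewrite yE /linv xpair_eqE /=; case: (e') (e) => [] [].
right; exists e; rewrite ?ee' //; rewrite /psiL.
have -> : letter_eval (fun x : bool => if x then c' s else gb) (false, e) =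
  letter_eval (@free_gen bool) (true, e) by case: (e).
by rewrite -el_cons nf_el // -[_ :: _]/(nseq (size V).+2 _) -[nseq _ _]cats0 reduced_nseq.
Qed.

Lemma nf_Psi_Good z V : reduced (z :: V) -> (s + 5 <= size (z :: V))%N ->
  let l := nf (Psi (el (z :: V))) in Good z l /\ (size (z :: V) <= size l)%N.
Proof.
move=> rV sV l; have [//|[e zE lE]] := nf_Psi rV.
rewrite /l lE size_nseq; split=> //; rewrite zE /Good.
by rewrite -[nseq _ _]cats0 run_nseq //= sV.
Qed.

(** If the last run has fewer than s + 5 letters, more than 6 of the s + 11 letters remain, enough
    to see the six-letter patterns [isP1] and [isP2]; otherwise the run alone decides. *)
Lemma Good_cat z y l : (s + 11 <= size y)%N -> Good z (y ++ l) = Good z y.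
Proof.
have pc p r : (size p <= size r)%N -> prefix p (r ++ l) = prefix p r.
  by move=> pr; rewrite !prefixE takel_cat.
move=> sy; have y6 : (6 <= size y)%N by apply: leq_trans sy; lia.
case: z => [[] e]; first by case: e; apply: pc.
rewrite /Good; set p := (true, e); have [y' [Ey ny]] := run_split p y.
have sE : size y = (run p y + size y')%N by rewrite {1}Ey size_cat size_nseq.
case: (leqP (s + 5) (run p y)) => jy.
  have jl : (s + 5 <= run p (y ++ l))%N.
    by rewrite Ey -catA; apply: leq_trans jy (run_nseq_le _ _ _).
  have s0 : (0 < s + 5)%N by rewrite addnS.
  by rewrite jl (leq_trans s0 jl) (leq_trans s0 jy).
have sy' : (6 <= size y')%N by move: sy; rewrite sE; move: jy; clear; lia.
have ny' : hd_neq p (y' ++ l) by case: (y') ny sy'.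
have -> : run p (y ++ l) = run p y by rewrite {1}Ey -catA run_nseq.
rewrite (leqNgt (s + 5)) jy /=; have -> : drop (run p y) (y ++ l) = y' ++ l.
  by rewrite {2}Ey -catA drop_size_cat // size_nseq.
have -> : drop (run p y) y = y' by rewrite {2}Ey drop_size_cat // size_nseq.
by rewrite /isP1 /isP2 !pc.
Qed.

Section Oscillation.
Hypotheses (A1 : forall q, (`|A q| <= 1)%R) (E1 : forall q, (`|E q| <= 1)%R).

Lemma mark_le1 l : (`|mark l| <= 1)%R.
Proof.
case: l => [|p l] //=; case: p.1 => //; rewrite /markb.
by case: p.2; do ![case: ifP => _] => //; rewrite ?normrN.
Qed.

(** Multiplication by a letter adds or deletes one letter at the end of the normal form, and marks
    look only backwards, so exactly one mark enters or leaves. This makes the cochain bounded on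
    b-edges. *)
Lemma potential_push p l : (`|potential (push p l) - potential l| <= 1)%R.
Proof.
case: l => [|q l]; rewrite /push.
  by have := mark_le1 [:: p]; rewrite potential_cons; have : potential [::] = 0%R by []; lia.
case: ifP => _; first by have := mark_le1 (q :: l); rewrite (potential_cons q); lia.
by have := mark_le1 [:: p, q & l]; rewrite (potential_cons p); lia.
Qed.

Lemma potential_pushw w l : (`|potential (pushw l w) - potential l| <= (size w)%:Z)%R.
Proof.
elim: w l => [|p w IHw] l; first by rewrite /= subrr.
rewrite pushw_cons; have := IHw (push p l); have := potential_push p l.
rewrite /= ; lia.
Qed.

Variable H : F2 -> int.
Hypothesis Ha : forall q, H (q * gb) = (H q + A q)%R.
Hypothesis He : forall q, H (q * c' s) = (H q + 3 * E q)%R.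

Lemma H_step q z : H (q * psiL z) = (H q + incr z (nf q) (nf (q * psiL z)%g))%R.
Proof.
rewrite /psiL; case: z => [] [] [] /=; rewrite /letter_eval /= ?el_nf.
- by have := He (q / c' s); rewrite mulgVK => ->; rewrite addrK.
- exact: He.
- by have := Ha (q / gb); rewrite mulgVK => ->; rewrite addrK.
- exact: Ha.
Qed.

Definition err q := (potential (nf q) - H q)%R.

Definition stepM : nat :=
  \max_(z : bool * bool) (size (repr (psiL z)) + 3).

Lemma err_step q z : (`|err (q * psiL z)%g - err q| <= stepM%:Z)%R.
Proof.
have zM : (size (repr (psiL z)) + 3 <= stepM)%N by exact: leq_bigmax.
have := potential_pushw (repr (psiL z)) (nf q).
rewrite -nf_mul_fpi fpi_repr /err H_step.
have : (`|incr z (nf q) (nf (q * psiL z)%g)| <= 3)%R.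
  case: z {zM} => [] [] [] /=.
  - by have := E1 (el (nf (q * psiL (true, true)))); lia.
  - by have := E1 (el (nf q)); lia.
  - by have := A1 (el (nf (q * psiL (false, true)))); lia.
  - by have := A1 (el (nf q)); lia.
move: (incr _ _ _) => i; lia.
Qed.

Lemma err_word q V : (`|err (q * Psi (el V))%g - err q| <= (stepM * size V)%:Z)%R.
Proof.
elim: V => [|z V IHV]; first by rewrite Psi_nil mulg1 subrr.
rewrite Psi_cons mulgA (le_trans (ler_distD (err (q * Psi (el V))%g) _ _)) //.
by rewrite -[size _]/(size V).+1 mulnS PoszD lerD // err_step.
Qed.

Definition oscN := (2 * (s + 11))%N.

(** By minimality of [q0], the part of the word of [Psi (el V)] that cancels against it is no longer
    than the part that survives. For |V| >= 2 (s+11) at least s + 11 letters survive, so [Good_cat]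
    applies, and from then on potential and H have equal increments. *)
Lemma err_min q0 V :
  (forall v, (size (nf q0) <= size (nf (q0 * Psi v)%g))%N) ->
  reduced V -> (`|err (q0 * Psi (el V))%g - err q0| <= (stepM * oscN)%:Z)%R /\
  ((oscN <= size V)%N -> if V is z :: _ then Good z (nf (q0 * Psi (el V))) else true).
Proof.
move=> qmin; elim: V => [|z V IHV] rV; first by rewrite Psi_nil mulg1 subrr.
have {IHV} [eV gV] := IHV (path_sorted rV).
case: (ltnP (size V) oscN) => sV; last first.
  case: V rV eV gV sV => [|y V] rV eV gV sV; first by rewrite /oscN addnS in sV.
  have rzy : z != linv y by move: rV => /= /andP[]; rewrite /nocancel eq_linv.
  have := step_Good (nf_reduced _) (gV sV) rzy; rewrite el_nf -mulgA -Psi_cons.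
  case=> g' hE _; split=> //; move: eV.
  have := H_step (q0 * Psi (el (y :: V))) z; rewrite -mulgA -Psi_cons.
  by rewrite /err hE => ->; move: (incr _ _ _) => i; lia.
split=> [|sV'].
  by apply: le_trans (err_word _ _) _; rewrite lez_nat leq_mul2l sV orbT.
have [|g' s'] := nf_Psi_Good rV.
  by apply: leq_trans sV'; rewrite /oscN; lia.
set l := nf _ in g' s'; have rl : reduced (rev l) by rewrite reduced_rev nf_reduced.
have [x [y [l' [E1' E2 E3]]]] := pushw_split (nf_reduced q0) rl.
have E4 : nf (q0 * Psi (el (z :: V))) = rev y ++ l'.
  by rewrite -E3 -nf_mul_fpi /l nfK.
have := qmin (el (z :: V)); rewrite E4 E2 !size_cat size_map size_rev leq_add2r => xy.
have := congr1 size E1'; rewrite size_rev size_cat => sl.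
have lE : l = rev y ++ rev x by rewrite -rev_cat -E1' revK.
have sy : (s + 11 <= size (rev y))%N.
  by rewrite size_rev; move: sV' s' sl xy; rewrite /oscN /=; lia.
by rewrite Good_cat // -(Good_cat z (rev x) sy) -lE.
Qed.

(* Start at a point of the coset q Psi(F2) with shortest normal form: after a bounded
   number of steps every further step grows the word, and the marks are then exact. *)
Theorem oscillation q v :
  (`|err (q * Psi v)%g - err q| <= (2 * (stepM * oscN))%:Z)%R.
Proof.
have /ex_minnP[m /asboolP[v0 mE] mmin] :
    exists m, `[< exists v, size (nf (q * Psi v)) = m >].
  by exists (size (nf q)); apply/asboolP; exists 1; rewrite gmorph1 mulg1.
pose q0 := q * Psi v0.
have qmin u : (size (nf q0) <= size (nf (q0 * Psi u)%g))%N.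
  rewrite /q0 mE -mulgA -gmulfM; apply: mmin.
  by apply/asboolP; eexists.
have B u : (`|err (q * Psi u)%g - err q0| <= (stepM * oscN)%:Z)%R.
  have -> : q * Psi u = q0 * Psi (el (nf (v0^-1 * u))).
    by rewrite el_nf /q0 -mulgA -gmulfM mulVKg.
  by have [] := err_min qmin (nf_reduced (v0^-1 * u)).
have := B v; have := B 1; rewrite gmorph1 mulg1; lia.
Qed.

End Oscillation.
End Potential.

(** * Mapping tori *)

(* For injective [phi], the HNN extension of [F] along [phi] acts on germs at
   infinity of sequences in [F]: [x] multiplies the n-th term by [phi^n x] and the
   stable letter is the shift. *)
Section MappingTorus.
Variables (F : groupType) (phi : {multiplicative F -> F}).

Definition germ_eq (x y : nat -> F) := exists N, forall n, (N <= n)%N -> x n = y n.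

Lemma germ_eqb_equiv : equiv_class_of (fun x y : nat -> F => `[< germ_eq x y >]).
Proof.
split=> [x|x y|y x z].
- by apply/asboolP; exists 0%N.
- by apply/asboolP/asboolP => -[N NP]; exists N => n /NP.
- move=> /asboolP[N1 P1] /asboolP[N2 P2]; apply/asboolP; exists (maxn N1 N2) => n.
  by rewrite geq_max => /andP[/P1 -> /P2].
Qed.
Canonical germ_equiv := EquivRelPack germ_eqb_equiv.
Definition germ := {eq_quot germ_equiv}.
HB.instance Definition _ := Choice.on germ.
HB.instance Definition _ := EqQuotient.on germ.

Definition germ_of (x : nat -> F) : germ := \pi_germ x.

Lemma germ_ofP x y : germ_of x = germ_of y <-> germ_eq x y.
Proof. by split=> [/(eqmodP germ_equiv)/asboolP|H] //; apply/eqmodP/asboolP. Qed.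

Lemma germ_repr (x : germ) : germ_of (repr x) = x. Proof. exact: reprK. Qed.

Definition germ_map (f : (nat -> F) -> nat -> F) (x : germ) := germ_of (f (repr x)).

Definition germ_ext f := forall x y, germ_eq x y -> germ_eq (f x) (f y).

Lemma germ_mapE f x : germ_ext f -> germ_map f (germ_of x) = germ_of (f x).
Proof. by move=> ef; apply/germ_ofP/ef/germ_ofP; rewrite germ_repr. Qed.

Lemma germ_map_can f g : germ_ext f -> germ_ext g ->
  (forall x, germ_eq (g (f x)) x) -> cancel (germ_map f) (germ_map g).
Proof.
move=> ef eg fg x; rewrite -(germ_repr x) !germ_mapE //.
exact/germ_ofP.
Qed.

Definition act (w : F) (x : nat -> F) n := iter n phi w * x n.
Definition shiftr (x : nat -> F) n := x n.-1.
Definition shiftl (x : nat -> F) n := x n.+1.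

Lemma iter_phiM n : {morph iter n phi : x y / x * y}.
Proof. by elim: n => [//|n IHn] x y; rewrite !iterS IHn gmulfM. Qed.

Lemma iter_phi1 n : iter n phi 1 = 1.
Proof. by elim: n => [//|n IHn]; rewrite iterS IHn gmorph1. Qed.

Lemma act_ext w : germ_ext (act w).
Proof. by move=> x y [N NP]; exists N => n /NP xy; rewrite /act xy. Qed.

Lemma shiftr_ext : germ_ext shiftr.
Proof. by move=> x y [N NP]; exists N.+1 => -[//|n] /NP. Qed.

Lemma shiftl_ext : germ_ext shiftl.
Proof. by move=> x y [N NP]; exists N => n Nn; apply: NP; rewrite leqW. Qed.

Lemma actK w x : germ_eq (act w^-1 (act w x)) x.
Proof. by exists 0%N => n _; rewrite /act mulgA -iter_phiM mulVg iter_phi1 mul1g. Qed.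

Lemma actVK w x : germ_eq (act w (act w^-1 x)) x.
Proof. by exists 0%N => n _; rewrite /act mulgA -iter_phiM mulgV iter_phi1 mul1g. Qed.

Lemma shiftrK x : germ_eq (shiftl (shiftr x)) x. Proof. by exists 0%N. Qed.
Lemma shiftlK x : germ_eq (shiftr (shiftl x)) x. Proof. by exists 1%N => -[]. Qed.

Definition torus_base (w : F) : bij germ :=
  Bij (germ_map_can (act_ext w) (act_ext w^-1) (actK w))
      (germ_map_can (act_ext w^-1) (act_ext w) (actVK w)).

Definition torus_shift : bij germ :=
  Bij (germ_map_can shiftr_ext shiftl_ext shiftrK)
      (germ_map_can shiftl_ext shiftr_ext shiftlK).

Lemma torus_baseE w x : torus_base w (germ_of x) = germ_of (act w x).
Proof. exact: germ_mapE (act_ext w). Qed.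

Lemma torus_baseM : {morph torus_base : u v / u * v}.
Proof.
move=> u v; apply: bij_ext => x; rewrite bij_mulE -(germ_repr x) !torus_baseE.
by apply/germ_ofP; exists 0%N => n _; rewrite /act iter_phiM mulgA.
Qed.

HB.instance Definition _ := isMultiplicative.Build _ _ torus_base torus_baseM.

Lemma torus_conj w :
  torus_shift^-1 * torus_base w * torus_shift = torus_base (phi w).
Proof.
apply: bij_ext => x; rewrite !bij_mulE -(germ_repr x) bij_VE /=.
rewrite (germ_mapE _ shiftr_ext) (germ_mapE _ (act_ext _)) (germ_mapE _ shiftl_ext).
rewrite (germ_mapE _ (act_ext _)); apply/germ_ofP; exists 0%N => n _.
by rewrite /shiftl /act /shiftr iterSr.
Qed.

Lemma torus_base_inj : injective phi -> injective torus_base.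
Proof.
move=> phiI; apply: gmorph_inj => w /(congr1 (fun f : bij germ => f (germ_of (fun=> 1)))).
rewrite torus_baseE => /germ_ofP[N /(_ N (leqnn N))]; rewrite /act mulg1.
elim: N => [//|N IHN]; rewrite iterS => eN; apply: IHN; apply: phiI.
by rewrite eN gmorph1.
Qed.

End MappingTorus.

(* A spanning tree of the coset graph, given by coset representatives [tau], and the
   crossed homomorphism [TH] reading off the edges outside the tree. *)
Section NielsenSchreier.
Variables (X : choiceType) (M : set (free_group X)).
Hypothesis sM : subgroup M.
Local Notation F := (free_group X).
Local Notation lt p := (letter_eval (@free_gen X) p).
Implicit Types (g h v : F) (p : X * bool).

Lemma lt_linv p : lt (linv p) = (lt p)^-1.
Proof. by case: p => x e; rewrite /linv letter_evalN. Qed.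

Lemma dist_exists g : exists n, `[< exists2 h, M h & size (nf (h * g)) = n >].
Proof. by exists (size (nf (1 * g))); apply/asboolP; exists 1; [apply: subgroup1|]. Qed.

Definition dist g := ex_minn (dist_exists g).

Lemma distM h g : M h -> dist (h * g) = dist g.
Proof.
move=> Mh; apply: eq_ex_minn => n; apply/asbool_equiv_eq; split=> -[k Mk <-].
  by exists (k * h); rewrite ?mulgA //; apply: subgroupM.
exists (k / h); first exact: sM.2.
by rewrite mulgA mulgVK.
Qed.

Lemma dist1 : dist 1 = 0%N.
Proof.
rewrite /dist; case: ex_minnP => m _ /(_ 0%N); rewrite leqn0 => H.
by apply/eqP/H/asboolP; exists 1; [apply: subgroup1|rewrite mulg1 nf1].
Qed.

Lemma dist0 g : dist g = 0%N -> M g.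
Proof.
rewrite /dist; case: ex_minnP => m /asboolP[h Mh hg] _ m0.
have /nf_eq0 hg1 : nf (h * g) = [::] by apply/size0nil; rewrite hg.
by rewrite -[g](mulKg h) hg1 mulg1; apply: subgroupV.
Qed.

Lemma dist_pred g : (0 < dist g)%N -> exists p, (dist (g / lt p) < dist g)%N.
Proof.
rewrite {1 3}/dist; case: ex_minnP => m /asboolP[h Mh hg] _ m0.
case E: (nf (h * g)) hg => [|p l] hg; first by rewrite -hg in m0.
exists p; apply: (@leq_ltn_trans (size l)); last by rewrite -hg.
rewrite -(distM _ Mh) /dist; case: ex_minnP => k _; apply; apply/asboolP; exists 1.
  exact: (subgroup1 sM).
rewrite mul1g mulgA -(nfK (h * g)) E rev_cons -cats1 fpi_cat fpi_letter mulgK.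
by rewrite nf_fpi_rev //; have := nf_reduced (h * g); rewrite E => /path_sorted.
Qed.

(** The choice depends on [g] only through distances from M, which are constant on each coset M g;
    hence so is [tau]. Each letter picked lowers the distance, so the tree consists of geodesics of
    the coset graph. *)
Definition pick_letter g : option (X * bool) :=
  xget None [set o | if o is Some p then (dist (g / lt p) < dist g)%N : Prop else False].

Lemma pick_letterP g : (0 < dist g)%N ->
  exists2 p, pick_letter g = Some p & (dist (g / lt p) < dist g)%N.
Proof.
move=> /dist_pred[p pP]; rewrite /pick_letter; set S := [set o | _].
have : S (xget None S) by apply: xgetPex; exists (Some p).
by case: (xget None S) => [q|] // qP; exists q.
Qed.

Lemma pick_letterM h g : M h -> pick_letter (h * g) = pick_letter g.
Proof.
move=> Mh; rewrite /pick_letter; congr xget; apply/funext => -[p|] //=.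
by rewrite -mulgA !(distM _ Mh).
Qed.

Fixpoint tree k g : F :=
  if k is k'.+1 then
    if dist g == 0%N then 1 else
    if pick_letter g is Some p then tree k' (g / lt p) * lt p else 1
  else 1.

Definition tau g := tree (dist g) g.

Lemma tree_fuel n k g : (dist g <= n)%N -> (dist g <= k)%N -> tree n g = tree k g.
Proof.
elim: n k g => [|n IHn] k g gn gk.
  by case: k {gk} => //= k; rewrite -leqn0 gn.
case: k gk => [|k] gk; first by rewrite /= -leqn0 gk.
rewrite /=; case: ifPn => //; rewrite -lt0n => g0.
by have [p -> lp] := pick_letterP g0; rewrite (IHn k) // -ltnS (leq_trans lp).
Qed.

Lemma tauM h g : M h -> tau (h * g) = tau g.
Proof.
move=> Mh; rewrite /tau (distM _ Mh).
move: (dist g) => k; elim: k g => [//|k IHk] g /=; rewrite (distM _ Mh) pick_letterM //.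
by case: ifP => // _; case: pick_letter => [p|] //; rewrite -mulgA IHk.
Qed.

Lemma tau1 : tau 1 = 1. Proof. by rewrite /tau dist1. Qed.

Lemma tau_step g : (0 < dist g)%N ->
  exists2 p, tau g = tau (g / lt p) * lt p & (dist (g / lt p) < dist g)%N.
Proof.
move=> g0; have [p gp lp] := pick_letterP g0; exists p => //.
rewrite /tau -(@tree_fuel (dist g).+1 (dist g) g) //= eqn0Ngt g0 /= gp.
by rewrite (@tree_fuel (dist g) (dist (g / lt p))) // ltnW.
Qed.

Lemma tau_ind (P : F -> Prop) : (forall g, dist g = 0%N -> P g) ->
  (forall g p, tau g = tau (g / lt p) * lt p -> P (g / lt p) -> P g) -> forall g, P g.
Proof.
move=> P0 PS g; elim: (dist g) {-2}g (leqnn (dist g)) => [|n IHn] {}g gn.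
  by apply: P0; apply/eqP; rewrite -leqn0.
have [/P0 //|/tau_step[p gp lp]] := posnP (dist g).
by apply: PS gp _; apply: IHn; rewrite -ltnS (leq_trans lp).
Qed.

Lemma tau_coset g : M (g / tau g).
Proof.
elim/tau_ind: g => [g g0|g p -> Mg]; last by rewrite invgM mulgA.
by rewrite /tau g0 invg1 mulg1; apply: dist0.
Qed.

Lemma tau_cosetV g : M (tau g / g).
Proof. by have := subgroupV sM (tau_coset g); rewrite invgF. Qed.

Definition schreier g x : F := tau g * free_gen x / tau (g * free_gen x).

Lemma schreierM h g x : M h -> schreier (h * g) x = schreier g x.
Proof. by move=> Mh; rewrite /schreier -(mulgA h) !(tauM _ Mh). Qed.

Lemma tau_tau g : tau (tau g) = tau g.
Proof. by rewrite -[RHS](tauM g (tau_cosetV g)) mulgVK. Qed.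

Definition edge_pred (q : F * X) := (tau q.1 == q.1) && (schreier q.1 q.2 != 1).

Definition Y := {q : F * X | edge_pred q}.

Definition lam g x : free_group Y :=
  if insub (tau g, x) is Some y then free_gen (y : Y) else 1.

Lemma lamM h g x : M h -> lam (h * g) x = lam g x.
Proof. by move=> Mh; rewrite /lam (tauM _ Mh). Qed.

Lemma schreier_tau g x : schreier (tau g) x = schreier g x.
Proof.
by rewrite -(schreierM g x (tau_cosetV g)) mulgVK.
Qed.

Lemma lam1 g x : schreier g x = 1 -> lam g x = 1.
Proof. by move=> gx; rewrite /lam insubF // /edge_pred /= schreier_tau gx eqxx andbF. Qed.

Definition basis (y : Y) : F := schreier (val y).1 (val y).2.

Lemma basis_lam g x : free_hom basis (lam g x) = schreier g x.
Proof.
rewrite /lam; case: insubP => [y _ yE|]; last first.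
  by rewrite /edge_pred /= tau_tau eqxx negbK schreier_tau => /eqP ->; apply: free_hom1.
by rewrite free_hom_gen /basis yE /= schreier_tau.
Qed.

Definition lamL g p : free_group Y :=
  if p.2 then (lam (g * lt p) p.1)^-1 else lam g p.1.

Fixpoint th g (w : word X) : free_group Y :=
  if w is p :: w' then lamL g p * th (g * lt p) w' else 1.

Lemma th_cat g w1 w2 : th g (w1 ++ w2) = th g w1 * th (g * fpi w1) w2.
Proof.
elim: w1 g => [|p w1 IHw] g /=; first by rewrite fpi_nil mulg1 mul1g.
by rewrite IHw -(cat1s p w1) fpi_cat fpi_letter !mulgA.
Qed.

Lemma th_cons g p w : th g (p :: w) = lamL g p * th (g * lt p) w.
Proof. by []. Qed.

Lemma lamL_linv g p : lamL g p * lamL (g * lt p) (linv p) = 1.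
Proof.
rewrite /lamL lt_linv mulgK.
by case: p => x [] /=; rewrite ?mulVg ?mulgV.
Qed.

Lemma th_free_eq g w1 w2 : free_eq w1 w2 -> th g w1 = th g w2.
Proof.
elim=> [//|? ? _ -> //|? ? ? _ -> _ -> //|u x e v].
rewrite !th_cat -[(x, ~~ e)]/(linv (x, e)) !th_cons lt_linv mulgK; congr (_ * _).
by rewrite mulgA lamL_linv mul1g.
Qed.

Lemma thM h g w : M h -> th (h * g) w = th g w.
Proof.
move=> Mh; elim: w g => [//|p w IHw] g /=.
by rewrite -mulgA IHw /lamL -mulgA !(lamM _ _ Mh).
Qed.

Definition TH g v := th g (repr v).

Lemma TH_mul g v1 v2 : TH g (v1 * v2) = TH g v1 * TH (g * v1) v2.
Proof.
have -> : TH g (v1 * v2) = th g (repr v1 ++ repr v2).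
  by apply: th_free_eq; apply/fpi_eq; rewrite fpi_cat !fpi_repr.
by rewrite th_cat fpi_repr.
Qed.

Lemma TH1 g : TH g 1 = 1.
Proof. by have := TH_mul g 1 1; rewrite !mulg1 => /(congr1 (fun u => (TH g 1)^-1 * u)); rewrite mulVg mulKg. Qed.

Lemma TH_lt g p : TH g (lt p) = lamL g p.
Proof.
rewrite -fpi_letter /TH (@th_free_eq g _ [:: p]) /= ?mulg1 //.
exact: free_eq_repr.
Qed.

Lemma TH_M h g v : M h -> TH (h * g) v = TH g v.
Proof. by move=> Mh; rewrite /TH (thM _ _ Mh). Qed.

Lemma TH_V g v : TH (g * v) v^-1 = (TH g v)^-1.
Proof. by apply/esym/mulg1_eq; rewrite -TH_mul mulgV TH1. Qed.

(** Paths inside the tree read no generator: each step of [tau] gives a trivial Schreier element, in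
    whichever direction its edge is traversed. *)
Lemma TH_tau g : TH 1 (tau g) = 1.
Proof.
elim/tau_ind: g => [g g0|g p gp IHg]; first by rewrite /tau g0 TH1.
rewrite gp TH_mul IHg TH_lt !mul1g.
case: p gp {IHg} => x [] gp; rewrite /lamL /=.
- apply/eqP; rewrite invg_eq1; apply/eqP/lam1.
  rewrite -[tau (g / _) * _]/(tau (g / lt (x, true)) * lt (x, true)) -gp schreier_tau.
  rewrite /schreier gp /letter_eval /= invgK.
  by rewrite mulgVK mulgV.
- apply: lam1; rewrite schreier_tau /schreier /= mulgVK.
  by rewrite gp /letter_eval /= mulgV.
Qed.

Lemma TH_tauV g : TH (tau g) (tau g)^-1 = 1.
Proof. by have := TH_V 1 (tau g); rewrite mul1g TH_tau invg1. Qed.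

Lemma TH_schreier g x : TH 1 (schreier g x) = lam g x.
Proof.
rewrite /schreier TH_mul TH_mul TH_tau !mul1g -[free_gen x]/(lt (x, false)) TH_lt.
have Mg : M (tau g * lt (x, false) / tau (g * lt (x, false))).
  have := subgroupM sM (tau_cosetV g) (tau_coset (g * lt (x, false))).
  by rewrite !mulgA mulgVK.
rewrite -[X in TH X _](mulgVK (tau (g * lt (x, false)))) (TH_M _ _ Mg).
by rewrite TH_tauV mulg1 /lamL /= /lam tau_tau.
Qed.

Lemma basisM u : M (free_hom basis u).
Proof.
rewrite /free_hom; apply: subgroup_prod => // -[y e] _.
have My : M (basis y).
  have := subgroupM sM (subgroupV sM (tau_coset (val y).1))
    (tau_coset ((val y).1 * free_gen (val y).2)).
  by rewrite invgF !mulgA mulgVK.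
by case: e => //; apply: subgroupV.
Qed.

Lemma TH_basisM u v : TH 1 (free_hom basis u * v) = TH 1 (free_hom basis u) * TH 1 v.
Proof. by rewrite TH_mul mul1g -[X in TH X v](mulg1 _) (TH_M _ _ (basisM u)). Qed.

(** On M the crossed homomorphism [TH 1] is an honest homomorphism, and it sends each Schreier
    generator back to its letter, so it is a left inverse. *)
Lemma basis_inj : injective (free_hom basis).
Proof.
suff H u : TH 1 (free_hom basis u) = u by move=> u v uv; rewrite -(H u) uv H.
have Hgen y : TH 1 (basis y) = free_gen y.
  rewrite TH_schreier /lam; have /andP[/eqP ty _] := valP y; rewrite ty.
  by rewrite -surjective_pairing valK.
rewrite -(fpi_repr u); elim: (repr u) => [|[y e] w IHw].
  by rewrite fpi_nil free_hom1 TH1.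
rewrite -cat1s fpi_cat free_hom_mul TH_basisM IHw; congr (_ * _).
rewrite free_hom_fpi word_eval_seq1 fpi_letter /letter_eval.
case: e => /=; last exact: Hgen.
have My : M (basis y) by have := basisM (free_gen y); rewrite free_hom_gen.
by rewrite -Hgen -[RHS]TH_V mul1g -[X in _ = TH X _]mulg1 (TH_M _ _ My).
Qed.

Lemma basis_lamL g p : free_hom basis (lamL g p) = tau g * lt p / tau (g * lt p).
Proof.
case: p => x [] /=; rewrite /lamL /=; last by rewrite basis_lam.
rewrite gmorphV /= basis_lam /schreier /letter_eval /= mulgVK !invgM invgK.
by rewrite mulgA.
Qed.

Lemma basis_surj v : M v -> exists u, free_hom basis u = v.
Proof.
move=> Mv; suff H w : fpi w = free_hom basis (th 1 w) * tau (fpi w).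
  exists (th 1 (repr v)); rewrite -[RHS]fpi_repr H fpi_repr.
  by rewrite -[v in tau v]mulg1 (tauM _ Mv) tau1 mulg1.
elim/last_ind: w => [|w p IHw]; first by rewrite free_hom1 mul1g tau1.
rewrite -cats1 fpi_cat fpi_letter th_cat free_hom_mul mul1g /= mulg1 basis_lamL.
by rewrite {1}IHw !mulgA mulgVK.
Qed.

End NielsenSchreier.

Theorem nielsen_schreier (X : choiceType) (M : set (free_group X)) :
  subgroup M -> free_subgroup M.
Proof.
move=> sM; exists (Y sM), (free_hom (@basis _ _ sM)); split; first exact: basis_inj.
apply/seteqP; split=> [_ [u _ <-]|v Mv]; first exact: basisM.
by have [u <-] := basis_surj sM Mv; exists u.
Qed.

(** * The locally free subgroup *)

Section GroupW.
Variable s : nat.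

Lemma gmorph_W (G H : groupType) (f : {multiplicative G -> H}) x y :
  f (W s x y) = W s (f x) (f y).
Proof.
rewrite /W gmulfM gmorph_prod; congr (_ * _); apply: eq_bigr => i _.
by rewrite gmulfM gmorphX.
Qed.

Definition wsum := (\sum_(4 <= i < (4 + s).+1) i)%N.

Lemma add_W (G : groupType) (Z : zmodType) (f : G -> Z) x y :
  f 1 = 0%R -> {morph f : u v / u * v >-> (u + v)%R} ->
  f (W s x y) = (f x *+ s.+2 + f y *+ wsum)%R.
Proof.
move=> f1 fM; have fX u n : f (u ^+ n) = (f u *+ n)%R.
  by elim: n => [|n IHn]; rewrite ?f1 // expgS fM IHn mulrS.
rewrite /W fM (big_morph f fM f1); under eq_bigr do rewrite fM fX.
rewrite big_split /= sumr_const_nat -sumrMnr addrAC -mulrSr; congr (_ *+ _ + _)%R.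
Qed.

Definition phi : {multiplicative F2 -> F2} :=
  free_hom (fun x : bool => if x then W s gb ga * gb * (W s ga gb)^-1 else gb).

Lemma phi_ga : phi ga = gb.
Proof. by rewrite /phi /= free_hom_gen. Qed.

Lemma phi_gbW : phi gb = W s gb ga * gb * (W s ga gb)^-1.
Proof. by rewrite /phi /= free_hom_gen. Qed.

Lemma phi_gb : phi gb = gb * c' s.
Proof.
rewrite phi_gbW /c' /W.
have -> : \prod_(4 <= i < (4 + s).+1) (gb * ga ^+ i) * gb =
    gb * \prod_(4 <= i < (4 + s).+1) (ga ^+ i * gb) :> F2.
  elim: (4 + s).+1 => [|n IHn]; first by rewrite !big_geq // mulg1 mul1g.
  have [n4|n4] := leqP 4 n; last by rewrite !big_geq // mulg1 mul1g.
  by rewrite !(big_nat_recr n) //= [RHS]mulgA -IHn !mulgA.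
rewrite (big_ltn (m := 4)) ?ltnS ?leq_addr // -addSn.
by move: (ga ^+ 4) => x; rewrite invgM !mulgA.
Qed.

(** The change of basis between [phi] and [Psi]: with phi(a) = b and phi(b) = b c', composing [Psi]
    with b -> a b gives phi, so both have the same image. *)
Definition eta : {multiplicative F2 -> F2} :=
  free_hom (fun x : bool => if x then ga * gb else ga).

Definition eta_inv : {multiplicative F2 -> F2} :=
  free_hom (fun x : bool => if x then ga^-1 * gb else ga).

Lemma etaK : cancel eta eta_inv.
Proof.
move=> v; apply: (free_hom_ext (f := eta_inv \o eta) (g := idfun)) => x /=.
rewrite free_hom_gen; case: x; last exact: free_hom_gen.
by rewrite free_hom_mul !free_hom_gen mulVKg.
Qed.

Lemma Psi_eta v : Psi s (eta v) = phi v.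
Proof.
apply: (free_hom_ext (f := Psi s \o eta) (g := phi)) => x.
case: x; rewrite /= ?[LHS]/=.
  by rewrite -/phi phi_gb free_hom_gen free_hom_mul !free_hom_gen.
by rewrite !free_hom_gen.
Qed.

Lemma Psi_inj : (2 <= s)%N -> injective (Psi s).
Proof.
move=> s2; apply: gmorph_inj => v; rewrite -(el_nf v).
have := nf_reduced v; case: (nf v) => [|z V] rV; first by [].
have := nf_Psi (fun=> 0%R) (fun=> 0%R) s2 rV.
move=> /= + v1; rewrite v1 nf1.
by case=> [[]//|[e]].
Qed.

Lemma phi_inj : (2 <= s)%N -> injective phi.
Proof.
move=> s2 u v; rewrite -!Psi_eta => /(Psi_inj s2) uv.
by rewrite -(etaK u) uv etaK.
Qed.

Local Notation G := (Gs s).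
Local Notation pg := (pgen (Gs_relations s)).
Definition Ga : G := pg (free_gen (@Ordinal 3 0 isT)).
Definition Gb : G := pg (free_gen (@Ordinal 3 1 isT)).
Definition Gt : G := pg (free_gen (@Ordinal 3 2 isT)).

Lemma rel_b : Gt^-1 * Ga * Gt = Gb.
Proof.
rewrite /Gt /Ga -gmorphV -!gmulfM; apply: pgen_rel; left => //.
Qed.

Lemma rel_c : Gt^-1 * Gb * Gt = W s Gb Ga * Gb * (W s Ga Gb)^-1.
Proof.
rewrite /Gt /Ga /Gb -gmorphV -!gmorph_W -gmorphV -!gmulfM.
by apply: pgen_rel; right.
Qed.

Lemma Gs_hom (T : groupType) (a b t : T) :
  t^-1 * a * t = b -> t^-1 * b * t = W s b a * b * (W s a b)^-1 ->
  exists h : {multiplicative G -> T}, [/\ h Ga = a, h Gb = b & h Gt = t].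
Proof.
move=> r1 r2; pose f (i : 'I_3) := nth t [:: a; b; t] i.
pose F : {multiplicative free_group 'I_3 -> T} := free_hom f.
have FE i : F (free_gen i) = f i by exact: free_hom_gen.
have [l r|h hE] := @presented_hom _ (Gs_relations s) T f.
  rewrite -[free_hom f l]/(F l) -[free_hom f r]/(F r).
  have FW x y : F (W s x y * x * (W s y x)^-1) = W s (F x) (F y) * F x * (W s (F y) (F x))^-1.
    by rewrite gmulfM gmorphV gmulfM !gmorph_W.
  case=> -[-> ->]; first by rewrite !gmulfM gmorphV !FE; exact: r1.
  by rewrite FW !gmulfM gmorphV !FE; exact: r2.
by exists h; split; rewrite [LHS]hE.
Qed.

Lemma Gs_ind (P : G -> Prop) : P 1 ->
  (forall g, P g -> [/\ P (g * Ga), P (g * Gb), P (g * Gt) &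
     [/\ P (g * Ga^-1), P (g * Gb^-1) & P (g * Gt^-1)]]) -> forall g, P g.
Proof.
move=> P1 PS g; have [u <-] := pgen_surj g; rewrite -(fpi_repr u).
elim/last_ind: (repr u) => [|w p IHw]; first by rewrite fpi_nil gmorph1.
have [PA PB PT [PA' PB' PT']] := PS _ IHw.
rewrite -cats1 fpi_cat gmulfM fpi_letter; case: p => i e.
have -> : i = nth i [:: @Ordinal 3 0 isT; @Ordinal 3 1 isT; @Ordinal 3 2 isT] i.
  by apply: val_inj; case: i => -[|[|[|]]].
case: i => -[|[|[|//]]] ? /=; case: e; rewrite /letter_eval /= ?gmorphV //.
Qed.

Definition fiber : {multiplicative F2 -> G} := free_hom (fun x : bool => if x then Gb else Ga).

Lemma fiber_a : fiber ga = Ga. Proof. exact: free_hom_gen. Qed.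
Lemma fiber_b : fiber gb = Gb. Proof. exact: free_hom_gen. Qed.

Lemma fiber_phi v : Gt^-1 * fiber v * Gt = fiber (phi v).
Proof.
rewrite -(fpi_repr v); elim: (repr v) => [|[x e] w IHw].
  by rewrite fpi_nil !gmorph1 mulg1 mulVg.
rewrite -cat1s fpi_cat !gmulfM -IHw fpi_letter.
have -> : fiber (phi (letter_eval (@free_gen bool) (x, e))) =
    Gt^-1 * fiber (letter_eval (@free_gen bool) (x, e)) * Gt.
  have gx : fiber (phi (free_gen x)) = Gt^-1 * fiber (free_gen x) * Gt.
    case: x; last by rewrite phi_ga fiber_b fiber_a rel_b.
    by rewrite phi_gbW gmulfM gmorphV gmulfM !gmorph_W !(fiber_a, fiber_b) rel_c.
  case: e => //; rewrite -[letter_eval _ _]/(free_gen x)^-1 !gmorphV gx.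
  by rewrite !invgM invgK mulgA.
by rewrite !mulgA mulgK.
Qed.

(** The torus action on germs extends to all of [Gs s] and restricts on the base group to
    [torus_base], which is faithful because [phi] is injective. *)
Lemma fiber_inj : (2 <= s)%N -> injective fiber.
Proof.
move=> s2; pose B : {multiplicative F2 -> _} := torus_base phi.
have [||h [ha hb ht]] := @Gs_hom _ (B ga) (B gb) (torus_shift _).
- by rewrite torus_conj phi_ga.
- by rewrite torus_conj phi_gbW gmulfM gmorphV gmulfM !gmorph_W.
have hj v : h (fiber v) = B v.
  by apply: (free_hom_ext (f := h \o fiber)) => -[] /=; rewrite ?fiber_a ?fiber_b.
move=> u v /(congr1 h); rewrite !hj.
exact/torus_base_inj/phi_inj.
Qed.

(* The kernel of the map to Z sending t to 1 and a to 0. *)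
Definition ascending : set G := [set g | exists n v, g = Gt ^+ n * fiber v * Gt ^- n].

Lemma ascending_raise n k v : exists u, Gt ^+ n * fiber v * Gt ^- n = Gt ^+ (n + k) * fiber u * Gt ^- (n + k).
Proof.
elim: k => [|k [u ->]]; first by exists v; rewrite addn0.
exists (phi u); rewrite -fiber_phi addnS expgSr; move: (Gt ^+ (n + k)) => x.
by rewrite invgM !mulgA mulgK mulgK.
Qed.

Lemma ascending_subgroup : subgroup ascending.
Proof.
split=> [|x y [n [u ->]] [m [v ->]]].
  by exists 0%N, 1; rewrite gmorph1 mulg1 mulgV.
have [u' ->] := ascending_raise n m u; have [v' ->] := ascending_raise m n v.
exists (n + m)%N, (u' / v'); rewrite gmulfM gmorphV addnC; move: (Gt ^+ _) => z.
by rewrite !invgM invgK !mulgA mulgVK.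
Qed.

Lemma ascending_locally_free : (2 <= s)%N -> locally_free_subgroup ascending.
Proof.
move=> s2 S /finite_seqP[r Sr] SK.
have [n nP] : exists n, forall g, g \in r -> exists v, g = Gt ^+ n * fiber v * Gt ^- n.
  have rK g : g \in r -> ascending g by move=> gr; apply: SK; apply: sub_generated; rewrite Sr.
  elim: r {Sr} rK => [|g r IHr] rK; first by exists 0%N.
  have [n nP] := IHr (fun h hr => rK h (mem_behead (s := g :: r) hr)).
  have [m [v gE]] := rK g (mem_head _ _).
  exists (n + m)%N => h; rewrite in_cons => /predU1P[->|/nP[u ->]].
    by rewrite gE addnC; apply: ascending_raise.
  exact: ascending_raise.
pose f v := Gt ^+ n * fiber v * Gt ^- n.
have fM : {morph f : u v / u * v}.
  by move=> u v; rewrite /f gmulfM; move: (Gt ^+ n) => x; rewrite !mulgA mulgVK.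
pose ff : {multiplicative F2 -> G} := HB.pack f (isMultiplicative.Build _ _ f fM).
have fI : injective ff by move=> u v /mulIg /mulgI; apply: fiber_inj.
have sM : subgroup [set v | generated S (ff v)].
  have [S1 SD] := generated_subgroup S.
  split=> [|u v Su Sv]; first by have := S1; rewrite -(gmorph1 ff).
  by have := SD _ _ Su Sv; rewrite -gmorphV -gmulfM.
have [X [g [gI gM]]] := nielsen_schreier sM.
exists X, (ff \o g : {multiplicative _ -> _}); split; first exact: inj_comp.
apply/seteqP; split=> [_ [u _ <-]|x Sx] /=.
  by have : range g (g u) by [exists u]; rewrite gM.
have [v xE] : exists v, x = ff v.
  have sf : subgroup (range ff).
    split=> [|_ _ [u _ <-] [v _ <-]]; first by exists 1; rewrite // (gmorph1 ff).
    by exists (u / v); rewrite // -(gmorphV ff) -gmulfM.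
  have [|v _ <-] := generated_min sf _ Sx; last by exists v.
  by move=> y; rewrite Sr => /nP[v ->]; exists v.
rewrite xE in Sx *; have : [set v | generated S (ff v)] v by [].
by rewrite -gM => -[u _ <-]; exists u.
Qed.

End GroupW.

(** * Exponent sums with respect to a free basis *)

Section ExponentSums.
Variable X : choiceType.

Definition expsum (x : X) (w : word X) : int :=
  \sum_(p <- w) (if p.2 then -1 else 1)%R *+ (p.1 == x).

Lemma expsum_free_eq x w1 w2 : free_eq w1 w2 -> expsum x w1 = expsum x w2.
Proof.
elim=> [//|? ? _ -> //|? ? ? _ -> _ -> //|u y e v].
rewrite /expsum !big_cat !big_cons /=; congr (_ + _)%R; rewrite addrA -mulrnDl.
by case: e; rewrite /= ?subrr ?addNr mul0rn add0r.
Qed.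

Definition exponent x (u : free_group X) : int := expsum x (repr u).

Lemma exponentM x : {morph exponent x : u v / u * v >-> (u + v)%R}.
Proof.
move=> u v; rewrite /exponent /expsum -big_cat; apply: expsum_free_eq; apply/fpi_eq.
by rewrite fpi_repr fpi_cat !fpi_repr.
Qed.

Lemma exponent1 x : exponent x 1 = 0%R.
Proof.
rewrite /exponent (@expsum_free_eq _ _ [::]) ?/expsum ?big_nil //.
exact: free_eq_repr.
Qed.

Lemma exponentV x u : exponent x u^-1 = (- exponent x u)%R.
Proof. by apply/eqP; rewrite -addr_eq0 -exponentM mulVg exponent1. Qed.

Lemma exponent_eq0 (Z : zmodType) (f : free_group X -> Z) u :
  {morph f : u v / u * v >-> (u + v)%R} -> (forall x, exponent x u = 0%R) -> f u = 0%R.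
Proof.
move=> fM exu; have f1 : f 1 = 0%R.
  by have := fM 1 1; rewrite mulg1 -[LHS]addr0 => /addrI.
have fV v : f v^-1 = (- f v)%R.
  by apply/eqP; rewrite -addr_eq0 -fM mulVg f1.
have fw w : f (fpi w) = (\sum_(x <- undup [seq p.1 | p <- w]) f (free_gen x) *~ expsum x w)%R.
  transitivity (\sum_(p <- w) f (free_gen p.1) *~ (if p.2 then -1 else 1))%R.
    elim: w => [|p w IHw]; first by rewrite fpi_nil big_nil.
    rewrite big_cons -cat1s fpi_cat fM IHw fpi_letter; congr (_ + _)%R.
    by case: p => x [] //=; rewrite /letter_eval /= fV mulrN1z.
  under [RHS]eq_bigr do rewrite /expsum mulrz_sumr.
  rewrite exchange_big; apply: eq_big_seq => p pw.
  rewrite (bigD1_seq p.1) ?undup_uniq ?mem_undup ?map_f //= eqxx mulr1n.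
  by rewrite big1 ?addr0 // => x /negPf xp; rewrite eq_sym xp mulr0n mulr0z.
rewrite -(fpi_repr u) fw big1 // => x _.
by rewrite -/(exponent x u) exu mulr0z.
Qed.

End ExponentSums.

(** * Affine maps of the rational line *)

Section Affine.
Local Open Scope ring_scope.

Definition tr_fun (r q : rat) := q + r.
Lemma tr_funK r : cancel (tr_fun r) (tr_fun (- r)).
Proof. by move=> q; rewrite /tr_fun addrK. Qed.
Lemma tr_funVK r : cancel (tr_fun (- r)) (tr_fun r).
Proof. by move=> q; rewrite /tr_fun subrK. Qed.
Definition tr r : bij rat := Bij (tr_funK r) (tr_funVK r).

Lemma trM x y : tr (x + y) = (tr x * tr y)%g.
Proof. by apply: bij_ext => q; rewrite bij_mulE /= /tr_fun addrAC addrA. Qed.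

Lemma tr0 : tr 0 = 1%g.
Proof. by apply: bij_ext => q; rewrite /= /tr_fun addr0. Qed.

Lemma trN x : tr (- x) = ((tr x)^-1)%g.
Proof. by apply/esym/mulg1_eq; rewrite -trM subrr tr0. Qed.

Lemma trX x n : tr (x *+ n) = (tr x ^+ n)%g.
Proof. by elim: n => [|n IHn]; rewrite ?tr0 // mulrS trM IHn expgS. Qed.

Lemma tr_W s x y : W s (tr x) (tr y) = tr (x *+ s.+2 + y *+ wsum s).
Proof.
rewrite -[in LHS]/tr /W; under eq_bigr do rewrite -trX -trM.
rewrite -(big_morph tr trM tr0) -trM; congr tr.
rewrite big_split /= sumr_const_nat -sumrMnr addrAC -mulrSr.
by congr (_ *+ _ + _).
Qed.

Variables (m : rat) (m0 : m != 0).
Definition sc_fun (q : rat) := - (q / m).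
Definition sc_inv (q : rat) := - (q * m).
Lemma sc_funK : cancel sc_fun sc_inv.
Proof. by move=> q; rewrite /sc_fun /sc_inv mulNr opprK mulfVK. Qed.
Lemma sc_invK : cancel sc_inv sc_fun.
Proof. by move=> q; rewrite /sc_fun /sc_inv mulNr opprK mulfK. Qed.
Definition sc : bij rat := Bij sc_funK sc_invK.

Lemma sc_conj x : (sc^-1 * tr x * sc)%g = tr (- (x * m)).
Proof.
apply: bij_ext => q; rewrite !bij_mulE bij_VE /= /tr_fun /sc_fun /sc_inv.
by rewrite mulrDl mulNr mulfVK // opprD opprK.
Qed.

End Affine.

Section NotFree.
Variable s : nat.
Hypothesis s3 : (3 <= s)%N.
Local Notation G := (Gs s).

Definition multiplier := (wsum s - s.+2)%N.

Lemma wsum_ge : (s.+2 + 2 <= wsum s)%N.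
Proof.
rewrite /wsum; case: s s3 => [|[|[|n]]] // _.
elim: n => [|n IHn]; first by rewrite unlock.
rewrite -[(4 + n.+4)%N]/((4 + n.+3).+1)%N big_nat_recr //=; lia.
Qed.

(** On exponent sums, the functional with values 1 on a and -m on b is an eigenvector for phi with
    eigenvalue -m. It becomes the translation part, and t acts as the scaling by -1/m, conjugation
    by which multiplies translations by -m. *)
Lemma translation_hom : exists h : {multiplicative G -> bij rat},
  [/\ h (Ga s) = tr 1, h (Gb s) = tr (- multiplier%:R)%R &
      forall g r, h g = tr r -> exists r', h (Gt s * g * (Gt s)^-1) = tr r'].
Proof.
have m0 : (multiplier%:R != 0 :> rat)%R.
  by rewrite pnatr_eq0 /multiplier; have := wsum_ge; lia.
have [||h [ha hb ht]] := @Gs_hom s _ (tr 1) (tr (- multiplier%:R)%R) (sc m0).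
- by rewrite sc_conj mul1r.
- rewrite sc_conj !tr_W -trN -!trM; congr tr.
  have wE : wsum s = (multiplier + s.+2)%N by rewrite /multiplier; have := wsum_ge; lia.
  rewrite wE !mulrnDr !mulr_natr; ring.
exists h; split=> // g r gr; rewrite !gmulfM gmorphV ht gr.
exists (- (r / multiplier%:R))%R.
have {1}-> : r = (- (- (r / multiplier%:R) * multiplier%:R))%R by rewrite mulNr opprK mulfVK.
by rewrite -(sc_conj m0) !mulgA mulgV mul1g mulgK.
Qed.

Lemma ascending_not_free : ~ free_subgroup (ascending (s := s)).
Proof.
move=> [X [f [fI fK]]].
have inK n v : exists u, f u = Gt s ^+ n * fiber s v * Gt s ^- n.
  have : ascending (Gt s ^+ n * fiber s v * Gt s ^- n) by exists n, v.
  by rewrite -fK => -[u _ uE]; exists u.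
have [h [ha hb hconj]] := translation_hom.
have htr u : exists r, h (f u) = tr r.
  have : ascending (f u) by rewrite -fK; exists u.
  move=> [n [v ->]]; elim: n => [|n [r nr]].
    rewrite mul1g invg1 mulg1 -(fpi_repr v).
    elim: (repr v) => [|[x e] w [r wr]].
      by exists 0%R; rewrite fpi_nil !gmorph1 tr0.
    have [r' xr] : exists r', h (fiber s (free_gen x)) = tr r'.
      by case: x; rewrite ?fiber_a ?fiber_b ?ha ?hb; eexists.
    rewrite -cat1s fpi_cat !gmulfM wr fpi_letter; case: e; rewrite /letter_eval /=.
      by exists (- r' + r)%R; rewrite trM trN !gmorphV xr.
    by exists (r' + r)%R; rewrite trM xr.
  have [r' r'E] := hconj _ _ nr; exists r'; rewrite -r'E expgS invgM.
  by congr (h _); rewrite !mulgA.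
pose T u : rat := h (f u) 0%R.
have TM : {morph T : u v / u * v >-> (u + v)%R}.
  move=> u v; rewrite /T !gmulfM; have [r ->] := htr u; have [r' ->] := htr v.
  by rewrite -trM /= /tr_fun !add0r.
have [u0 u0E] := inK 0%N (ga / gb).
have ex0 x : exponent x u0 = 0%R.
  have m2 : (2 <= multiplier)%N by rewrite /multiplier; have := wsum_ge; lia.
  (* The induction conjugates the pair a, b by one more power of t: the old pair is the phi-image of
     the new one, and phi multiplies the difference of the two exponents by -m. *)
  have key n : exists al be, [/\ f al = Gt s ^+ n * Ga s * Gt s ^- n,
      f be = Gt s ^+ n * Gb s * Gt s ^- n &
      exponent x u0 = ((- Posz multiplier) ^+ n * (exponent x al - exponent x be))%R].
    elim: n => [|n [al [be [alE beE uE]]]].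
      have [al alE] := inK 0%N ga; have [be beE] := inK 0%N gb.
      exists al, be; split; rewrite ?alE ?beE ?fiber_a ?fiber_b //.
      have -> : u0 = al / be.
        apply: fI; rewrite u0E gmulfM gmorphV alE beE gmulfM gmorphV.
        by rewrite !mul1g !invg1 !mulg1.
      by rewrite expr0 mul1r exponentM exponentV.
    have [al' alE'] := inK n.+1 ga; have [be' beE'] := inK n.+1 gb.
    rewrite fiber_a in alE'; rewrite fiber_b in beE'; exists al', be'; split=> //.
    pose cj g := Gt s ^+ n.+1 * g * Gt s ^- n.+1.
    have cjM : {morph cj : u v / u * v}.
      by move=> u v; rewrite /cj; move: (Gt s ^+ _) => z; rewrite !mulgA mulgVK.
    pose cjj : {multiplicative G -> G} := HB.pack cj (isMultiplicative.Build _ _ cj cjM).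
    have cjt g : cj ((Gt s)^-1 * g * Gt s) = Gt s ^+ n * g * Gt s ^- n.
      rewrite /cj expgSr; move: (Gt s ^+ n) => z.
      by rewrite invgM !mulgA !mulgK.
    have eal : al = be'.
      by apply: fI; rewrite alE -cjt rel_b beE'.
    have ebe : be = W s be' al' * be' * (W s al' be')^-1.
      apply: fI; rewrite beE -cjt rel_c -[cj _]/(cjj _).
      have cW u v w : cjj (u * v * w^-1) = cjj u * cjj v * (cjj w)^-1.
        by rewrite gmulfM gmorphV gmulfM.
      have fW u v w : f (u * v * w^-1) = f u * f v * (f w)^-1.
        by rewrite gmulfM gmorphV gmulfM.
      by rewrite cW fW !gmorph_W alE' beE'.
    have exW u v w : exponent x (u * v * w^-1) = (exponent x u + exponent x v - exponent x w)%R.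
      by rewrite exponentM exponentV exponentM.
    rewrite uE eal ebe exW !(add_W _ _ _ (exponent1 x) (exponentM x)).
    have wE : wsum s = (multiplier + s.+2)%N by rewrite /multiplier; have := wsum_ge; lia.
    rewrite wE !mulrnDr exprSr; move: (exponent x al') (exponent x be') => e1 e2.
    rewrite -!(mulr_natr e1) -!(mulr_natr e2) !natz.
    move: (Posz multiplier) (Posz s.+2) => M N; ring.
  (* Taking n = |e| for a nonzero exponent e gives a contradiction, since m^n divides e and m^n > n
     for m >= 2. *)
  apply/eqP; apply: contraT => ne0; have [al [be [_ _ uE]]] := key `|exponent x u0|%N.
  have := congr1 absz uE; rewrite abszM abszX abszN absz_nat.
  move: (exponent x u0) (exponent x al - exponent x be)%R ne0 => e e' ne0 eE; exfalso.
  have e'0 : (0 < `|e'|)%N.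
    by rewrite lt0n; apply: contraNneq ne0 => e'0; rewrite -absz_eq0 eE e'0 muln0.
  have : (`|e| < multiplier ^ `|e|)%N.
    by apply: leq_trans (ltn_expl `|e| (isT : (1 < 2)%N)) _; rewrite leq_exp2r ?absz_gt0.
  by rewrite ltnNge => /negP; apply; rewrite {2}eE leq_pmulr.
have := exponent_eq0 TM ex0; rewrite /T u0E mul1g invg1 mulg1 gmulfM gmorphV fiber_a fiber_b.
rewrite gmulfM gmorphV ha hb -trN -trM /= /tr_fun.
by move/eqP; rewrite add0r opprK -[1%R]/(1%:R)%R -natrD pnatr_eq0.
Qed.

End NotFree.

(** * The free-by-cyclic structure *)

Section PathWord.
Variable G : groupType.
Implicit Types (u : nat -> G) (w : seq bool).

(* Read a positive word in a = false and b = true as a path whose height goes up by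
   one with each letter; b = t^-1 a t contributes u_h^-1 u_(h+1), where u_h = a^h t a^-h. *)
Fixpoint path_value u h w : G :=
  if w is x :: w' then
    (if x then (u h)^-1 * u h.+1 else 1) * path_value u h.+1 w'
  else 1.

Lemma path_value_cat u h w1 w2 :
  path_value u h (w1 ++ w2) = path_value u h w1 * path_value u (h + size w1) w2.
Proof.
elim: w1 h => [|x w1 IHw] h /=; first by rewrite mul1g addn0.
by rewrite IHw addSnnS mulgA.
Qed.

Lemma eq_PW u u' h w : (forall i, (h <= i <= h + size w)%N -> u i = u' i) ->
  path_value u h w = path_value u' h w.
Proof.
elim: w h => [//|x w IHw] h uu' /=; rewrite IHw; last first.
  by move=> i ih; apply: uu'; rewrite /=; lia.
by rewrite !uu' //=; lia.
Qed.

Lemma path_value_shift u h w : path_value u h.+1 w = path_value (fun i => u i.+1) h w.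
Proof. by elim: w h => [//|x w IHw] h /=; rewrite IHw. Qed.

Lemma path_value_in (K : set G) u h w : subgroup K ->
  (forall i, (h <= i <= h + size w)%N -> K (u i)) -> K (path_value u h w).
Proof.
move=> sK; elim: w h => [|x w IHw] h uK /=; first exact: subgroup1.
apply: (subgroupM sK); last by apply: IHw => i ih; apply: uK; rewrite /=; lia.
case: x uK => uK; last exact: subgroup1.
by apply: (subgroupM sK); [apply: (subgroupV sK)|]; apply: uK; rewrite /=; lia.
Qed.

Variables (a t : G).
Let b := t^-1 * a * t.
Let u i := a ^+ i * t * a ^- i.
Definition weval w : G := \prod_(x <- w) (if x then b else a).

Lemma path_valueE h w : a ^+ h * weval w = path_value u h w * a ^+ (h + size w).
Proof.
elim: w h => [|x w IHw] h; first by rewrite /weval big_nil mulg1 mul1g addn0.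
rewrite /weval big_cons -/(weval w) /= -addSnnS -mulgA -IHw.
case: x; last by rewrite mul1g mulgA expgSr.
rewrite /b /u expgSr; move: (a ^+ h) => z.
by rewrite !invgM !invgK !mulgA !mulgVK.
Qed.

End PathWord.

Lemma path_value_morph (G H : groupType) (f : {multiplicative G -> H}) u h w :
  f (path_value u h w) = path_value (f \o u) h w.
Proof.
elim: w h => [|x w IHw] h /=; first exact: gmorph1.
rewrite gmulfM IHw; congr (_ * _); case: x; last exact: gmorph1.
by rewrite gmulfM gmorphV.
Qed.

Section FreeByCyclic.
Variable s : nat.

Definition W_word (x y : bool) := flatten [seq x :: nseq i y | i <- index_iota 4 (4 + s).+1].
Definition W_rest := nseq 4 false ++
  flatten [seq true :: nseq i false | i <- index_iota 5 (4 + s).+1] ++ [:: true].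

(** The height at which the last letter of W(b,a) b starts. That letter is the only place where
    u_(L+1) enters, L being [top_index]; everything else in the relation stays at heights at most
    L. *)
Definition top_index := (size (W_word false true)).+1.

Lemma size_W_rest : size W_rest = size (W_word false true).
Proof.
have sf x y m : size (flatten [seq x :: nseq i y | i <- index_iota m (4 + s).+1]) =
    (\sum_(m <= i < (4 + s).+1) i.+1)%N.
  rewrite size_flatten /shape -map_comp sumnE big_map.
  by apply: eq_bigr => i _; rewrite /= size_nseq.
rewrite /W_rest 2!size_cat sf /W_word sf [RHS]big_ltn ?ltnS ?leq_addr //.
by rewrite size_nseq addnA addnC addnA.
Qed.

Section Relation.
Variables (G : groupType) (a t : G).
Let b := t^-1 * a * t.
Let u i := a ^+ i * t * a ^- i.

Lemma weval_WW0 x y : let v (z : bool) := if z then b else a in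
  weval a t (W_word x y) * v x = W s (v x) (v y).
Proof.
rewrite /= /W; congr (_ * _); rewrite /weval /W_word big_flatten big_map.
apply: eq_bigr => i _; rewrite big_cons; congr (_ * _).
by rewrite big_nseq iter_mulg_1.
Qed.

Lemma W_word_WWr : true :: W_rest = W_word true false ++ [:: true].
Proof.
have iotaE : index_iota 4 (4 + s).+1 = 4 :: index_iota 5 (4 + s).+1.
  rewrite /index_iota; have -> : ((4 + s).+1 - 4 = s.+1)%N by lia.
  by have -> : ((4 + s).+1 - 5 = s)%N by lia.
by rewrite /W_word /W_rest iotaE map_cons -catA.
Qed.

(** Moving all letters a to the right leaves the same power of a on both sides of the second
    relation. It cancels, and a relation among the u_i alone remains. *)
Lemma relation_left : t^-1 * b * t * W s a b =
  (u 0)^-1 * (u 0)^-1 * u 1 * u 1 * path_value u 1 (W_word false true) * a ^+ top_index.+1.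
Proof.
have -> : a ^+ top_index.+1 = a ^+ (1 + size (W_word false true)) * a by rewrite -expgSr.
transitivity ((u 0)^-1 * (u 0)^-1 * u 1 * u 1 *
    (a ^+ 1 * weval a t (W_word false true)) * a); last by rewrite path_valueE !mulgA.
have <- := weval_WW0 false true; move: (weval _ _ _) => z.
by rewrite /= /u expg1 expg0 invg1 mulg1 mul1g /b !mulgA !mulgVK.
Qed.

Lemma relation_right : W s b a * b =
  (u 0)^-1 * u 1 * path_value u 1 W_rest * (u top_index)^-1 * u top_index.+1 * a ^+ top_index.+1.
Proof.
have -> : W s b a * b = weval a t (true :: W_rest ++ [:: true]).
  rewrite -cat_cons W_word_WWr -catA /weval big_cat /= -/(weval a t _) !big_cons big_nil.
  by have <- := weval_WW0 true false; rewrite mulg1 !mulgA.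
rewrite -[LHS]mul1g -[1](expg0 a) path_valueE -/u add0n.
have -> : size (true :: W_rest ++ [:: true]) = top_index.+1.
  by rewrite -cat_cons size_cat -[size (true :: W_rest)]/(size W_rest).+1 size_W_rest addn1.
rewrite -[path_value u 0 _]/((u 0)^-1 * u 1 * path_value u 1 (W_rest ++ [:: true])) path_value_cat size_W_rest add1n.
by rewrite -[path_value _ top_index _]/((u top_index)^-1 * u top_index.+1 * 1) mulg1 !mulgA.
Qed.

End Relation.

Local Notation FX := (free_group 'I_top_index.+1).

Definition gen_u i : FX := free_gen (inord i).

(* The value of u_(L+1) forced by the second relation. *)
Definition next (G : groupType) (u : nat -> G) : G :=
  u top_index * (path_value u 1 W_rest)^-1 * (u 1%N)^-1 * (u 0%N)^-1 *
  u 1%N * u 1%N * path_value u 1 (W_word false true).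

Lemma next_rel (G : groupType) (u : nat -> G) (x : G) :
  (u 0%N)^-1 * (u 0%N)^-1 *
  u 1%N * u 1%N * path_value u 1 (W_word false true) * x =
  (u 0%N)^-1 * u 1%N * path_value u 1 W_rest * (u top_index)^-1 * u top_index.+1 * x <->
  u top_index.+1 = next u.
Proof.
rewrite /next; move: (path_value u 1 W_rest) (path_value u 1 (W_word false true)) => p q.
split=> [/mulIg|->].
  rewrite -!mulgA => /mulgI E.
  by rewrite E !mulKg mulVKg.
by rewrite !mulgA !mulgVK !mulgK.
Qed.

Lemma next_morph (G H : groupType) (f : {multiplicative G -> H}) u :
  f (next u) = next (f \o u).
Proof.
rewrite /next -!path_value_morph; move: (path_value u 1 W_rest) (path_value u 1 (W_word false true)) => p q.
by rewrite !gmulfM !gmorphV.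
Qed.

Lemma eq_next (G : groupType) (u v : nat -> G) :
  (forall i, (i <= top_index)%N -> u i = v i) -> next u = next v.
Proof.
move=> uv; rewrite /next (@eq_PW _ u v 1 W_rest) ?(@eq_PW _ u v 1 (W_word false true)) ?uv //.
  by move=> i /andP[_ iL]; apply: uv; move: iL; rewrite add1n -/top_index.
by move=> i /andP[_ iL]; apply: uv; move: iL; rewrite size_W_rest add1n.
Qed.

Definition alpha : {multiplicative FX -> FX} :=
  free_hom (fun i : 'I_top_index.+1 => if (i < top_index)%N then gen_u i.+1 else next gen_u).

Lemma alpha_gen_u i : (i <= top_index)%N ->
  alpha (gen_u i) = if (i < top_index)%N then gen_u i.+1 else next gen_u.
Proof. by move=> iL; rewrite /alpha /= free_hom_gen inordK. Qed.

(** The left inverse shifts indices down; its value on u_0 is u_(-1), obtained by solving the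
    relation, shifted down by one, for its lowest generator. *)
Lemma alpha_inj : injective alpha.
Proof.
pose z : FX := gen_u top_index.-1 * (path_value gen_u 0 W_rest)^-1 * (gen_u 0)^-1.
pose z' : FX := (gen_u 0) * (gen_u 0) * path_value gen_u 0 (W_word false true).
pose beta : {multiplicative FX -> FX} :=
  free_hom (fun i : 'I_top_index.+1 => if (i : nat) is i'.+1 then gen_u i' else z' * (gen_u top_index)^-1 * z).
have bt i : (i <= top_index)%N -> beta (gen_u i) =
    if i is i'.+1 then gen_u i' else z' * (gen_u top_index)^-1 * z.
  by move=> iL; rewrite /beta /= free_hom_gen inordK.
have bPW w : (size w < top_index)%N -> beta (path_value gen_u 1 w) = path_value gen_u 0 w.
  move=> wL; rewrite path_value_morph path_value_shift; apply: eq_PW => i /andP[_ iL] /=.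
  by rewrite bt //; apply: leq_ltn_trans wL.
suff ab v : beta (alpha v) = v by move=> v w vw; rewrite -(ab v) vw ab.
apply: (free_hom_ext (f := beta \o alpha) (g := idfun)) => i /=.
have -> : free_gen i = gen_u i by rewrite /gen_u inord_val.
have iL : (i <= top_index)%N by rewrite -ltnS ltn_ord.
rewrite alpha_gen_u //; case: ltnP => Li; first by rewrite bt.
have -> : i = top_index :> nat by apply/eqP; rewrite eqn_leq iL Li.
rewrite next_morph /next -!path_value_morph !bPW ?size_W_rest //.
have -> : (beta \o gen_u) 0%N = z' * (gen_u top_index)^-1 * z by exact: bt.
have -> : (beta \o gen_u) 1%N = gen_u 0 by exact: bt.
have -> : (beta \o gen_u) top_index = gen_u top_index.-1 by exact: bt.
rewrite /z /z'; move: (path_value gen_u 0 W_rest) (path_value gen_u 0 (W_word false true)).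
move: (gen_u top_index.-1) (gen_u 0) (gen_u top_index) => x y w p q.
by rewrite !invgM !invgK !mulgA !(mulgK, mulgVK, mulgV, mul1g).
Qed.

Local Notation G := (Gs s).
Definition ui i : G := Ga s ^+ i * Gt s * (Ga s) ^- i.

Lemma ui_next : ui top_index.+1 = next ui.
Proof.
pose b := (Gt s)^-1 * Ga s * Gt s.
have : (Gt s)^-1 * b * Gt s * W s (Ga s) b = W s b (Ga s) * b.
  by rewrite /b rel_b rel_c mulgVK.
rewrite relation_left relation_right; exact: (proj1 (next_rel ui _)).
Qed.

Definition ff : {multiplicative FX -> G} := free_hom (fun i : 'I_top_index.+1 => ui i).

Lemma ff_tn i : (i <= top_index)%N -> ff (gen_u i) = ui i.
Proof. by move=> iL; rewrite /ff /= free_hom_gen inordK. Qed.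

(** Let a act on germs as the inverse shift and t as multiplication by u_0. Then a^i t a^-i acts as
    multiplication by alpha^i(u_0), which is u_i up to the top index and the value forced by [next]
    after it, so the second relation holds. *)
Lemma ff_inj : injective ff.
Proof.
pose B : {multiplicative FX -> _} := torus_base alpha.
pose tau := torus_shift FX.
pose a := tau^-1; pose t := B (gen_u 0).
have conjE i : a ^+ i * t * a ^- i = B (iter i alpha (gen_u 0)).
  elim: i => [|i IHi]; first by rewrite mul1g invg1 mulg1.
  rewrite iterS; transitivity (tau^-1 * B (iter i alpha (gen_u 0)) * tau); last exact: torus_conj.
  by rewrite -IHi expgS invgM {1 3}/a invgK !mulgA.
have iterE i : (i <= top_index)%N -> iter i alpha (gen_u 0) = gen_u i.
  elim: i => [//|i IHi] iL; rewrite iterS IHi ?(ltnW iL) //.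
  by rewrite alpha_gen_u ?iL // ltnW.
have [||h [ha hb ht]] := @Gs_hom s _ a (t^-1 * a * t) t => //.
  rewrite -[LHS](mulgK (W s a (t^-1 * a * t))); congr (_ / _).
  rewrite relation_left relation_right; apply/next_rel.
  rewrite conjE iterS iterE // alpha_gen_u // ltnn next_morph.
  by apply: eq_next => i iL /=; rewrite conjE iterE.
have hf v : h (ff v) = B v.
  apply: (free_hom_ext (f := h \o ff) (g := B)) => i.
  have -> : free_gen i = gen_u i by rewrite /gen_u inord_val.
  have iL : (i <= top_index)%N by rewrite -ltnS ltn_ord.
  rewrite -(iterE i iL) -conjE /= iterE // ff_tn // /ui.
  by rewrite !gmulfM gmorphV !gmorphX ha ht.
move=> u v /(congr1 h); rewrite !hf; exact/torus_base_inj/alpha_inj.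
Qed.

Definition NN : set G := range ff.

Lemma NN_subgroup : subgroup NN.
Proof.
split=> [|_ _ [u _ <-] [v _ <-]]; first by exists 1; rewrite // (gmorph1 ff).
by exists (u / v); rewrite // -(gmorphV ff) -gmulfM.
Qed.

Lemma ui_NN i : (i <= top_index.+1)%N -> NN (ui i).
Proof.
move=> iL; have le i' : (i' <= top_index)%N -> NN (ui i').
  by move=> i'L; exists (gen_u i') => //; apply: ff_tn.
move: iL; rewrite leq_eqVlt => /predU1P[->|]; last exact: le.
have sN := NN_subgroup; have NV x : NN x -> NN x^-1 := subgroupV sN.
have NM x y : NN x -> NN y -> NN (x * y) := @subgroupM _ _ x y sN.
have Np : NN (path_value ui 1 W_rest).
  by apply: (path_value_in sN) => j /andP[_ jL]; apply: le; move: jL; rewrite size_W_rest add1n.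
have Nq : NN (path_value ui 1 (W_word false true)).
  by apply: (path_value_in sN) => j /andP[_ jL]; apply: le; move: jL; rewrite add1n -/top_index.
have [N0 N1 NL] : [/\ NN (ui 0), NN (ui 1) & NN (ui top_index)] by split; apply: le.
rewrite ui_next /next; have [N0V N1V NpV] := And3 (NV _ N0) (NV _ N1) (NV _ Np).
exact: (NM _ _ (NM _ _ (NM _ _ (NM _ _ (NM _ _ (NM _ _ NL NpV) N1V) N0V) N1) N1) Nq).
Qed.

Lemma NN_gen (P : set G) : subgroup P -> (forall i, (i <= top_index)%N -> P (ui i)) -> NN `<=` P.
Proof.
move=> sP Pu _ [v _ <-]; rewrite -(fpi_repr v); elim: (repr v) => [|[i e] w IHw].
  by rewrite fpi_nil gmorph1; apply: subgroup1.
rewrite -cat1s fpi_cat gmulfM fpi_letter; apply: (subgroupM sP) => //.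
have Pi : P (ff (free_gen i)) by rewrite /ff /= free_hom_gen; apply: Pu; rewrite -ltnS.
by case: e; rewrite /letter_eval //= (gmorphV ff); apply: subgroupV.
Qed.

Lemma conj_subgroup (K : set G) g : subgroup K -> subgroup [set x | K (x ^ g)].
Proof.
move=> [K1 KD]; split=> [|x y /= Kx Ky]; first by rewrite /= conj1g.
by rewrite conjMg conjVg; apply: KD.
Qed.

Lemma NN_conjA x : NN x -> NN (x ^ (Ga s)^-1).
Proof.
apply: (NN_gen (P := [set x | NN (x ^ (Ga s)^-1)])).
  exact: conj_subgroup NN_subgroup.
move=> i iL /=; have -> : ui i ^ (Ga s)^-1 = ui i.+1.
  by rewrite /ui /conjg invgK expgS invgM !mulgA.
exact: ui_NN.
Qed.

(** Conjugation by a lowers the index, so only u_0 needs care: the relation expresses it through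
    u_1, ..., u_(L+1), all of which can be lowered. *)
Lemma NN_conjAV x : NN x -> NN (x ^ Ga s).
Proof.
pose P := [set x | NN (x ^ Ga s)].
have sP : subgroup P by exact: conj_subgroup NN_subgroup.
have PV y : P y -> P y^-1 := subgroupV sP.
have PM y z : P y -> P z -> P (y * z) := @subgroupM _ _ y z sP.
have Pu i : (0 < i <= top_index.+1)%N -> P (ui i).
  case: i => [//|i] /= iL; rewrite /P /=; have -> : ui i.+1 ^ Ga s = ui i.
    by rewrite /ui /conjg expgS invgM !mulgA mulVg mul1g mulgVK.
  by apply: ui_NN; apply: leqW.
apply: (NN_gen (P := P)) => // -[|i] iL; last by apply: Pu; rewrite /= leqW.
have -> : ui 0 = ui 1 * ui 1 * path_value ui 1 (W_word false true) * (ui top_index.+1)^-1 * ui top_index *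
    (path_value ui 1 W_rest)^-1 * (ui 1)^-1.
  rewrite ui_next /next; move: (path_value ui 1 W_rest) (path_value ui 1 (W_word false true)).
  move: (ui 0) (ui 1) (ui top_index) => x0 x1 x2 p q.
  by rewrite !invgM !invgK !mulgA !(mulgK, mulgVK, mulgV, mul1g).
have [P1 PL PL1] : [/\ P (ui 1), P (ui top_index) & P (ui top_index.+1)] by split; apply: Pu; rewrite /=.
have Pp : P (path_value ui 1 W_rest).
  apply: (path_value_in sP) => j /andP[j1 jL]; apply: Pu; rewrite j1 leqW //.
  by move: jL; rewrite size_W_rest add1n.
have Pq : P (path_value ui 1 (W_word false true)).
  by apply: (path_value_in sP) => j /andP[j1 jL]; apply: Pu; rewrite j1 leqW.
have PpV := PV _ Pp; have P1V := PV _ P1; have PL1V := PV _ PL1.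
by apply: (PM _ _ (PM _ _ (PM _ _ (PM _ _ (PM _ _ (PM _ _ P1 P1) Pq) PL1V) PL) PpV) P1V).
Qed.

Lemma NN_t : NN (Gt s).
Proof. by have := @ui_NN 0 isT; rewrite /ui mul1g invg1 mulg1. Qed.

Lemma NN_normal : normal_subgroup NN.
Proof.
have sN := NN_subgroup; split=> // x g; elim/Gs_ind: g x => [x|g Pg]; first by rewrite conjg1.
have Nt x y : NN y -> NN x -> NN (x ^ y).
  by move=> Ny Nx; apply: (subgroupM sN (subgroupV sN Ny) (subgroupM sN Nx Ny)).
have bE : Gb s = (Gt s)^-1 * Ga s * Gt s by rewrite rel_b.
have NtV : NN (Gt s)^-1 by apply: (subgroupV sN NN_t).
have cb x : NN x -> NN (x ^ Gb s).
  by move=> Nx; rewrite bE !conjgM; apply: (Nt _ _ NN_t); apply: NN_conjAV; apply: Nt.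
have cbV x : NN x -> NN (x ^ (Gb s)^-1).
  move=> Nx; rewrite bE !invgM invgK mulgA !conjgM.
  by apply: (Nt _ _ NN_t); apply: NN_conjA; apply: Nt.
split; [| | |split]; move=> x /Pg Nx; rewrite conjgM.
- exact: NN_conjAV.
- exact: cb.
- exact: (Nt _ _ NN_t Nx).
- exact: NN_conjA.
- exact: cbV.
- exact: (Nt _ _ NtV Nx).
Qed.

Theorem Gs_free_by_cyclic : free_by_cyclic G.
Proof.
exists NN; split; first exact: NN_normal.
  by exists 'I_top_index.+1, ff; split=> //; apply: ff_inj.
exists (qpi NN (Ga s)); apply/seteqP; split=> // x _.
have sC := generated_subgroup [set qpi NN (Ga s)]; set C := generated _ in sC *.
have Ca : C (qpi NN (Ga s)) by apply: sub_generated.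
have CV y : C y -> C y^-1 := subgroupV sC.
have CM y z : C y -> C z -> C (y * z) := @subgroupM _ _ y z sC.
have Ct : C (qpi NN (Gt s)).
  have -> : qpi NN (Gt s) = 1 by apply/qpi_eq1; exact: (sub_normal_closure NN_t).
  exact: subgroup1.
have Cb : C (qpi NN (Gb s)).
  rewrite -rel_b 2!qpi_mul (gmorphV (qpi NN)).
  exact: (CM _ _ (CM _ _ (CV _ Ct) Ca) Ct).
rewrite -(qpi_repr x); elim/Gs_ind: (repr x) => [|g Cg].
  by rewrite (gmorph1 (qpi NN)); apply: subgroup1.
have [CaV CbV CtV] := And3 (CV _ Ca) (CV _ Cb) (CV _ Ct).
by do ![split]; rewrite qpi_mul ?(gmorphV (qpi NN)); apply: (CM _ _ Cg).
Qed.

End FreeByCyclic.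

(** * Hyperbolicity *)

Section WordLength.
Variables (G : groupType) (S : set G).
Hypothesis genS : generated S = setT.

Lemma is_word_cat g h u v : is_word_of S g u -> is_word_of S h v ->
  is_word_of S (g * h) (u ++ v).
Proof.
move=> [uS <-] [vS <-]; split; last by rewrite big_cat.
by move=> x; rewrite mem_cat => /orP[/uS|/vS].
Qed.

Lemma is_word_inv g u : is_word_of S g u -> is_word_of S g^-1 (rev [seq x^-1 | x <- u]).
Proof.
move=> [uS <-]; split=> [x|].
  by rewrite mem_rev => /mapP[y /uS + ->]; rewrite invgK => -[]; [right|left].
elim: u {uS} => [|x u IHu]; first by rewrite !big_nil invg1.
by rewrite map_cons rev_cons -cats1 big_cat IHu big_seq1 big_cons invgM.
Qed.

Lemma word_exists g : exists w, is_word_of S g w.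
Proof.
have sW : subgroup [set g | exists w, is_word_of S g w].
  split=> [|x y [u ux] [v vy]]; first by exists [::]; split; rewrite ?big_nil.
  by eexists; apply: is_word_cat ux (is_word_inv vy).
have : generated S g by rewrite genS.
apply: (generated_min sW) => x Sx; exists [:: x]; split; last by rewrite big_seq1.
by move=> y; rewrite inE => /eqP ->; left.
Qed.

Lemma word_lengthP g : (exists2 w, is_word_of S g w & size w = word_length S g) /\
  forall w, is_word_of S g w -> (word_length S g <= size w)%N.
Proof.
rewrite /word_length; set P := [set n | _]; suff : P (xget 0%N P) by [].
apply: xgetPex; have ex : exists n, `[< exists2 w, is_word_of S g w & size w = n >].
  by have [w wg] := word_exists g; exists (size w); apply/asboolP; exists w.
have [n /asboolP nP nmin] := ex_minnP ex; exists n; split=> // w wg.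
by apply: nmin; apply/asboolP; exists w.
Qed.

Lemma word_length_le g w : is_word_of S g w -> (word_length S g <= size w)%N.
Proof. by case: (word_lengthP g) => _; apply. Qed.

Lemma word_length_eq0 g : word_length S g = 0%N <-> g = 1.
Proof.
split=> [g0|->]; last first.
  by apply/eqP; rewrite -leqn0 (@word_length_le _ [::]) //; split; rewrite ?big_nil.
have [[w [_ wE] sw] _] := word_lengthP g.
by move: sw wE; rewrite g0 => /size0nil ->; rewrite big_nil.
Qed.

Local Notation d := (word_metric S).

Lemma wm0 x y : d x y = 0%N <-> x = y.
Proof.
rewrite /word_metric word_length_eq0; split=> [|->]; last exact: mulVg.
by move/mulg1_eq; rewrite invgK.
Qed.

Lemma wm_sym x y : d x y = d y x.
Proof.
have le g : (word_length S g^-1 <= word_length S g)%N.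
  have [[w wg <-] _] := word_lengthP g; apply: leq_trans (word_length_le (is_word_inv wg)) _.
  by rewrite size_rev size_map.
have -> : d x y = word_length S (y^-1 * x)^-1 by rewrite invgM invgK.
by apply/eqP; rewrite eqn_leq le /word_metric -[X in (word_length S X <= _)%N]invgK le.
Qed.

Lemma wm_tri x y z : (d x z <= d x y + d y z)%N.
Proof.
have [[u uw uE] _] := word_lengthP (x^-1 * y); have [[v vw vE] _] := word_lengthP (y^-1 * z).
rewrite /word_metric -uE -vE -size_cat; apply: word_length_le.
by have := is_word_cat uw vw; rewrite mulgA mulgK.
Qed.

Lemma wm_geodesic x y :
  exists p, [/\ path (adj d) x p, last x p = y & size p = d x y].
Proof.
have [n] := ubnP (d x y); elim: n x => // n IHn x xn.
have [[[|g w] ww ws] _] := word_lengthP (x^-1 * y).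
  by exists [::]; split=> //; apply/wm0/esym.
have [wS wE] := ww; rewrite big_cons in wE.
have d1 : (d x (x * g) <= 1)%N.
  rewrite /word_metric mulKg; apply: (@word_length_le _ [:: g]); split; last by rewrite big_seq1.
  by move=> z; rewrite inE => /eqP ->; apply: wS; apply: mem_head.
have dn : (d (x * g) y <= size w)%N.
  apply: word_length_le; split; first by move=> z zw; apply: wS; rewrite in_cons zw orbT.
  by rewrite invgM -mulgA -wE mulKg.
have dt := wm_tri x (x * g) y; move: ws; rewrite -/(d x y) /= => ws.
have [|p [pp py ps]] := IHn (x * g).
  by apply: leq_ltn_trans dn _; rewrite -ltnS ws.
have dnE : d (x * g) y = size w.
  apply/eqP; rewrite eqn_leq dn -ltnS ws; apply: leq_trans dt _.
  by rewrite -add1n leq_add2r.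
exists (x * g :: p); split=> //=; last by rewrite ps dnE ws.
rewrite pp andbT /adj eqn_leq d1 /= -(leq_add2r (d (x * g) y)).
by apply: leq_trans dt; rewrite dnE add1n ws.
Qed.

Lemma wm_adj x y : d x y = 1%N -> exists g, (S g \/ S g^-1) /\ y = x * g.
Proof.
rewrite /word_metric => xy; have [[w [wS wE] ws] _] := word_lengthP (x^-1 * y).
move: ws wS wE; rewrite xy; case: w => [//|g [|//]] _ wS; rewrite big_seq1 => gE.
by exists g; split; [apply: wS; apply: mem_head | rewrite gE mulVKg].
Qed.

End WordLength.

(** * Edge paths in the Cayley graph and their chains *)

Section Paths.
Variables (X : choiceType) (G : groupType) (gen : X -> G).
Implicit Types (w : word X) (g : G).

Fixpoint word_path g w : seq (int * (G * X)) :=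
  if w is p :: w' then
    (if p.2 then ((-1)%R, (g * (gen p.1)^-1, p.1)) else (1%R, (g, p.1)))
    :: word_path (g * letter_eval gen p) w'
  else [::].

Lemma size_word_path g w : size (word_path g w) = size w.
Proof. by elim: w g => //= p w IHw g; rewrite IHw. Qed.

Lemma word_path_cat g w1 w2 :
  word_path g (w1 ++ w2) = word_path g w1 ++ word_path (g * word_eval gen w1) w2.
Proof.
elim: w1 g => [|p w1 IHw] g; first by rewrite word_eval_nil mulg1.
by rewrite cat_cons /= IHw word_eval_cons mulgA.
Qed.

Lemma pair_word_path_free_eq f g w1 w2 : free_eq w1 w2 ->
  pair f (word_path g w1) = pair f (word_path g w2).
Proof.
move=> e; elim: e g => [//|u v _ IH|u v w _ IH1 _ IH2|u x e v] g.
- by rewrite IH.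
- by rewrite IH1 IH2.
- rewrite !word_path_cat !pair_cat; congr (_ + _)%R.
  rewrite /= !pair_cons /letter_eval; case: e => /=; rewrite ?mulgVK ?mulgK; lia.
Qed.

Lemma pair_word_path_fpi f g w :
  pair f (word_path g (repr (fpi w))) = pair f (word_path g w).
Proof. exact/pair_word_path_free_eq/free_eq_repr. Qed.

Lemma pair_word_path_mul f g (u v : free_group X) :
  (pair f (word_path g (repr (u * v)%g)) =
   pair f (word_path g (repr u)) + pair f (word_path (g * free_hom gen u)%g (repr v)))%R.
Proof.
rewrite -{1}(fpi_repr u) -{1}(fpi_repr v) -fpi_cat pair_word_path_fpi.
by rewrite word_path_cat pair_cat.
Qed.

Lemma pair_word_path_inv f g (u : free_group X) :
  (pair f (word_path g (repr u^-1%g)) =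
   - pair f (word_path (g * (free_hom gen u)^-1)%g (repr u)))%R.
Proof.
have := pair_word_path_mul f (g * (free_hom gen u)^-1) u u^-1.
by rewrite mulgV mulgVK -{1}fpi_nil pair_word_path_fpi /= pair_nil; lia.
Qed.

Lemma pair_word_path_gen f g x :
  pair f (word_path g (repr (free_gen x))) = f (g, x).
Proof. by rewrite pair_word_path_fpi /= pair_cons pair_nil mul1r addr0. Qed.

Lemma word_path_telescope (u : G -> int) g w :
  pair (fun e => u (e.1 * gen e.2)%g - u e.1)%R (word_path g w) =
  (u (g * word_eval gen w)%g - u g)%R.
Proof.
elim: w g => [|p w IHw] g; first by rewrite word_eval_nil mulg1 pair_nil subrr.
rewrite /= pair_cons IHw word_eval_cons mulgA /letter_eval.
by case: p => x [] /=; rewrite ?mulgVK; move: (u _) (u _) (u _) => ???; lia.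
Qed.

End Paths.

(** Each coset of the image of F receives a base point [rho], relative to which [co] is a coordinate
    in F; injectivity makes the coordinate unique, hence equivariant. *)
Lemma free_cosets (F G : groupType) (j : {multiplicative F -> G}) : injective j ->
  exists rho co, (forall g, g = rho g * j (co g)) /\
    forall g v, rho (g * j v) = rho g /\ co (g * j v) = co g * v.
Proof.
move=> jI; pose rho g := xget 1 [set h : G | exists v, g = h * j v].
have rhoE g : exists v, g = rho g * j v.
  by apply: (@xgetPex _ 1 [set h : G | exists v, g = h * j v]); exists g, 1; rewrite gmorph1 mulg1.
have [co coE] := choice rhoE; exists rho, co; split=> // g v.
have rhov : rho (g * j v) = rho g.
  congr xget; apply/seteqP; split=> h /= [u uE]; [exists (u * v^-1)|exists (u * v)].
    by rewrite gmulfM gmorphV mulgA -uE mulgK.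
  by rewrite gmulfM mulgA -uE.
split=> //; apply/jI/(@mulgI _ (rho g)); rewrite -{1}rhov -coE gmulfM mulgA.
by rewrite -coE.
Qed.

(* A free action has no first cohomology. *)
Lemma free_potential (X : choiceType) (G : groupType) (gen : X -> G) (f : G * X -> int) :
  injective (free_hom gen) -> exists H : G -> int,
    forall g x, H (g * gen x) = (H g + f (g, x))%R.
Proof.
move=> jI; have [rho [co [coE coM]]] := free_cosets jI.
exists (fun g => pair f (word_path gen (rho g) (repr (co g)))) => g x.
rewrite -(free_hom_gen gen x) !(coM _ _).1 (coM _ _).2 pair_word_path_mul.
by rewrite -[X in word_path _ X (repr (free_gen x))]coE pair_word_path_gen.
Qed.

Section Cells.
Variable s : nat.
Local Notation G := (Gs s).
Local Notation o0 := (@Ordinal 3 0 isT).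
Local Notation o1 := (@Ordinal 3 1 isT).
Local Notation o2 := (@Ordinal 3 2 isT).

Definition gen2 (x : bool) : G := if x then Gb s else Ga s.
Definition gen3 (i : 'I_3) : G := pgen (Gs_relations s) (free_gen i).
Definition idx (x : bool) : 'I_3 := if x then o1 else o0.
Definition lift_word (w : word bool) : word 'I_3 := [seq (idx p.1, p.2) | p <- w].

Lemma gen3_idx x : gen3 (idx x) = gen2 x. Proof. by case: x. Qed.

Lemma letter_eval_idx p : letter_eval gen3 (idx p.1, p.2) = letter_eval gen2 p.
Proof. by rewrite /letter_eval gen3_idx. Qed.

Lemma free_hom_gen3 u : free_hom gen3 u = pgen (Gs_relations s) u.
Proof.
apply: (free_hom_ext (f := free_hom gen3) (g := pgen (Gs_relations s))) => x.
by rewrite /= free_hom_gen.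
Qed.

Lemma word_eval_lift w : word_eval gen3 (lift_word w) = fiber s (fpi w).
Proof.
rewrite /= free_hom_fpi; elim: w => [|p w IHw]; first by rewrite !word_eval_nil.
by rewrite /= !word_eval_cons letter_eval_idx -/(lift_word w) IHw.
Qed.

Lemma pair_lift f g w : pair f (word_path gen3 g (lift_word w)) =
  pair (fun e => f (e.1, idx e.2)) (word_path gen2 g w).
Proof.
elim: w g => [|p w IHw] g; first by rewrite !pair_nil.
rewrite /= !pair_cons letter_eval_idx IHw gen3_idx.
by case: p => x [].
Qed.

Definition kap : {multiplicative F2 -> free_group 'I_3} :=
  free_hom (fun x => free_gen (idx x)).

Lemma fpi_lift w : fpi (lift_word w) = kap (fpi w).
Proof.
rewrite /= free_hom_fpi; elim: w => [|[x e] w IHw]; first by rewrite word_eval_nil.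
by rewrite /= word_eval_cons -cat1s fpi_cat fpi_letter -/(lift_word w) IHw.
Qed.

(* The boundary word of the 2-cell of the relation [x t = t phi(x)]. *)
Definition cell_word (x : bool) : word 'I_3 :=
  (o2, false) :: lift_word (repr (phi s (free_gen x))) ++ [:: (o2, true); (idx x, true)].

Lemma fpi_cell_word x : fpi (cell_word x) =
  free_gen o2 * kap (phi s (free_gen x)) * (free_gen o2)^-1 * (free_gen (idx x))^-1.
Proof.
have -> : cell_word x = [:: (o2, false)] ++ (lift_word (repr (phi s (free_gen x))) ++
  ([:: (o2, true)] ++ [:: (idx x, true)])) by [].
by rewrite !fpi_cat !fpi_letter fpi_lift fpi_repr !mulgA.
Qed.

Definition cell (q : G * bool) := word_path gen3 q.1 (cell_word q.2).

Lemma fiber_gen x : fiber s (free_gen x) = gen2 x. Proof. exact: free_hom_gen. Qed.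

Lemma pgen_kap v : pgen (Gs_relations s) (kap v) = fiber s v.
Proof.
by rewrite -free_hom_gen3 -(fpi_repr v) -fpi_lift free_hom_fpi word_eval_lift fpi_repr.
Qed.

Lemma cell_word_eval x : word_eval gen3 (cell_word x) = 1.
Proof.
rewrite -free_hom_fpi free_hom_gen3 fpi_cell_word 3!pgen_mul 2!gmorphV.
rewrite pgen_kap -fiber_phi fiber_gen.
rewrite /= -[pgen _ (free_gen o2)]/(Gt s) -[pgen _ _]/(gen3 (idx x)) gen3_idx.
by rewrite !mulgA mulgV mul1g mulgK mulgV.
Qed.

Definition cell_size := (\max_(x : bool) size (cell_word x))%N.

Lemma cell_size_le x : (size (cell_word x) <= cell_size)%N.
Proof. exact: (leq_bigmax x). Qed.

Lemma cell_norm q : (norm (cell q) <= cell_size%:Z)%R.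
Proof.
apply: le_trans (norm_size _) _; last by rewrite size_word_path lez_nat cell_size_le.
rewrite /cell; move: (cell_word _) (q.1) => w; elim: w => //= p w IHw g.
by rewrite IHw; case: p.2.
Qed.

Lemma cell_cycle q (u : G -> int) :
  pair (fun e => u (e.1 * gen3 e.2)%g - u e.1)%R (cell q) = 0%R.
Proof. by rewrite word_path_telescope cell_word_eval mulg1 subrr. Qed.

(** The elements whose loops bound from every base point form a normal subgroup: conjugation just
    moves the base point, the two tails cancelling. It contains the relators, being conjugates of
    inverted cell words. *)
Lemma path_filling x w1 w2 : word_eval gen3 w1 = word_eval gen3 w2 ->
  exists c, forall f,
    (pair f (word_path gen3 x w1) - pair f (word_path gen3 x w2) = pair f (bind cell c))%R.
Proof.
pose N := [set u : free_group 'I_3 | free_hom gen3 u = 1 /\ forall x, exists c, forall f,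
  pair f (word_path gen3 x (repr u)) = pair f (bind cell c)].
have hV u : free_hom gen3 u^-1 = (free_hom gen3 u)^-1 by exact: (gmorphV (free_hom gen3)).
have nN : normal_subgroup N.
  split; first split.
  - split=> [|y]; first by rewrite free_hom1.
    by exists [::] => f; rewrite -fpi_nil pair_word_path_fpi.
  - move=> u v [u1 uc] [v1 vc]; split.
      by rewrite free_hom_mul hV u1 v1 invg1 mulg1.
    move=> y; have [c cE] := uc y; have [c' cE'] := vc y.
    exists (c ++ cscale (-1)%R c') => f.
    rewrite pair_word_path_mul pair_word_path_inv u1 v1 invg1 !mulg1 cE cE'.
    by rewrite !pair_bind pair_cat pair_scale mulN1r.
  - move=> u g [u1 uc]; split.
      by rewrite /conjg !free_hom_mul hV u1 mul1g mulVg.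
    move=> y; have [c cE] := uc (y * (free_hom gen3 g)^-1); exists c => f.
    rewrite /conjg !pair_word_path_mul pair_word_path_inv.
    rewrite hV -cE u1 mulg1; move: (pair _ _) (pair _ _) => a b; lia.
have Ncell x' : N (fpi (cell_word x')).
  split=> [|y]; first by rewrite free_hom_fpi cell_word_eval.
  exists [:: (1%R, (y, x'))] => f.
  by rewrite pair_word_path_fpi pair_bind [RHS]big_seq1 mul1r.
have Nrel x' : N ((free_gen o2)^-1 * free_gen (idx x') * free_gen o2 / kap (phi s (free_gen x'))).
  have [sN cN] := nN.
  have -> : (free_gen o2)^-1 * free_gen (idx x') * free_gen o2 / kap (phi s (free_gen x')) =
      (fpi (cell_word x'))^-1 ^ free_gen o2.
    rewrite fpi_cell_word; move: (free_gen o2) (free_gen (idx x')) (kap _) => t y k.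
    by rewrite /conjg !invgM !invgK !mulgA mulgVK.
  exact: (cN _ _ (subgroupV sN (Ncell x'))).
move=> w12; have /(normal_closure_min nN) : [set p.1 / p.2 | p in Gs_relations s] `<=` N.
  move=> _ [p [|] -> /= <-]; first by have := Nrel false; rewrite phi_ga /= !free_hom_gen.
  have := Nrel true; rewrite phi_gbW gmulfM gmorphV gmulfM !gmorph_W /=.
  by rewrite !free_hom_gen.
move=> /(_ (fpi w1 / fpi w2)) [].
  apply/qpi_eq1; rewrite -[qpi _ _]/(pgen (Gs_relations s) _) pgen_mul gmorphV.
  by rewrite /= -!free_hom_gen3 !free_hom_fpi w12 mulgV.
move=> _ /(_ x)[c cE]; exists c => f; rewrite -cE pair_word_path_mul pair_word_path_inv.
by rewrite !pair_word_path_fpi !free_hom_fpi w12 mulgK.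
Qed.

End Cells.

Section Isoperimetry.
Variable s : nat.
Hypothesis s2 : (2 <= s)%N.
Local Notation G := (Gs s).
Local Notation o0 := (@Ordinal 3 0 isT).
Local Notation o1 := (@Ordinal 3 1 isT).
Local Notation o2 := (@Ordinal 3 2 isT).

(* The potential prescribed on the cells by SA and SE is integrated along the cosets of
   the base group; its failure to match the potential of the next coset oscillates
   boundedly by [oscillation] and becomes the value of the cochain on the t-edges. *)
Lemma dual_cochain : exists B : nat, forall SA SE : G -> int,
  (forall g, `|SA g| <= 1)%R -> (forall g, `|SE g| <= 1)%R ->
  exists zeta : G * 'I_3 -> int, (forall e, `|zeta e| <= B%:Z)%R /\
    forall g, pair zeta (cell (g, false)) = SA g /\
      (`|pair zeta (cell (g, true)) - (SA g + 3 * SE g)| <= 1)%R.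
Proof.
have [rho [co [coE coM]]] := free_cosets (fiber_inj s2).
pose osc := (2 * (stepM s * oscN s))%N; exists osc.+1 => SA SE SA1 SE1.
have [H HE] := @free_potential bool G (@gen2 s)
  (fun e => if e.2 then SA e.1 + 3 * SE e.1 else SA e.1)%R (fiber_inj s2).
pose t := Gt s; pose a := Ga s.
pose A r q := SA (r * fiber s q * t^-1); pose E r q := SE (r * fiber s q * t^-1 * a^-1).
pose hh g := potential s (A (rho g)) (E (rho g)) (nf (co g)).
pose er g := (hh (g * t)%g - H g)%R.
have hhM g x : hh (g * gen2 s x) =
    potential s (A (rho g)) (E (rho g)) (push (x, false) (nf (co g))).
  rewrite -fiber_gen /hh (coM _ _).1 (coM _ _).2; congr (potential _ _ _ _).
  by rewrite nf_mul_fpi.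
have hha g : hh (g * gen2 s false) = hh g.
  rewrite hhM /hh; case: (nf _) => [|[[] []] l].
  1-3,5: exact: (potential_a _ _ _ 1%N false).
  exact/esym/(potential_a _ _ _ 1%N true).
have hhb g x : (`|hh (g * gen2 s x)%g - hh g| <= 1)%R.
  by rewrite hhM; apply: potential_push => // q; [apply: SA1|apply: SE1].
(* Carry H through the t-edges to the coset of [g * t]. Moving by fiber v before t is moving by
   phi(v) after it, so the claim becomes [oscillation] for the pulled-back function H'. *)
have erB g v : (`|er (g * fiber s v)%g - er g| <= osc%:Z)%R.
  pose r := rho (g * t); pose q := co (g * t).
  pose H' q := H (r * fiber s q * t^-1).
  have Ha q' : H' (q' * gb) = (H' q' + A r q')%R.
    rewrite /H' /A -(phi_ga s) gmulfM -fiber_phi fiber_a -/t -/a.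
    rewrite -(HE _ false); congr H.
    by rewrite /gen2 -/a !mulgA mulgK.
  (* Going backwards along a and then along b, the two terms SA are taken at the same vertex and
     cancel; this is why a^-1 b, with image c', is used in place of b. *)
  have He q' : H' (q' * c' s) = (H' q' + 3 * E r q')%R.
    have -> : c' s = phi s (ga^-1 * gb).
      by rewrite gmulfM gmorphV phi_ga phi_gb /= mulKg.
    set x := r * fiber s q' * t^-1.
    have -> : H' (q' * phi s (ga^-1 * gb)) = H (x * a^-1 * gen2 s true).
      rewrite /H' gmulfM -fiber_phi gmulfM gmorphV fiber_a fiber_b -/t -/a /x /gen2.
      by congr H; move: (fiber s q') => y; rewrite !mulgA mulgK.
    have HxE : H x = (H (x * a^-1)%g + SA (x * a^-1)%g)%R.
      by rewrite -(HE _ false) /gen2 -/a mulgVK.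
    by rewrite HE /= /H' -/x HxE /E -/x; move: (H _) (SA _) (SE _) => ???; lia.
  have HA q' : (`|A r q'| <= 1)%R by exact: SA1.
  have HE' q' : (`|E r q'| <= 1)%R by exact: SE1.
  have := oscillation s2 HA HE' Ha He q (eta v); rewrite Psi_eta.
  have tE : g * fiber s v * t = g * t * fiber s (phi s v).
    by rewrite -fiber_phi -/t !mulgA mulgK.
  have erE : er (g * fiber s v) = err s (A r) (E r) H' (q * phi s v).
    rewrite /er /err; have -> : H' (q * phi s v) = H (g * fiber s v).
      by rewrite /H' gmulfM mulgA -coE -tE mulgK.
    by rewrite /hh tE (coM _ _).1 (coM _ _).2.
  have erE1 : er g = err s (A r) (E r) H' q.
    by rewrite /er /err /hh -/r -/q /H' -coE mulgK.
  by rewrite erE // erE1.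
(* Along the phi(x) part of a cell boundary the values telescope to a difference of [hh], and the
   two t-edges replace it by a difference of H. Subtracting [er] at the base point of the coset
   makes the values bounded by [erB] and does not affect cells, whose t-edges start in one coset. *)
pose zeta (e : G * 'I_3) : int :=
  (if e.2 == o0 then 0 else if e.2 == o1 then hh (e.1 * gen2 s true)%g - hh e.1
   else er e.1 - er (rho e.1))%R.
exists zeta; split=> [[g i]|].
  have hb := hhb g true; have eb := erB (rho g) (co g); rewrite -coE in eb.
  rewrite /zeta /= in hb *; case: ifP => // _; case: ifP => _; last first.
    by apply: le_trans eb _; rewrite lez_nat.
  by apply: le_trans hb _; rewrite lez_nat.
have lift g v : pair zeta (word_path (@gen3 s) g (lift_word (repr v))) =
    (hh (g * fiber s v)%g - hh g)%R.
  rewrite pair_lift -{2}(fpi_repr v) /= free_hom_fpi -word_path_telescope.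
  apply: eq_pair => -[h []] //=; rewrite /zeta /=.
  by rewrite -[Ga s]/(gen2 s false) hha subrr.
have cellE g x : pair zeta (cell (g, x)) =
    (H (g * gen2 s x)%g - H g - zeta (g, idx x))%R.
  have gx : g * t * fiber s (phi s (free_gen x)) * t^-1 = g * gen2 s x.
    by rewrite -fiber_phi fiber_gen -/t !mulgA !mulgK.
  rewrite /cell /= pair_cons word_path_cat pair_cat lift word_eval_lift fpi_repr.
  rewrite /= !pair_cons pair_nil /letter_eval /= -[gen3 s o2]/t gx gen3_idx mulgK.
  have -> : zeta (g, o2) = (er g - er (rho g))%R by [].
  have -> : zeta (g * gen2 s x, o2) = (er (g * gen2 s x)%g - er (rho g))%R.
    by rewrite /zeta /= -fiber_gen (coM _ _).1.
  have -> : g * t * fiber s (phi s (free_gen x)) = g * gen2 s x * t by rewrite -gx mulgVK.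
  by rewrite /er; ring.
move=> g; rewrite !cellE !HE /=; split.
  by rewrite /zeta /=; move: (H g) (SA g) => *; lia.
have := hhb g true; rewrite {1}/zeta /=; move: (_ - _)%R (H g) (SA g) (SE g) => *; lia.
Qed.

Theorem linear_isoperimetry : exists K : nat, forall c : seq (int * (G * bool)),
  (norm c <= K%:Z * norm (bind (@cell s) c))%R.
Proof.
have [B dual] := dual_cochain; exists B => c.
pose L := undup [seq p.2.1 | p <- c].
(* Both cells at every vertex met by the chain are listed, including those of coefficient 0, so that
   the sum can be estimated vertex by vertex. *)
pose U := [seq (g, x) | g <- L, x <- [:: false; true]].
have Uu : uniq U.
  by apply: allpairs_uniq; rewrite ?undup_uniq // => -[? ?] [? ?] _ _ [-> ->].
have cU : {subset [seq p.2 | p <- c] <= U}.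
  move=> q /mapP[p pc ->]; apply/allpairsP; exists p.2; split.
  - by rewrite mem_undup; apply: (map_f (fun p => p.2.1)).
  - by case: p.2.2.
  - by case: p.2.
have sum2 (F : bool -> int) : (\sum_(x <- [:: false; true]) F x = F false + F true)%R.
  by rewrite big_cons big_seq1.
have sgz1 (x : int) : (`|sgz x| <= 1)%R by case: sgzP.
have [zeta [zB zE]] := dual (fun g => sgz (coef c (g, false) + coef c (g, true))%R)
  (fun g => sgz (coef c (g, true))) (fun g => sgz1 _) (fun g => sgz1 _).
apply: le_trans (pair_le_scaled _ zB); apply: le_trans (ler_norm _).
rewrite pair_bind -norm_sgz !(pair_coef_on _ Uu cU) !big_allpairs_dep /=.
apply: ler_sum => g _; rewrite !sum2.
have [-> +] := zE g; move: (coef c (g, false)) (coef c (g, true)) => u v.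
set S := (sgz (u + v) + _)%R; set z := pair _ _ => zS.
have vz : (v * z = v * S + v * (z - S))%R by ring.
have : (`|v * (z - S)| <= `|v|)%R by rewrite normrM ler_piMr.
rewrite {}vz {zS}; move: (v * (z - S))%R => e; rewrite /S.
by case: (sgzP u); case: (sgzP v); case: (sgzP (u + v)%R); lia.
Qed.

End Isoperimetry.

Lemma word_path_step (X : choiceType) (G : groupType) (gen : X -> G) g w e0 i :
  (i < size w)%N ->
  step (fun e : G * X => e.1) (fun e => e.1 * gen e.2)
    (g * word_eval gen (take i w)) (g * word_eval gen (take i.+1 w))
    (nth e0 (word_path gen g w) i).
Proof.
elim: w g i => [//|[x e] w IHw] g [_|i iw].
  rewrite /= take0 word_eval_nil word_eval_seq1 mulg1 /step /letter_eval.
  by case: e => /=; [right; rewrite mulgVK|left].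
by rewrite !take_cons !word_eval_cons !mulgA; apply: IHw.
Qed.

Section Hyperbolic.
Variable s : nat.
Hypothesis s2 : (2 <= s)%N.
Local Notation G := (Gs s).

Definition gens : set G := range (@gen3 s).
Local Notation d := (word_metric gens).

Lemma gens_finite : finite_set gens.
Proof. exact/finite_image/finite_finset. Qed.

Lemma gens_generate : generated gens = setT.
Proof.
have sG := generated_subgroup gens; apply/seteqP; split=> // g _.
have gen i : generated gens (gen3 s i) by apply: sub_generated; exists i.
have [ga gb gt] : [/\ generated gens (Ga s), generated gens (Gb s) & generated gens (Gt s)].
  by split; apply: gen.
apply: (@Gs_ind s (fun h => generated gens h)) => [|h hh]; first exact: subgroup1.
by do 2?split; apply: (subgroupM sG) => //; apply: (subgroupV sG).
Qed.

Let d_word g w : (d g (g * word_eval (@gen3 s) w) <= size w)%N.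
Proof.
rewrite /word_metric mulKg -(size_map (letter_eval (@gen3 s))).
apply: (word_length_le gens_generate); split; last by rewrite big_map.
by move=> _ /mapP[[i []] _ ->]; [right|left]; exists i => //=; rewrite invgK.
Qed.

Let path_word x p : path (adj d) x p -> exists w : word 'I_3, size w = size p /\
  forall i, (i <= size p)%N -> nth x (x :: p) i = x * word_eval (@gen3 s) (take i w).
Proof.
elim: p x => [|y p IHp] x /=.
  by move=> _; exists [::]; split=> // -[|//] _; rewrite word_eval_nil mulg1.
move=> /andP[/eqP xy /IHp[w [ws wE]]].
have [g [gS yE]] := wm_adj gens_generate xy.
have [l lE] : exists l, g = letter_eval (@gen3 s) l.
  by case: gS => -[i _ iE]; [exists (i, false)|exists (i, true); rewrite /letter_eval iE invgK].
exists (l :: w); split=> [|[|i] ip] /=; first by rewrite ws.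
  by rewrite word_eval_nil mulg1.
by rewrite word_eval_cons mulgA -lE -yE -wE //; apply: set_nth_default.
Qed.

Let path_chain_word x w e0 :
  path_chain (nth e0 (word_path (@gen3 s) x w)) (size w) = word_path (@gen3 s) x w.
Proof. by rewrite -(size_word_path (@gen3 s) x); apply: mkseq_nth. Qed.

Lemma exponential_divergence : exists K P, (0 < P)%N /\ forall (x : G) p q w R,
  path (adj d) x p -> path (adj d) x q -> last x p = last x q ->
  size p = d x (last x p) -> w \in x :: p ->
  (forall w', w' \in x :: q -> (R < d w w')%N) ->
  (2 ^ (R %/ P) <= K * (size p + size q))%N.
Proof.
have [K0 isop] := linear_isoperimetry s2; pose K := K0.+1.
pose M := (cell_size s).+1.
(* The denominator T Q + D + 1 of [log_property], with D = M: a boundary word of at most M letters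
   also bounds how far a cell reaches from its base. The successors keep the constants positive. *)
exists K, (2 * M * (2 * K * M) + M.+1)%N; split; first by rewrite addnS.
move=> x p q w R xp xq lpq sp wp far.
have [u [us uE]] := path_word xp; have [v [vs vE]] := path_word xq.
pose e0 : int * (G * 'I_3) := (0%R, (1, @Ordinal 3 0 isT)).
have uv : word_eval (@gen3 s) u = word_eval (@gen3 s) v.
  apply: (@mulgI _ x); rewrite -(take_size u) -(take_size v) us vs -uE // -vE //.
  by rewrite -!last_nth.
have [c cE] := path_filling x uv.
have edge (e : G * 'I_3) : (d e.1 (e.1 * gen3 s e.2) <= 1)%N.
  by have := d_word e.1 [:: (e.2, false)]; rewrite word_eval_seq1.
have cell_norm' (y : G * bool) : (norm (cell y) <= M%:Z)%R.
  by apply: le_trans (cell_norm y) _; rewrite lez_nat /M leqnSn.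
have isop' c0 : (norm c0 <= K%:Z * norm (bind (@cell s) c0))%R.
  by apply: le_trans (isop c0) _; apply: ler_wpM2r; rewrite ?norm_ge0 // lez_nat /K leqnSn.
have near (y : G * bool) e : e \in cell y -> (d y.1 e.2.1 <= M)%N.
  suff near' w0 g : e \in word_path (@gen3 s) g w0 -> (d g e.2.1 <= size w0)%N.
    by move=> /near' /leq_trans; apply; apply: leqW; apply: cell_size_le.
  elim: w0 g => //= l w0 IH g; rewrite in_cons => /predU1P[->|/IH le].
    case: l => i [] /=; last by rewrite (wm0 gens_generate g g).2.
    apply: leq_trans (_ : 1 <= _)%N => //.
    by have := d_word g [:: (i, true)]; rewrite word_eval_seq1.
  apply: leq_trans (wm_tri gens_generate _ (g * letter_eval (@gen3 s) l) _) _.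
  rewrite -[(size w0).+1]add1n; apply: leq_add le.
  by have := d_word g [:: l]; rewrite word_eval_seq1.
have step_word y r w0 : size w0 = size r ->
    (forall i, (i <= size r)%N -> nth y (y :: r) i = y * word_eval (@gen3 s) (take i w0)) ->
    forall i, (i < size r)%N -> step (fun e : G * 'I_3 => e.1) (fun e => e.1 * gen3 s e.2)
      (nth y (y :: r) i) (nth y (y :: r) i.+1) (nth e0 (word_path (@gen3 s) y w0) i).
  move=> wr nE i ir; rewrite !nE // ?(ltnW ir) //.
  by apply: word_path_step; rewrite wr.
have geod i : (i <= size p)%N -> d (nth x (x :: p) 0) (nth x (x :: p) i) = i.
  move=> ip; have [le1 le2] : (d x (nth x (x :: p) i) <= i)%N /\
      (d (nth x (x :: p) i) (last x p) <= size p - i)%N.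
    split; first by rewrite uE //; apply: leq_trans (d_word _ _) _; rewrite size_take_min geq_minl.
    have -> : last x p = nth x (x :: p) i * word_eval (@gen3 s) (drop i u).
      rewrite uE // -mulgA -word_eval_cat cat_take_drop -{1}(take_size u) us -uE //.
      by rewrite -last_nth.
    by apply: leq_trans (d_word _ _) _; rewrite size_drop us.
  have := wm_tri gens_generate x (nth x (x :: p) i) (last x p); rewrite -sp.
  rewrite [nth x _ 0]/= => tri; apply/eqP; rewrite eqn_leq le1 -(leq_add2r (size p - i)).
  by rewrite subnKC //; apply: leq_trans tri _; rewrite leq_add2l.
have far' i : (i <= size q)%N ->
    (R < d (nth x (x :: p) (index w (x :: p))) (nth x (x :: q) i))%N.
  by move=> iq; rewrite nth_index //; apply: far; apply: mem_nth.
have wk : (index w (x :: p) <= size p)%N by rewrite -ltnS index_mem.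
have lE : nth x (x :: p) (size p) = nth x (x :: q) (size q) by rewrite -!last_nth.
have fill f : (pair f (path_chain (nth e0 (word_path (@gen3 s) x u)) (size p)) -
    pair f (path_chain (nth e0 (word_path (@gen3 s) x v)) (size q)) = pair f (bind (@cell s) c))%R.
  by rewrite -us -vs !path_chain_word cE.
exact: (log_property (wm0 gens_generate) (wm_sym gens_generate) (wm_tri gens_generate)
  edge cell_norm' near (@cell_cycle s) isop' (step_word _ _ _ us uE) (step_word _ _ _ vs vE)
  geod wk erefl lE far' fill).
Qed.

Theorem Gs_hyperbolic : word_hyperbolic (Gs s).
Proof.
exists gens; split; [exact: gens_finite | exact: gens_generate |].
have [K [P [P0 div]]] := exponential_divergence.
exact: (thin_gromov (wm0 gens_generate) (wm_sym gens_generate) (wm_tri gens_generate)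
  (wm_geodesic gens_generate) div P0).
Qed.

End Hyperbolic.

Theorem proposition3 :
  (forall s : nat, (3 <= s)%N ->
     free_by_cyclic (Gs s) /\
     exists H : set (Gs s),
       [/\ subgroup H, locally_free_subgroup H & ~ free_subgroup H]) /\
  (exists s0 : nat, forall s : nat, (3 <= s)%N -> (s0 <= s)%N ->
     word_hyperbolic (Gs s)).
Proof.
split=> [s s3|]; last by exists 0%N => s s3 _; apply: Gs_hyperbolic; apply: ltnW.
split; first exact: Gs_free_by_cyclic.
exists (@ascending s); split; [exact: ascending_subgroup | | exact: ascending_not_free].
by apply: ascending_locally_free; apply: ltnW.
Qed.
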